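(* The following decision problem is NP-complete: given a connected graph $G$ with $h(G)=2$, decide whether $cfc(G)=2$ or $cfc(G)=3$. In particular, computing $cfc(G)$ is NP-hard.
   Context: All graphs are finite, simple and undirected. In an edge-colored graph, a path is conflict-free if some color is used on exactly one of its edges. An edge-coloring of a connected graph $G$ is a conflict-free connection coloring if every pair of distinct vertices is joined by a conflict-free path; the conflict-free connection number $cfc(G)$ is the minimum number of colors in such a coloring. For a connected graph $G$, let $C(G)$ be the subgraph of $G$ induced by the set of cut-edges of $G$, and $h(G)=\max\{cfc(T): T \text{ a component of } C(G)\}$. (It is known that for a connected graph $G$ with cut-edges, $h(G)\le cfc(G)\le h(G)+1$.) *)

(* Defs.v *)
From mathcomp Require Import all_boot all_algebra.
From mathcomp Require Import boolp classical_sets.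

Set Implicit Arguments.
Unset Strict Implicit.
Unset Printing Implicit Defensive.

(** * Conflict-free connection *)

Section Graphs.
Context {T : finType}.
Implicit Types (e : rel T) (x y : T).

Definition simple_graph e : Prop := symmetric e /\ irreflexive e.

Definition connected e : bool :=
  (0 < #|T|) && [forall x, forall y, connect e x y].

(* Since [p] is a simple path, listing edge colors with multiplicity counts
   each edge of the path exactly once. *)
Definition conflict_free (c : {set T} -> nat) x (p : seq T) : Prop :=
  exists a, count_mem a (pairmap (fun u v => c [set u; v]%SET) x p) = 1.

Definition conflict_free_connection e (c : {set T} -> nat) : Prop :=
  forall x y, x != y -> exists p : seq T,
    [/\ path e x p, last x p = y, uniq (x :: p) & conflict_free c x p].

(* Only the values of [c] on edges matter. *)
Definition cf_colorable e (k : nat) : Prop :=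
  exists c : {set T} -> nat,
    (forall x y, e x y -> c [set x; y]%SET < k) /\ conflict_free_connection e c.

Definition least_cf_colors e (k : nat) : Prop :=
  cf_colorable e k /\ forall j, cf_colorable e j -> k <= j.

(* The default value 0 is only reached when no coloring exists, i.e. when
   [e] is not connected. *)
Definition cfc e : nat := xget 0 (least_cf_colors e).

Definition delete_edge e x y : rel T :=
  fun u v => e u v && ([set u; v] != [set x; y])%SET.

(* Meant for connected [e]. *)
Definition cut_edge e : rel T :=
  fun x y => e x y && ~~ connected (delete_edge e x y).

Definition component e x : rel {y : T | connect e x y} :=
  fun u v => e (val u) (val v).

End Graphs.

Arguments component {T} e x.

(* The vertices of C(G) are the endpoints of cut-edges, so isolated vertices
   of the spanning graph [cut_edge e] are left out. *)
Definition h (T : finType) (e : rel T) : nat :=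
  \max_(x : T | [exists y, cut_edge e x y]) cfc (component (cut_edge e) x).

(** * Deterministic multi-tape Turing machines *)

Definition word := seq bool.
Definition language := word -> Prop.

Inductive move := Left | Stay | Right.

(* Tape alphabet: the blank [None], the two bits [Some (inl b)] and
   finitely many auxiliary symbols [Some (inr a)]. *)
Definition symbol (A : finType) : finType := option (bool + A).

(* Symbols left of the head (nearest first), scanned symbol, symbols right of
   the head; everything beyond the two lists is blank. *)
Definition tape (A : finType) : Type := (seq (symbol A) * symbol A * seq (symbol A))%type.

(* The machine has [ntapes.+1] tapes. *)
Record TM := MkTM {
  ntapes : nat;
  aux : finType;
  state : finType;
  start : state;
  final : pred state;
  trans : state -> {ffun 'I_ntapes.+1 -> symbol aux} ->
          state * ('I_ntapes.+1 -> symbol aux * move)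
}.

Section Tapes.
Context {A : finType}.
Implicit Types (t : tape A) (s : seq (symbol A)).

Definition scanned t : symbol A := t.1.2.

Definition write_move t (am : symbol A * move) : tape A :=
  let: (l, _, r) := t in let: (a, m) := am in
  match m with
  | Left => (behead l, head None l, a :: r)
  | Stay => (l, a, r)
  | Right => (a :: l, head None r, behead r)
  end.

Definition load (w : word) : tape A :=
  let s := [seq Some (inl b) | b <- w] in ([::], head None s, behead s).

Fixpoint leading_bits s : word :=
  if s is Some (inl b) :: s' then b :: leading_bits s' else [::].

(* The word starting under the head and ending before the first non-bit. *)
Definition read t : word := leading_bits (t.1.2 :: t.2).

End Tapes.

Section Runs.
Variable M : TM.

Definition config : Type :=
  (state M * {ffun 'I_(ntapes M).+1 -> tape (aux M)})%type.

(* The i-th input word is written on tape i, the other tapes are blank. *)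
Definition init (ws : seq word) : config :=
  (start M, [ffun i : 'I_(ntapes M).+1 => load (nth [::] ws i)]).

Definition step (c : config) : config :=
  let: (q, ts) := c in
  if final q then c else
  let: (q', act) := trans q [ffun i => scanned (ts i)] in
  (q', [ffun i => write_move (ts i) (act i)]).

Definition halts_with (c : config) (w : word) : Prop :=
  final c.1 /\ read (c.2 ord0) = w.

(* Final configurations are fixed by [step], so this means: [M] halts after
   at most [n] steps with output [w] on tape 0. *)
Definition computes_in (ws : seq word) (w : word) (n : nat) : Prop :=
  halts_with (iter n step (init ws)) w.

End Runs.

(** * NP, reductions and hardness *)

Definition polytime (f : word -> word) : Prop :=
  exists (M : TM) (q : {poly nat}),
    forall x, computes_in M [:: x] (f x) (q.[size x])%R.

Definition polytime_rel (V : word -> word -> bool) : Prop :=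
  exists (M : TM) (q : {poly nat}),
    forall x y, computes_in M [:: x; y] [:: V x y] (q.[size x + size y])%R.

Definition NP (L : language) : Prop :=
  exists (V : word -> word -> bool) (q : {poly nat}), polytime_rel V /\
    forall x, L x <-> exists y : word, size y <= (q.[size x])%R /\ V x y.

(* A decision problem is given by the encodings of its yes-instances and of
   its no-instances; a word may be neither. Membership asks that the set of
   yes-instances be in NP, so words encoding no instance are rejected;
   reductions only produce instances. *)
Definition NP_complete (yes no : language) : Prop :=
  NP yes /\
  forall L, NP L -> exists f, polytime f /\
    forall x, (L x -> yes (f x)) /\ (~ L x -> no (f x)).

(* In an asking state, the word read on the last tape is replaced, in one
   step, by the answer of the oracle. *)
Record oracle_TM := MkOracleTM {
  base :> TM;
  ask : pred (state base);
  resume : state base -> state base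
}.

Definition oracle_step (O : word -> word) (M : oracle_TM) (c : config M) :
    config M :=
  let: (q, ts) := c in
  if ~~ final q && ask q then
    (resume q, [ffun i => if i == ord_max then load (O (read (ts i))) else ts i])
  else step c.

Definition oracle_computes_in (O : word -> word) (M : oracle_TM)
    (ws : seq word) (w : word) (n : nat) : Prop :=
  halts_with (iter n (@oracle_step O M) (init M ws)) w.

(* A computation problem is given by the set of functions solving it. It is
   NP-hard if every NP language is decided by a polynomial-time machine
   that may query an arbitrary solver (polynomial-time Turing reduction). *)
Definition NP_hard (solves : (word -> word) -> Prop) : Prop :=
  forall L, NP L -> exists (M : oracle_TM) (q : {poly nat}),
    forall O, solves O -> forall x,
      oracle_computes_in O M [:: x] [:: `[< L x >]] (q.[size x])%R.

(** * The problems *)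

(* The number of vertices in unary, a separator, and the adjacency matrix. *)
Definition encode (n : nat) (e : rel 'I_n) : word :=
  nseq n true ++ false :: [seq e i j | i <- enum 'I_n, j <- enum 'I_n].

Definition h2_cfc (k : nat) : language := fun w =>
  exists (n : nat) (e : rel 'I_n),
    [/\ w = encode e, simple_graph e, connected e, h e = 2 & cfc e = k].

(* Unary output is harmless: cfc is at most the number of edges. *)
Definition solves_cfc (O : word -> word) : Prop :=
  forall (n : nat) (e : rel 'I_n), simple_graph e -> connected e ->
    O (encode e) = nseq (cfc e) true.

(* Main.v *)
(* That h = cfc = 2 is certified by a 2-colouring of the edges together with,
   for every pair of vertices, a path and a colour that is unique on it.

   Hardness goes from NP through the tableau of a machine to 2-colouring of
   hypergraphs. A hypergraph becomes a graph with a hub U and a path U - A - B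
   of cut edges. A point is a cut edge whose first end is joined to U by a
   diamond with monochromatic paths of both colours; the second end is joined
   to the hyperedges containing the point. A hyperedge is a diamond that ends in
   two pendant edges. Two adjacent cut edges have different colours; hence a
   conflict-free path from B to the leaf behind the pendant edge of colour i has
   colour i from U on, and every hyperedge has points of both colours. Copies of
   a point, linked to a common copy by hyperedges with two members, keep two
   hyperedges from sharing more than one point, so that the converse need only
   be verified on finitely many small configurations. Three colours always
   suffice.

   The reduction and the verifier are given by arithmetical expressions with
   bounded sums. These are compiled to multi-tape machines whose registers are
   head positions; all values are bounded by a polynomial in the length of the
   input, and this bounds the running time. *)
From HB Require Import structures.
From mathcomp Require Import all_boot all_algebra.
From mathcomp Require Import boolp classical_sets.
From mathcomp Require Import zify.
Require Import Defs.


Set Implicit Arguments.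
Unset Strict Implicit.
Unset Printing Implicit Defensive.

(** In a 2-coloured gadget a monochromatic path may come to a point out of another hyperedge instead
    of over the edge from the port of the point. The edge by which it enters a hyperedge then need
    not show the colour of that port edge. The copies deal with this obstacle as well. A link has
    only two members and must be entered in both colours, so no monochromatic path crosses it from
    one member to the other. A copy other than the common one lies in one link and in at most one
    hyperedge of the given hypergraph, and the common copy lies in links only. So the colour in
    which a copy enters its hyperedge is that of its port edge, and the link hands it on, reversed,
    to the common copy, where all hyperedges read it.

    Clauses become hyperedges as in the step from satisfiability to not-all-equal satisfiability:
    one additional point, shared by all clauses, stands for falsity. In the tableau the head is
    fixed and the tape contents shift. This leaves finitely many families of clauses, which depend
    on the machine alone, so that each bit of the graph is an arithmetical function of its place and
    of the input. *)

Notation sym := (symbol unit).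
Definition mark : sym := Some (inr tt).
Definition bit (b : bool) : sym := Some (inl b).

(** * Program fragments on several tapes, with time bounds *)

Section Comps.
Variable K : nat.
Notation tapes := {ffun 'I_K.+1 -> tape unit}.
Notation syms := {ffun 'I_K.+1 -> symbol unit}.
Notation acts := ('I_K.+1 -> sym * move).

(* A program fragment: a transition table whose target [None] means exit. *)
Record comp := Comp {
  cst : finType;
  cstart : cst;
  ctrans : cst -> syms -> option cst * acts }.

Definition scan (ts : tapes) : syms := [ffun i => scanned (ts i)].
Definition perform (ts : tapes) (a : acts) : tapes :=
  [ffun i => write_move (ts i) (a i)].

Definition cstep (c : comp) (x : option (cst c) * tapes) :
    option (cst c) * tapes :=
  if x.1 is Some s then
    let: (s', a) := ctrans s (scan x.2) in (s', perform x.2 a)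
  else x.

Definition exits (c : comp) ts ts' n :=
  exists2 m, m <= n & iter m (@cstep c) (Some (cstart c), ts) = (None, ts').

(** The one simulation argument behind all composite programs: [F] is the step function of the
    larger machine, [emb] places the states of [c] in it, and [emb None] says where it goes on after
    the exit. *)
Lemma exits_embed (c : comp) (X : Type) (F : X -> X)
    (emb : option (cst c) -> tapes -> X) :
  (forall s ts, F (emb (Some s) ts) =
     let: (s', a) := ctrans s (scan ts) in emb s' (perform ts a)) ->
  forall ts ts' n, exits c ts ts' n ->
  exists2 m, m <= n & iter m F (emb (Some (cstart c)) ts) = emb None ts'.
Proof.
move=> HF ts ts' n [m le_mn].
move: (Some (cstart c)) => s; elim: m n s ts le_mn => [|m IH] n s ts le_mn.
  by case=> -> ->; exists 0.
rewrite iterSr /cstep; case: s => [s|] /=; last first.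
  move=> E; exists 0 => //=; congr emb.
  have H : forall k, iter k (@cstep c) (None, ts) = (None, ts).
    by elim=> //= k ->.
  by move: E; rewrite -/(@cstep c) H => -[].
case E: (ctrans s (scan ts)) => [s' a].
case: n le_mn => // n le_mn; case/(IH n) => // k le_kn Ek; exists k.+1 => //.
by rewrite iterSr HF E.
Qed.

Lemma exits_weaken c ts ts' n n' : n <= n' -> exits c ts ts' n -> exits c ts ts' n'.
Proof. by move=> le_n [m le_m E]; exists m => //; apply: leq_trans le_n. Qed.

Definition Act (f : syms -> acts) : comp :=
  @Comp unit tt (fun _ y => (None, f y)).

Lemma exits_Act f ts : exits (Act f) ts (perform ts (f (scan ts))) 1.
Proof. by exists 1. Qed.

Definition noop (y : syms) : acts := fun i => (y i, Stay).

Lemma perform_noop ts : perform ts (noop (scan ts)) = ts.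
Proof. by apply/ffunP=> i; rewrite !ffunE /noop !ffunE; case: (ts i) => -[]. Qed.

Definition Seq (c1 c2 : comp) : comp :=
  @Comp (cst c1 + cst c2)%type (inl (cstart c1))
   (fun s y => match s with
    | inl s => let: (s', a) := ctrans s y in
       (Some (if s' is Some s' then inl s' else inr (cstart c2)), a)
    | inr s => let: (s', a) := ctrans s y in (omap inr s', a)
    end).

Lemma exits_Seq c1 c2 ts1 ts2 ts3 n1 n2 :
  exits c1 ts1 ts2 n1 -> exits c2 ts2 ts3 n2 -> exits (Seq c1 c2) ts1 ts3 (n1 + n2).
Proof.
move=> H1 H2.
pose emb1 (s : option (cst c1)) ts := (Some (if s is Some s then inl s
   else inr (cstart c2)) : option (cst (Seq c1 c2)), ts : tapes).
pose emb2 (s : option (cst c2)) ts := (omap inr s : option (cst (Seq c1 c2)), ts : tapes).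
have [|m1 l1 E1] := @exits_embed c1 _ (@cstep (Seq c1 c2)) emb1 _ _ _ _ H1.
  by move=> s ts; rewrite /emb1 /cstep /=; case: ctrans => [[s'|] a].
have [|m2 l2 E2] := @exits_embed c2 _ (@cstep (Seq c1 c2)) emb2 _ _ _ _ H2.
  by move=> s ts; rewrite /emb2 /cstep /=; case: ctrans => [[s'|] a].
exists (m2 + m1); first by rewrite addnC leq_add.
by rewrite iterD E1 -/(emb2 (Some (cstart c2)) ts2) E2.
Qed.

Definition Ite (tst : syms -> bool) (c1 c2 : comp) : comp :=
  @Comp (option (cst c1 + cst c2))%type None
   (fun s y => match s with
    | None => (Some (Some (if tst y then inl (cstart c1) else inr (cstart c2))), noop y)
    | Some (inl s) => let: (s', a) := ctrans s y in (omap (fun s => Some (inl s)) s', a)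
    | Some (inr s) => let: (s', a) := ctrans s y in (omap (fun s => Some (inr s)) s', a)
    end).

Lemma exits_Ite tst c1 c2 ts ts' n :
  exits (if tst (scan ts) then c1 else c2) ts ts' n ->
  exits (Ite tst c1 c2) ts ts' n.+1.
Proof.
case E: (tst _) => H.
- pose emb1 (s : option (cst c1)) ts :=
    (omap (fun s => Some (inl s)) s : option (cst (Ite tst c1 c2)), ts : tapes).
  have [|m1 l1 E1] := @exits_embed c1 _ (@cstep (Ite tst c1 c2)) emb1 _ _ _ _ H.
    by move=> s ts0; rewrite /emb1 /cstep /=; case: ctrans => [[s'|] a].
  exists m1.+1 => //; rewrite iterSr /cstep /= E perform_noop -/(@cstep (Ite tst c1 c2)).
  exact: E1.
- pose emb1 (s : option (cst c2)) ts :=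
    (omap (fun s => Some (inr s)) s : option (cst (Ite tst c1 c2)), ts : tapes).
  have [|m1 l1 E1] := @exits_embed c2 _ (@cstep (Ite tst c1 c2)) emb1 _ _ _ _ H.
    by move=> s ts0; rewrite /emb1 /cstep /=; case: ctrans => [[s'|] a].
  exists m1.+1 => //; rewrite iterSr /cstep /= E perform_noop -/(@cstep (Ite tst c1 c2)).
  exact: E1.
Qed.

Definition While (tst : syms -> bool) (c : comp) : comp :=
  @Comp (option (cst c)) None
   (fun s y => match s with
    | None => (if tst y then Some (Some (cstart c)) else None, noop y)
    | Some s => let: (s', a) := ctrans s y in (Some s', a)
    end).

Lemma exits_While0 (tst : syms -> bool) c ts : ~~ tst (scan ts) -> exits (While tst c) ts ts 1.
Proof.
by move=> E; exists 1; rewrite //= /cstep /= (negbTE E) perform_noop.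
Qed.

Lemma exits_WhileS (tst : syms -> bool) c ts ts' ts'' n n' :
  tst (scan ts) -> exits c ts ts' n -> exits (While tst c) ts' ts'' n' ->
  exits (While tst c) ts ts'' (n + n').+1.
Proof.
move=> E H [m' l' E'].
pose emb (s : option (cst c)) ts :=
  (Some s : option (cst (While tst c)), ts : tapes).
have [|m1 l1 E1] := @exits_embed c _ (@cstep (While tst c)) emb _ _ _ _ H.
  by move=> s ts0; rewrite /emb /cstep /=; case: ctrans => [[s'|] a].
exists (m' + m1).+1; first by rewrite ltnS addnC leq_add.
rewrite iterSr {2}/cstep /= E perform_noop iterD -/(emb (Some (cstart c)) ts).
by rewrite E1.
Qed.

(* Every tape carries a marker, at position 0, followed by a word. *)
Definition cont (w : word) (p : nat) : sym := nth None (mark :: map bit w) p.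

(** Cells are compared through [nth None], since the lists of a tape may end in explicit blanks. The
    left list has the nearest cell first, which reverses its indices. *)
Definition view (t : tape unit) (p : nat) (w : word) : Prop :=
  [/\ forall i, i < p -> nth None t.1.1 i = cont w (p - i.+1),
      t.1.2 = cont w p & forall i, nth None t.2 i = cont w (p + i.+1)].

Lemma view_right t p w : view t p w -> view (write_move t (scanned t, Right)) p.+1 w.
Proof.
case: t => -[l a] r [/= H1 H2 H3]; split=> /=.
- by case=> [|i] Hi /=; rewrite ?subn1 //= ?subSS; apply: H1; lia.
- by rewrite -nth0 H3 addn1.
- by move=> i; rewrite nth_behead H3; congr cont; lia.
Qed.

Lemma view_left t p w : view t p.+1 w -> view (write_move t (scanned t, Left)) p w.
Proof.
case: t => -[l a] r [/= H1 H2 H3]; split=> /=.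
- by move=> i Hi; rewrite nth_behead H1.
- by rewrite -nth0 H1 // subn1.
- by case=> [|i] /=; rewrite ?H2 ?H3 ?addn1 //; congr cont; lia.
Qed.

Lemma view_stay t p w : view t p w -> view (write_move t (scanned t, Stay)) p w.
Proof. by case: t => -[l a] r. Qed.

Lemma cont_rcons w b p : cont (rcons w b) p =
  if p == (size w).+1 then bit b else cont w p.
Proof.
case: p => [|p] //; rewrite /cont /= map_rcons nth_rcons size_map eqSS.
by case: ltngtP => // H; rewrite nth_default // size_map ltnW.
Qed.

Lemma view_emit t w b : view t (size w).+1 w ->
  view (write_move t (bit b, Right)) (size w).+2 (rcons w b).
Proof.
case: t => -[l a] r [/= H1 H2 H3]; split=> /=.
- case=> [|i] Hi /=; first by rewrite subn1 cont_rcons eqxx.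
  rewrite H1 // cont_rcons subSS ifN //; lia.
- by rewrite -nth0 H3 addn1 cont_rcons ifN //; lia.
- move=> i; rewrite nth_behead H3 cont_rcons ifN; last lia.
  by congr cont; lia.
Qed.

Definition rep (s : nat -> nat) (ws : nat -> word) (ts : tapes) : Prop :=
  forall i : 'I_K.+1, view (ts i) (s i) (ws i).

Variant hoare (c : comp) s ws s' ws' n : Prop :=
  Hoare of forall ts, rep s ws ts -> exists2 ts', exits c ts ts' n & rep s' ws' ts'.

Lemma hoareE c s ws s' ws' n : hoare c s ws s' ws' n ->
  forall ts, rep s ws ts -> exists2 ts', exits c ts ts' n & rep s' ws' ts'.
Proof. by case. Qed.

Definition upd (T : Type) (s : nat -> T) i v := fun j => if j == i then v else s j.

Definition Move (i : nat) (m : move) : comp :=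
  Act (fun y k => (y k, if k == i :> nat then m else Stay)).

Definition Emit (i : nat) (b : bool) : comp :=
  Act (fun y k => if k == i :> nat then (bit b, Right) else (y k, Stay)).

Definition at_ (i : nat) (tst : pred sym) (y : syms) : bool := tst (y (inord i)).
(** The marker stands at position 0 only, so this tests a register for being nonzero. *)
Definition nz : pred sym := fun a => a != mark.
Definition isbit : pred sym := fun a => if a is Some (inl _) then true else false.

Section Hoare.
Variable ws : nat -> word.
Implicit Types s : nat -> nat.

Lemma hoare_weaken c s s' n n' ws' : n <= n' -> hoare c s ws s' ws' n -> hoare c s ws s' ws' n'.
Proof.
by move=> le_n [H]; split=> ts /H [ts' He Hr]; exists ts' => //; apply: exits_weaken He.
Qed.

Lemma hoare_ext c s1 s1' n s2 s2' : s1 =1 s2 -> s1' =1 s2' ->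
  hoare c s1 ws s1' ws n -> hoare c s2 ws s2' ws n.
Proof. by move=> /funext -> /funext ->. Qed.

Lemma hoare_post c s s1' n s2' ws' :
  hoare c s ws s1' ws' n -> s1' =1 s2' -> hoare c s ws s2' ws' n.
Proof. by move=> H /funext <-. Qed.

Lemma hoare_Seq c1 c2 s1 s2 s3 ws1 ws2 ws3 n1 n2 : hoare c1 s1 ws1 s2 ws2 n1 ->
  hoare c2 s2 ws2 s3 ws3 n2 -> hoare (Seq c1 c2) s1 ws1 s3 ws3 (n1 + n2).
Proof.
move=> [H1] [H2]; split=> ts /H1 [ts' He /H2 [ts'' He' Hr]]; exists ts'' => //.
exact: exits_Seq He He'.
Qed.

Lemma hoare_Right i s : hoare (Move i Right) s ws (upd s i (s i).+1) ws 1.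
Proof.
split=> ts H; eexists; first exact: exits_Act.
move=> k; rewrite !ffunE /upd; case: eqP => [<-|_].
  exact: view_right.
exact: view_stay.
Qed.

Lemma hoare_Left i s : 0 < s i -> hoare (Move i Left) s ws (upd s i (s i).-1) ws 1.
Proof.
move=> Hi; split=> ts H; eexists; first exact: exits_Act.
move=> k; rewrite !ffunE /upd; case: eqP => [E|_].
  by apply: view_left; move: (H k); rewrite E prednK.
exact: view_stay.
Qed.

Lemma hoare_Emit i b s : s i = (size (ws i)).+1 ->
  hoare (Emit i b) s ws (upd s i (s i).+1) (upd ws i (rcons (ws i) b)) 1.
Proof.
move=> Hi; split=> ts H; eexists; first exact: exits_Act.
move=> k; rewrite !ffunE /upd; case: eqP => [E|_]; last exact: view_stay.
by rewrite Hi -E; apply: view_emit; move: (H k); rewrite E Hi.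
Qed.

Lemma rep_at s ts i tst : i <= K -> rep s ws ts ->
  at_ i tst (scan ts) = tst (cont (ws i) (s i)).
Proof.
by move=> Hi H; rewrite /at_ !ffunE; have [_ E _] := H (inord i); rewrite /scanned E inordK.
Qed.

Lemma hoare_Ite i tst c1 c2 s s' ws' n : i <= K ->
  hoare (if tst (cont (ws i) (s i)) then c1 else c2) s ws s' ws' n ->
  hoare (Ite (at_ i tst) c1 c2) s ws s' ws' n.+1.
Proof.
move=> Hi [H]; split=> ts Hr; case: (H _ Hr) => ts' He Hr'; exists ts' => //.
by apply: exits_Ite; rewrite (rep_at _ Hi Hr).
Qed.
End Hoare.

(** [S j] and [W j] are the registers and the words before round [j]. The number of rounds is known
    beforehand and [C] bounds every round, so the loop is a for loop and its time a product. *)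
Lemma hoare_While i tst c (S : nat -> nat -> nat) (W : nat -> nat -> word) n C : i <= K ->
  (forall j, j < n -> hoare c (S j) (W j) (S j.+1) (W j.+1) C) ->
  (forall j, j <= n -> tst (cont (W j i) (S j i)) = (j < n)) ->
  hoare (While (at_ i tst) c) (S 0) (W 0) (S n) (W n) (n * C.+1).+1.
Proof.
move=> Hi Hc Ht.
have H : forall k j, j + k = n ->
   hoare (While (at_ i tst) c) (S j) (W j) (S n) (W n) (k * C.+1).+1.
  elim=> [|k IH] j E; split=> ts Hr.
    move: E; rewrite addn0 => E; exists ts; last by rewrite -E.
    by apply: exits_While0; rewrite (rep_at _ Hi Hr) Ht E ?ltnn.
  have lt_jn : j < n by lia.
  have [ts1 He1 Hr1] := hoareE (Hc _ lt_jn) Hr.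
  have [|ts2 He2 Hr2] := hoareE (IH j.+1 _) Hr1; first lia.
  exists ts2 => //; apply: exits_weaken (exits_WhileS _ He1 He2); first lia.
  by rewrite (rep_at _ Hi Hr) Ht // ltnW.
by apply: H; rewrite add0n.
Qed.

Definition Skip : comp := Act noop.

Lemma hoare_Skip s ws : hoare Skip s ws s ws 1.
Proof.
by split=> ts H; exists ts => //; rewrite -{2}[ts]perform_noop; apply: exits_Act.
Qed.

End Comps.

Arguments hoare_Skip {K} s ws.
Arguments hoare_Right {K} ws i s.
Arguments hoare_Left {K ws i s} _.
Arguments hoare_Emit {K ws i} b {s} _.
Arguments hoare_ext {K ws c s1 s1' n s2 s2'} _ _ _.
Arguments hoare_weaken {K ws c s s' n n' ws'} _ _.
Arguments hoare_Seq {K c1 c2 s1 s2 s3 ws1 ws2 ws3 n1 n2} _ _.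
Arguments hoare_Ite {K ws i tst c1 c2 s s' ws' n} _ _.
Arguments hoare_post {K ws c s s1' n s2' ws'} _ _.

(** * Arithmetical expressions and polynomial bounds *)

(* De Bruijn indices; [Len], [Bit] refer to the two input words. *)
Inductive exp :=
  | Var of nat
  | Const of nat
  | Add of exp & exp
  | Sub of exp & exp
  | Len of bool
  | Bit of bool & exp
  | Sum of exp & exp.

Definition scons (T : Type) (a : T) (f : nat -> T) (i : nat) : T :=
  if i is i'.+1 then f i' else a.

Fixpoint eval (e : exp) (iw : bool -> word) (env : nat -> nat) : nat :=
  match e with
  | Var i => env i
  | Const n => n
  | Add a b => eval a iw env + eval b iw env
  | Sub a b => eval a iw env - eval b iw env
  | Len w => size (iw w)
  | Bit w a => nth false (iw w) (eval a iw env)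
  | Sum a b => \sum_(j < eval a iw env) eval b iw (scons (j : nat) env)
  end.

(** The base [n + 2] is at least 2, so that powers of it absorb constants as well as sums, products
    and compositions. Only the final bounds are turned into elements of [{poly nat}]. *)
Definition pbound (f : nat -> nat) : Prop := exists k, forall n, f n <= (n + 2) ^ k.

Lemma pbound_leq f g : (forall n, f n <= g n) -> pbound g -> pbound f.
Proof. by move=> H [k Hk]; exists k => n; apply: leq_trans (H n) (Hk n). Qed.

Lemma pbound_const c : pbound (fun _ => c).
Proof.
exists c => n; apply: (@leq_trans (2 ^ c)); first exact/ltnW/ltn_expl.
by case: c => // c; rewrite leq_exp2r // addn2.
Qed.

Lemma pbound_id : pbound id.
Proof. by exists 1 => n; lia. Qed.

Lemma pbound_mul f g : pbound f -> pbound g -> pbound (fun n => f n * g n).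
Proof. by move=> [k Hk] [l Hl]; exists (k + l) => n; rewrite expnD leq_mul. Qed.

Lemma pbound_add f g : pbound f -> pbound g -> pbound (fun n => f n + g n).
Proof.
move=> [k Hk] [l Hl]; exists (k + l).+1 => n; have := Hk n; have := Hl n.
rewrite expnS expnD; have := expn_gt0 (n + 2) k; have := expn_gt0 (n + 2) l.
rewrite !addn2 /=; nia.
Qed.

Lemma pbound_comp f g : pbound f -> pbound g -> pbound (fun n => f (g n)).
Proof.
move=> [k Hk] [l Hl]; exists (l.+2 * k) => n; apply: leq_trans (Hk _) _.
rewrite expnM; have [->|k_gt0] := posnP k; first by rewrite !expn0.
rewrite leq_exp2r //; have := Hl n; rewrite !expnS.
have := expn_gt0 (n + 2) l; rewrite addn2 /=; nia.
Qed.

Lemma pbound_S f : pbound f -> pbound (fun n => (f n).+1).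
Proof. by move=> H; apply: pbound_leq (pbound_add H (pbound_const 1)) => n; lia. Qed.

Definition within (iw : bool -> word) (env : nat -> nat) (n : nat) :=
  (forall b, size (iw b) <= n) /\ (forall i, env i <= n).

(** Values are held in unary, so a bound on them is a bound on loops. Under a sum the index is
    bounded by the value of the first argument; hence [n + f n]. *)
Lemma eval_bound e : exists2 f, pbound f &
  forall iw env n, within iw env n -> eval e iw env <= f n.
Proof.
elim: e => [i|c|a [f pf Hf] b [g pg Hg]|a [f pf Hf] b [g pg Hg]|w|w a _|a [f pf Hf] b [g pg Hg]] /=.
- by exists id; [apply: pbound_id | move=> iw env n [_]].
- by exists (fun _ => c); [apply: pbound_const | ].
- exists (fun n => f n + g n); first exact: pbound_add.
  by move=> iw env n H; rewrite leq_add ?Hf ?Hg.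
- exists f => // iw env n H; apply: leq_trans (Hf _ _ _ H); lia.
- by exists id; [apply: pbound_id | move=> iw env n []].
- by exists (fun _ => 1); [apply: pbound_const | move=> iw env n _; case: nth].
- exists (fun n => f n * g (n + f n)).
    by apply: pbound_mul => //; apply: pbound_comp => //; apply: pbound_add => //; apply: pbound_id.
  move=> iw env n H; have Ha := Hf _ _ _ H.
  apply: (@leq_trans (\sum_(j < eval a iw env) g (n + f n))).
    apply: leq_sum => j _; apply: Hg; split=> [c|[|i]] /=; case: H => H1 H2.
    + exact: leq_trans (H1 c) (leq_addr _ _).
    + have := ltn_ord j; lia.
    + exact: leq_trans (H2 i) (leq_addr _ _).
  by rewrite sum_nat_const card_ord leq_mul2r Ha orbT.
Qed.

(* Tapes 0 and 1 hold the input words. *)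
Definition wtape (w : bool) : nat := w.

Ltac upd_lia :=
  let i := fresh "i" in move=> i; rewrite /upd /=;
  repeat match goal with |- context [?x == ?y] =>
    case: (@eqP _ x y) => ? end; subst; try congruence; try lia.

(** * Compilation of expressions to counter programs *)

Section Compile.
Variable K : nat.
Notation comp := (comp K).

Definition Drain (a : nat) (c : comp) : comp :=
  While (at_ a nz) (Seq (Move _ a Left) c).

Definition Rewind (a : nat) : comp := Drain a (Skip K).

Fixpoint Incr (n : nat) (d : nat) : comp :=
  if n is n'.+1 then Seq (Move _ d Right) (Incr n' d) else Skip K.

(* Adds the value of [e] to counter [d]; variable [i] is in counter [r i],
   and the counters from [s] on are scratch space, left at zero. *)
Fixpoint cadd (e : exp) (r : nat -> nat) (d s : nat) : comp :=
  match e with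
  | Var i => Seq (Drain (r i) (Seq (Move _ d Right) (Move _ s Right)))
                 (Drain s (Move _ (r i) Right))
  | Const n => Incr n d
  | Add a b => Seq (cadd a r d s) (cadd b r d s)
  | Sub a b => Seq (Seq (cadd a r s s.+2) (cadd b r s.+1 s.+2))
     (Seq (Drain s.+1 (Ite (at_ s nz) (Move _ s Left) (Skip K)))
          (Drain s (Move _ d Right)))
  | Len w => Seq (Move _ (wtape w) Right)
     (Seq (While (at_ (wtape w) isbit) (Seq (Move _ (wtape w) Right) (Move _ d Right)))
          (Rewind (wtape w)))
  | Bit w a => Seq (Seq (cadd a r s s.+1) (Drain s (Move _ (wtape w) Right)))
     (Seq (Move _ (wtape w) Right)
       (Seq (Ite (at_ (wtape w) (pred1 (bit true))) (Move _ d Right) (Skip K))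
            (Rewind (wtape w))))
  | Sum a b => Seq (cadd a r s s.+2)
     (Seq (Drain s (Seq (cadd b (scons s.+1 r) d s.+2) (Move _ s.+1 Right)))
          (Rewind s.+1))
  end.

Fixpoint need (e : exp) : nat :=
  match e with
  | Var _ => 1 | Const _ => 0 | Len _ => 0
  | Add a b => need a + need b
  | Sub a b => need a + need b + 2
  | Bit _ a => need a + 1
  | Sum a b => need a + need b + 2
  end.

Variable ws : nat -> word.
Definition iw (b : bool) : word := ws (wtape b).
Notation hoare c s s' n := (@hoare K c s ws s' ws n).

Lemma nz_cont w p : nz (cont w p) = (0 < p).
Proof.
case: p => [|p]; first by rewrite /nz eqxx.
rewrite /nz /cont /=; have [lt_p|le_p] := ltnP p (size w); last first.
  by rewrite nth_default ?size_map.
by rewrite (nth_map false).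
Qed.

Lemma isbit_cont w p : isbit (cont w p) = (0 < p <= size w).
Proof.
case: p => [|p] //=; rewrite /cont /=; have [lt_p|le_p] := ltnP p (size w).
  by rewrite (nth_map false).
by rewrite nth_default ?size_map.
Qed.

Lemma bit_cont w p : (cont w p.+1 == bit true) = nth false w p.
Proof.
rewrite /cont /=; have [lt_p|le_p] := ltnP p (size w).
  by rewrite (nth_map false) // /bit; case: nth.
by rewrite !nth_default ?size_map.
Qed.

Lemma hoare_Drain a c (S : nat -> nat -> nat) n C : a <= K ->
  (forall j, j <= n -> S j a = n - j) ->
  (forall j, j < n -> hoare c (upd (S j) a (n - j).-1) (S j.+1) C) ->
  hoare (Drain a c) (S 0) (S n) (n * C.+2).+1.
Proof.
move=> aK Ha Hc; apply: (@hoare_While _ _ _ _ S (fun _ => ws)) => //.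
  move=> j lt_jn; rewrite -(add1n C); apply: hoare_Seq (Hc _ lt_jn).
  by rewrite -Ha ?(ltnW lt_jn) //; apply: hoare_Left; rewrite Ha; lia.
by move=> j le_jn; rewrite nz_cont Ha // subn_gt0.
Qed.

Lemma hoare_Rewind s a : a <= K -> hoare (Rewind a) s (upd s a 0) (s a * 3).+1.
Proof.
move=> aK; have := @hoare_Drain a (Skip K) (fun j => upd s a (s a - j)) (s a) 1 aK.
move=> H; refine (hoare_ext _ _ (H _ _)).
- by move=> j; rewrite /upd; case: eqP => [->|]; rewrite ?subn0.
- by move=> j; rewrite /upd subnn.
- by move=> j _; rewrite /upd eqxx.
- by move=> j Hj; refine (hoare_post (hoare_Skip _ _) _); upd_lia.
Qed.

Lemma hoare_Incr n d s : hoare (Incr n d) s (upd s d (s d + n)) n.+1.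
Proof.
elim: n s => [|n IH] s /=.
  by refine (hoare_post (hoare_Skip _ _) _); upd_lia.
rewrite -[n.+2]add1n; apply: hoare_Seq (hoare_Right _ _ _) _.
by refine (hoare_post (IH _) _); upd_lia.
Qed.

Lemma hoare_Transfer (a b : nat) s : a <= K -> a != b ->
  hoare (Drain a (Move _ b Right)) s (upd (upd s a 0) b (s b + s a)) (s a * 3).+1.
Proof.
move=> aK Hab.
have := @hoare_Drain a (Move _ b Right)
  (fun j => upd (upd s a (s a - j)) b (s b + j)) (s a) 1 aK.
move=> H; refine (hoare_ext _ _ (H _ _)); [upd_lia|upd_lia|upd_lia|].
by move=> j Hj; refine (hoare_post (hoare_Right _ _ _) _); upd_lia.
Qed.

Lemma hoare_Dec2 (a b : nat) s : a <= K -> b <= K -> a != b ->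
  hoare (Drain a (Ite (at_ b nz) (Move _ b Left) (Skip K))) s
    (upd (upd s a 0) b (s b - s a)) (s a * 4).+1.
Proof.
move=> aK bK Hab.
have := @hoare_Drain a (Ite (at_ b nz) (Move _ b Left) (Skip K))
  (fun j => upd (upd s a (s a - j)) b (s b - j)) (s a) 2 aK.
move=> H; refine (hoare_ext _ _ (H _ _)); [upd_lia|upd_lia|upd_lia|].
move=> j Hj; apply: hoare_Ite => //; rewrite nz_cont; case: ifPn => Hb.
  by refine (hoare_post (hoare_Left Hb) _); upd_lia.
have {}Hb : s b - j = 0.
  by move: Hb; rewrite /upd; repeat case: eqP => ?; subst; try congruence; lia.
by refine (hoare_post (hoare_Skip _ _) _); upd_lia.
Qed.

Lemma hoare_Scan (w d : nat) s : w <= K -> d != w -> s w = 1 ->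
  hoare (While (at_ w isbit) (Seq (Move _ w Right) (Move _ d Right))) s
    (upd (upd s w (size (ws w)).+1) d (s d + size (ws w))) (size (ws w) * 3).+1.
Proof.
move=> wK Hd Hs.
pose S j := upd (upd s w j.+1) d (s d + j).
have H : hoare (While (at_ w isbit) (Seq (Move _ w Right) (Move _ d Right)))
    (S 0) (S (size (ws w))) (size (ws w) * 3).+1.
  apply: (@hoare_While _ _ _ _ S (fun _ => ws)) => //.
    move=> j Hj; apply: (hoare_Seq (n1 := 1) (n2 := 1) (hoare_Right _ _ _)).
    by refine (hoare_post (hoare_Right _ _ _) _); rewrite /S; upd_lia.
  by move=> j Hj; rewrite isbit_cont /S /upd eqxx eq_sym (negbTE Hd).
by refine (hoare_ext _ _ H); rewrite /S; upd_lia.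
Qed.

End Compile.

Arguments hoare_Rewind {K ws} s {a} _.
Arguments hoare_Scan {K ws w d s} _ _ _.

(** Keeps variables, target and scratch registers apart and away from the input tapes, whose heads
    rest at 0 between operations. *)
Definition scratch (r : nat -> nat) (d s : nat) (st : nat -> nat) : Prop :=
  [/\ forall i, 1 < r i < s, forall i, r i != d, 1 < d < s,
      forall j, s <= j -> st j = 0 & forall w : bool, st w = 0].

(** [C] depends on [e] alone: it is chosen before the number of tapes, the registers and their
    contents. This uniformity lets the body of a sum be charged the same in every round. *)
Lemma cadd_correct e : exists2 C, pbound C & forall K ws r d s st n,
  scratch r d s st -> s + need e <= K.+1 -> within (iw ws) (fun i => st (r i)) n ->
  hoare (cadd K e r d s) st ws (upd st d (st d + eval e (iw ws) (fun i => st (r i)))) ws (C n).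
Proof.
elim: e => [i|c|a [f pf Hf] b [g pg Hg]|a [f pf Hf] b [g pg Hg]|w|w a [f pf Hf]|a [f pf Hf] b [g pg Hg]].
- exists (fun n => (n * 4).+1 + (n * 3).+1).
    apply: pbound_add; apply: pbound_S; apply: pbound_mul;
      by [apply: pbound_id | apply: pbound_const].
  move=> K ws r d s st n [Hr Hrd Hd Hs Hw] Hn [_ Hi]; rewrite /= in Hn *.
  have := Hr i; have := Hrd i; have := Hi i; set x := r i => Hx xd xs.
  have xK : x <= K by lia.
  (* Reading a register empties it; the second copy, in [s], refills it. *)
  have H1 := @hoare_Drain K ws x (Seq (Move K d Right) (Move K s Right))
    (fun j => upd (upd (upd st x (st x - j)) d (st d + j)) s j) (st x) 2 xK.
  have H2 := @hoare_Transfer K ws s x (upd (upd (upd st x 0) d (st d + st x)) s (st x)).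
  apply: (hoare_weaken (n := (st x * 4).+1 + (st x * 3).+1)); first lia.
  apply: (@hoare_Seq _ _ _ _ (upd (upd (upd st x 0) d (st d + st x)) s (st x))).
    refine (hoare_ext _ _ (H1 _ _)).
    + by move: (Hs s (leqnn s)) => ?; upd_lia.
    + by upd_lia.
    + by upd_lia.
    + move=> j Hj; apply: (hoare_Seq (n1 := 1) (n2 := 1) (hoare_Right _ _ _)).
      by refine (hoare_post (hoare_Right _ _ _) _); upd_lia.
  have E : upd (upd (upd st x 0) d (st d + st x)) s (st x) s = st x.
    by rewrite /upd eqxx.
  rewrite E in H2.
  refine (hoare_post (H2 _ _) _); [lia|lia|].
  by move: (Hs s (leqnn s)) => ?; upd_lia.
- exists (fun _ => c.+1); first exact: pbound_const.
  by move=> K ws r d s st n _ _ _; apply: hoare_Incr.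
- exists (fun n => f n + g n); first exact: pbound_add.
  move=> K ws r d s st n Hsc /= Hn Hi; have [Hr Hrd Hd Hs Hw] := Hsc.
  have HE : (fun i => (upd st d (st d + eval a (iw ws) (fun i => st (r i)))) (r i)) = (fun i => st (r i)).
    by apply/funext => i; rewrite /upd (negbTE (Hrd i)).
  apply: (hoare_Seq (Hf _ _ _ _ _ _ _ Hsc _ Hi)); first lia.
  have := Hg K ws r d s (upd st d (st d + eval a (iw ws) (fun i => st (r i)))) n.
  rewrite HE => H; refine (hoare_post (H _ _ _) _) => //; [|lia|upd_lia].
  split=> // [j Hj|w]; rewrite /upd; first by rewrite ifN ?Hs //; lia.
  by rewrite ifN ?Hw //; lia.
- have [fa pfa Hfa] := eval_bound a; have [fb pfb Hfb] := eval_bound b.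
  exists (fun n => (f n + g n) + ((fb n * 4).+1 + (fa n * 3).+1)).
    by do ![apply: pbound_add => // | apply: pbound_S | apply: pbound_mul => // | apply: pbound_const].
  move=> K ws r d s st n [Hr Hrd Hd Hs Hw] /= Hn Hi.
  have := Hfa _ _ _ Hi; have := Hfb _ _ _ Hi.
  set x := eval a (iw ws) _; set y := eval b (iw ws) _ => Hy Hx.
  have Es := Hs s (leqnn s); have Es1 := Hs s.+1 (leqnSn s).
  have HE : (fun i => (upd st s x) (r i)) = (fun i => st (r i)).
    by apply/funext => i; rewrite /upd ifN //; have := Hr i; lia.
  apply: (@hoare_Seq _ _ _ _ (upd (upd st s x) s.+1 y)).
    apply: (@hoare_Seq _ _ _ _ (upd st s x)).
      refine (hoare_post (Hf K ws r s s.+2 st n _ _ Hi) _); [|lia|].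
      + split=> // [i|i||j Hj]; [have := Hr i; lia|have := Hr i; lia|lia|apply: Hs; lia].
      + by rewrite -/x; upd_lia.
    have := Hg K ws r s.+1 s.+2 (upd st s x) n; rewrite HE => H.
    refine (hoare_post (H _ _ Hi) _); [|lia|].
    + split=> // [i|i||j Hj|w]; [have := Hr i; lia|have := Hr i; lia|lia| |];
        rewrite /upd ifN ?Hw ?Hs //; lia.
    + by rewrite -/y; upd_lia.
  apply: (hoare_weaken (n := (y * 4).+1 + ((x - y) * 3).+1)); first lia.
  have H1 := @hoare_Dec2 K ws s.+1 s (upd (upd st s x) s.+1 y).
  have E1 : upd (upd st s x) s.+1 y s.+1 = y by rewrite /upd eqxx.
  have E2 : upd (upd st s x) s.+1 y s = x by rewrite /upd eqxx; case: eqP => //; lia.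
  rewrite E1 E2 in H1; apply: (@hoare_Seq _ _ _ _ (upd st s (x - y))).
    by refine (hoare_post (H1 _ _ _) _); [lia|lia|lia|upd_lia].
  have H2 := @hoare_Transfer K ws s d (upd st s (x - y)).
  have E3 : upd st s (x - y) s = x - y by rewrite /upd eqxx.
  by rewrite E3 in H2; refine (hoare_post (H2 _ _) _); [lia|lia|upd_lia].
- exists (fun n => 1 + ((n * 3).+1 + (n.+1 * 3).+1)).
    by do ![apply: pbound_add | apply: pbound_S | apply: pbound_mul | apply: pbound_const | apply: pbound_id].
  move=> K ws r d s st n [Hr Hrd Hd Hs Hw] /= Hn [Hi _].
  have Hsz := Hi w; rewrite /iw in Hsz *; have Ew := Hw w.
  have wlt : wtape w < 2 by rewrite /wtape; case: (w).
  rewrite -/(wtape w) in Ew; set p := wtape w in wlt Ew Hsz *.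
  apply: (hoare_weaken (n := 1 + ((size (ws p) * 3).+1 + ((size (ws p)).+1 * 3).+1))).
    lia.
  apply: hoare_Seq (hoare_Right _ _ _) _; rewrite Ew.
  apply: hoare_Seq (hoare_Scan (d := d) _ _ _) _; [lia|lia|by rewrite /upd eqxx|].
  set st' := upd _ _ _; have E : st' p = (size (ws p)).+1.
    by rewrite /st' /upd eqxx; case: eqP => //; lia.
  rewrite -E; refine (hoare_post (hoare_Rewind _ _) _); first lia.
  by rewrite /st'; upd_lia.
- have [fa pfa Hfa] := eval_bound a.
  exists (fun n => (f n + (fa n * 3).+1) + (1 + (2 + ((fa n).+1 * 3).+1))).
    by do ![apply: pbound_add => // | apply: pbound_S => // | apply: pbound_mul => // | apply: pbound_const | apply: pbound_id].
  move=> K ws r d s st n [Hr Hrd Hd Hs Hw] /= Hn Hi.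
  have := Hfa _ _ _ Hi; set x := eval a (iw ws) _ => Hx.
  have Es := Hs s (leqnn s); have Ew := Hw w.
  have wlt : wtape w < 2 by rewrite /wtape; case: (w).
  rewrite -/(wtape w) in Ew; rewrite /iw in Hi *; set p := wtape w in wlt Ew *.
  apply: (@hoare_Seq _ _ _ _ (upd st p x)).
    apply: (@hoare_Seq _ _ _ _ (upd st s x)).
      refine (hoare_post (Hf K ws r s s.+1 st n _ _ Hi) _); [|lia|].
      + split=> // [i|i||j Hj]; [have := Hr i; lia|have := Hr i; lia|lia|apply: Hs; lia].
      + by rewrite -/x; upd_lia.
    have H2 := @hoare_Transfer K ws s p (upd st s x).
    have E3 : upd st s x s = x by rewrite /upd eqxx.
    rewrite E3 in H2; apply: hoare_weaken (_ : (x * 3).+1 <= _) _; first lia.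
    by refine (hoare_post (H2 _ _) _); [lia|lia|upd_lia].
  apply: hoare_Seq (hoare_Right _ _ _) _.
  have Ep : upd st p x p = x by rewrite /upd eqxx.
  have Es' : upd (upd st p x) p (upd st p x p).+1 =1 upd st p x.+1 by upd_lia.
  apply: hoare_Seq (hoare_Ite (s' := upd (upd st p x.+1) d (st d + nth false (ws p) x)) (n := 1) _ _) _.
  + lia.
  + rewrite Ep /upd eqxx -/(upd _ _ _) /= bit_cont.
    case: nth => /=.
      by refine (hoare_post (hoare_Right _ _ _) _); upd_lia.
    by refine (hoare_post (hoare_Skip _ _) _); upd_lia.
  + apply: (hoare_weaken (n := (x.+1 * 3).+1)); first lia.
    set st' := upd _ _ _; have E : st' p = x.+1.
      by rewrite /st' /upd eqxx; case: eqP => //; lia.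
    rewrite -E; refine (hoare_post (hoare_Rewind _ _) _); first lia.
    by rewrite /st'; upd_lia.
- have [fa pfa Hfa] := eval_bound a.
  (* In the body the index, at most [fa n], is one more variable; hence [g] at [n + fa n]. *)
  exists (fun n => f n + ((fa n * (g (n + fa n)).+3).+1 + (fa n * 3).+1)).
    by do ![apply: pbound_add => // | apply: pbound_S => // | apply: pbound_mul => // | apply: pbound_const | apply: pbound_id | apply: (pbound_comp pg)].
  move=> K ws r d s st n [Hr Hrd Hd Hs Hw] /= Hn Hi.
  have := Hfa _ _ _ Hi; set x := eval a (iw ws) _ => Hx.
  have Es := Hs s (leqnn s); have Es1 := Hs s.+1 (leqnSn s).
  pose y j := \sum_(k < j) eval b (iw ws) (scons (k : nat) (fun i => st (r i))).
  (* Before round [j]: [s] holds the rounds left, [s.+1] the index, and [d] has received the partial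
     sum. *)
  pose S j := upd (upd (upd st s (x - j)) s.+1 j) d (st d + y j).
  apply: (@hoare_Seq _ _ _ _ (upd st s x)).
    refine (hoare_post (Hf K ws r s s.+2 st n _ _ Hi) _); [|lia|].
    + split=> // [i|i||j Hj]; [have := Hr i; lia|have := Hr i; lia|lia|apply: Hs; lia].
    + by rewrite -/x; upd_lia.
  apply: (@hoare_Seq _ _ _ _ (S x)).
    have H1 := @hoare_Drain K ws s (Seq (cadd K b (scons s.+1 r) d s.+2) (Move K s.+1 Right)) S x (g (n + fa n)).+1.
    apply: (hoare_weaken (n := (x * (g (n + fa n)).+3).+1)).
      by rewrite ltnS leq_mul2r Hx orbT.
    refine (hoare_ext _ _ (H1 _ _ _)) => //; [|lia| |].
    + have E0 : y 0 = 0 by rewrite /y big_ord0.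
      by rewrite /S E0; upd_lia.
    + by rewrite /S; upd_lia.
    + move=> j Hj; rewrite -[(g _).+1]addn1.
      set s1 := upd (S j) s _.
      have E : (fun i => s1 (scons s.+1 r i)) = scons j (fun i => st (r i)).
        apply/funext => -[|i] /=; rewrite /s1 /S /upd.
          by repeat case: eqP => ?; lia.
        by have := Hr i; have := Hrd i; repeat case: eqP => //; lia.
      apply: (@hoare_Seq _ _ _ _ (upd s1 d (s1 d + eval b (iw ws) (fun i => s1 (scons s.+1 r i))))).
        apply: Hg; [|lia|].
        * split; rewrite ?E; [move=> [|i] /=|move=> [|i] /=| | |].
          - lia.
          - have := Hr i; lia.
          - lia.
          - exact: Hrd.
          - lia.
          - move=> k Hk; rewrite /s1 /S /upd; repeat case: eqP => ?; try lia.
            apply: Hs; lia.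
          - by move=> w; rewrite /s1 /S /upd; repeat case: eqP => ?; try lia.
        * rewrite E; case: Hi => Hi1 Hi2; split=> [w|[|i]] /=.
          - exact: leq_trans (Hi1 w) (leq_addr _ _).
          - lia.
          - exact: leq_trans (Hi2 i) (leq_addr _ _).
      have Ey : y j.+1 = y j + eval b (iw ws) (scons j (fun i => st (r i))).
        by rewrite /y big_ord_recr.
      refine (hoare_post (hoare_Right _ _ _) _).
      by rewrite E /s1 /S Ey; upd_lia.
  apply: (hoare_weaken (n := (x * 3).+1)); first lia.
  have E : S x s.+1 = x by rewrite /S /upd eqxx; case: eqP => //; lia.
  rewrite -/(y x); have H1 := @hoare_Rewind K ws (S x) s.+1; rewrite E in H1.
  by refine (hoare_post (H1 _) _); [lia | rewrite /S; upd_lia].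
Qed.


(** * Programs that write a word bit by bit *)

Section Programs.
Variable K : nat.
Notation tapes := {ffun 'I_K.+1 -> tape unit}.

Definition load_all (ins : seq word) : tapes :=
  [ffun i : 'I_K.+1 => load (nth [::] ins i)].

(** A loaded word begins under the head with nothing on its left; one step to the left reaches the
    blank that becomes the marker. *)
Definition Setup : comp K :=
  Seq (Act (fun y k => (y k, Left))) (Act (fun _ _ => (mark, Stay))).

Lemma exits_Setup ins : exists2 ts, exits Setup (load_all ins) ts 2 &
  rep (fun _ => 0) (nth [::] ins) ts.
Proof.
eexists; first exact: exits_Seq (exits_Act _ _) (exits_Act _ _).
move=> i; rewrite !ffunE /load /=; split=> //= j; rewrite add0n /cont /=.
by rewrite -[map _ _]/(map bit _); case: (map bit _) => [|a l]; case: j => [|[|j]] //=.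
Qed.

Lemma nth_None_leading_bits (s : seq sym) : (forall i, nth None s i = None) ->
  leading_bits s = [::].
Proof. by case: s => [|a s] //= H; move: (H 0) => /= ->. Qed.

Definition to_end (j : nat) : comp K :=
  Seq (Move K j Right) (While (at_ j isbit) (Move K j Right)).

Lemma hoare_to_end ws st j : j <= K -> st j = 0 ->
  hoare (to_end j) st ws (upd st j (size (ws j)).+1) ws (size (ws j) * 2 + 2).
Proof.
move=> jK Hj; pose S i := upd st j i.+1.
have H : hoare (While (at_ j isbit) (Move K j Right)) (S 0) ws (S (size (ws j))) ws
    (size (ws j) * 2).+1.
  apply: (@hoare_While _ _ _ _ S (fun _ => ws)) => // i Hi.
    by refine (hoare_post (hoare_Right _ _ _) _); rewrite /S; upd_lia.
  by rewrite isbit_cont /S /upd eqxx.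
apply: (hoare_weaken (n := 1 + (size (ws j) * 2).+1)); first lia.
apply: hoare_Seq H.
by refine (hoare_post (hoare_Right _ _ _) _); rewrite /S; upd_lia.
Qed.

Definition Carry (o j : nat) : comp K :=
  Act (fun y k => if k == j :> nat then (y (inord o), Left)
                  else (y k, if k == o :> nat then Left else Stay)).

(* The word is written from its last bit to its first, the head of the target
   moving left, so that only the cells to its right matter. *)
Lemma exits_Carry (o j : 'I_K.+1) w p (ts : tapes) : o != j -> p <= size w ->
  view (ts o) p w -> leading_bits (ts j).2 = drop p w ->
  exists ts', [/\ exits (While (at_ o isbit) (Carry o j)) ts ts' (p * 2).+1,
    leading_bits (ts' j).2 = w & forall k, k != o -> k != j -> ts' k = ts k].
Proof.
move=> Hoj; have Eoj : (o == j :> nat) = false by exact: negbTE Hoj.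
elim: p ts => [|p IH] ts Hp Ho Hj.
  exists ts; split=> //; last by rewrite Hj drop0.
  apply: exits_While0; rewrite /at_ inord_val ffunE.
  by case: Ho => _ E _; rewrite /scanned E.
set ts1 := perform ts (fun k : 'I_K.+1 => if k == j :> nat then ((scan ts) (inord o), Left)
                  else ((scan ts) k, if k == o :> nat then Left else Stay)).
have Eo : scanned (ts o) = bit (nth false w p).
  by case: Ho => _ E _; rewrite /scanned E /cont /= (nth_map false).
have [||ts' [He Hw Hk]] := IH ts1 (ltnW Hp).
- by rewrite !ffunE Eoj eqxx; apply: view_left.
- rewrite !ffunE eqxx /= inord_val Eo; case: (ts j) Hj => -[l a] r /= ->.
  by rewrite (drop_nth false Hp).
exists ts'; split=> //.
  have -> : (p.+1 * 2).+1 = (1 + (p * 2).+1).+1 by lia.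
  apply: exits_WhileS He; last exact: exits_Act.
  by rewrite /at_ inord_val ffunE Eo.
move=> k ko kj; rewrite Hk // !ffunE.
rewrite [_ == val j](negbTE kj) [_ == val o](negbTE ko).
by case: (ts k) => -[l a] r.
Qed.

Definition zeros (i : nat) : nat := 0.

Section Main.
Variables (eL eB : exp) (j : nat).

Definition otape := 6.

(** Register 2 stays zero and is the value of all free variables; 3 holds the rounds left, 4 the
    place of the bit, 5 the value of [eB] there, and scratch space begins at 7. *)
Definition emit_loop : comp K :=
  Drain 3 (Seq (cadd K eB (scons 4 (fun _ => 2)) 5 7)
    (Seq (Ite (at_ 5 nz) (Emit K otape true) (Emit K otape false))
      (Seq (Rewind K 5) (Move K 4 Right)))).

(** The target head is first sent past the word on its own tape. The word carried over then has only
    blanks on its right, and reading stops at its end. *)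
Definition prog : comp K :=
  Seq Setup (Seq (cadd K eL (fun _ => 2) 3 7) (Seq (Move K otape Right)
   (Seq emit_loop (Seq (to_end j) (Seq (Move K otape Left)
    (Seq (While (at_ otape isbit) (Carry otape j)) (Move K j Right))))))).

Definition output (iw : bool -> word) : word :=
  mkseq (fun i => 0 < eval eB iw (scons i zeros)) (eval eL iw zeros).

Hypothesis HK : 8 + need eL + need eB <= K.
Hypothesis jK : j <= K.
Hypothesis Hj : j < 2 \/ j = K.

(** With [j = 0] the word lands on the output tape. With [j = K] it lands on the tape read by an
    oracle, and the input survives on tape 0, where the final answer will be written behind it. *)
Lemma prog_correct : exists2 f, pbound f & forall ins : seq word, size ins <= 2 ->
  exists ts', [/\ exits prog (load_all ins) ts' (f (sumn (map size ins))),
    read (ts' (inord j)) = output (nth [::] ins) &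
    j <> 0 -> view (ts' ord0) 0 (nth [::] ins 0)].
Proof.
have [CL pCL HCL] := cadd_correct eL.
have [CB pCB HCB] := cadd_correct eB.
have [fL pfL HfL] := eval_bound eL; have [fB pfB HfB] := eval_bound eB.
pose body n := CB (n + fL n) + (2 + ((fB (n + fL n) * 3).+1 + 1)).
exists (fun n => 2 + (CL n + (1 + ((fL n * (body n).+2).+1 + ((n * 2 + 2) +
   (1 + ((fL n * 2).+1 + 1))))))).
  by rewrite /body; do ![apply: pbound_add => // | apply: pbound_S => // | apply: pbound_mul => // |
    apply: pbound_const | apply: pbound_id | apply: (pbound_comp pCB) | apply: (pbound_comp pfB)].
move=> ins size_ins; set N := sumn _.
have HN i : size (nth [::] ins i) <= N.
  rewrite /N; elim: (ins) i => [|w l IH] [|i] //=; first exact: leq_addr.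
  exact: leq_trans (IH i) (leq_addl _ _).
set ws : nat -> word := nth [::] ins.
have Hin : within (fun b : bool => ws b) zeros N by split=> // b; apply: HN.
have HL := HfL _ _ _ Hin; set len := eval eL _ _ in HL.
pose out i := mkseq (fun i => 0 < eval eB (fun b : bool => ws b) (scons i zeros)) i.
pose W i := upd ws otape (out i).
pose S i := upd (upd (upd (fun _ => 0) 3 (len - i)) 4 i) otape i.+1.
have so i : size (out i) = i by rewrite size_mkseq.
have [ts0 He0 Hr0] := exits_Setup ins.
have H1 : hoare (cadd K eL (fun _ => 2) 3 7) (fun _ => 0) ws (upd (fun _ => 0) 3 len) ws (CL N).
  by refine (hoare_post (HCL K ws _ _ _ _ N _ _ _) _) => //; first [lia | upd_lia].
have H2 : hoare (Move K otape Right) (upd (fun _ => 0) 3 len) ws (S 0) ws 1.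
  by refine (hoare_post (hoare_Right _ _ _) _); rewrite /S; upd_lia.
have EW : W 0 = ws.
  apply/funext=> i; rewrite /W /upd; case: eqP => // ->.
  by rewrite /ws nth_default //; apply: leq_trans size_ins _.
have H3 : hoare emit_loop (S 0) ws (S len) (W len) (fL N * (body N).+2).+1.
  apply: (hoare_weaken (n := (len * (body N).+2).+1)); first by rewrite ltnS leq_mul2r HL orbT.
  rewrite -EW; apply: (@hoare_While _ _ _ _ S W); first lia.
  + move=> i Hi; rewrite -[(body N).+1]add1n.
    have Hlt : 0 < S i 3 by rewrite /S /upd /=; lia.
    apply: hoare_Seq (hoare_Left Hlt) _.
    set s1 := upd (S i) 3 _.
    have E : (fun k => s1 (scons 4 (fun _ => 2) k)) = scons i zeros.
      by apply/funext => -[|k].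
    have E' : iw (W i) = (fun b : bool => ws b) by apply/funext => -[].
    set v := eval eB (fun b : bool => ws b) (scons i zeros).
    have Hwi : within (iw (W i)) (scons i zeros) (N + fL N).
      rewrite E'; split=> [b|[|k]] //=; last lia.
      exact: leq_trans (HN b) (leq_addr _ _).
    have Hv : v <= fB (N + fL N) by apply: HfB; rewrite -E'.
    apply: (@hoare_Seq _ _ _ _ (upd s1 5 v)).
      refine (hoare_post (HCB K (W i) _ _ _ _ (N + fL N) _ _ _) _); [|lia| |].
      - split=> //; [by case|by case| |by case].
        by move=> k Hk; rewrite /s1 /S /upd /otape; repeat case: eqP => ?; lia.
      - by rewrite E.
      - by rewrite E E' -/v; rewrite /s1 /S; upd_lia.
    apply: (@hoare_Seq _ _ _ _ (upd (upd s1 5 v) otape i.+2) _ _ (W i.+1)).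
      apply: hoare_Ite; first lia.
      have Hso : upd s1 5 v otape = (size (W i otape)).+1.
        by rewrite /W /upd eqxx so.
      have EW1 b : (0 < v) = b -> upd (W i) otape (rcons (W i otape) b) = W i.+1.
        move=> Eb; apply/funext => k; rewrite /W /upd; case: eqP => // _.
        by rewrite eqxx /out -Eb /mkseq -[in RHS](addn1 i) iotaD map_cat /= cats1 add0n.
      rewrite nz_cont /upd eqxx -/(upd _ _ _) /=.
      by case: ifPn => Hb; [rewrite -(EW1 true Hb) | rewrite -(EW1 false (negbTE Hb))];
        refine (hoare_post (hoare_Emit _ Hso) _); rewrite /s1 /S; upd_lia.
    apply: (@hoare_Seq _ _ _ _ (upd s1 otape i.+2)).
      apply: (hoare_weaken (n := (v * 3).+1)); first lia.
      have Er := @hoare_Rewind K (W i.+1) (upd (upd s1 5 v) otape i.+2) 5.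
      have E5 : upd (upd s1 5 v) otape i.+2 5 = v by rewrite /upd eqxx.
      rewrite E5 in Er; refine (hoare_post (Er _) _); first lia.
      by rewrite /s1 /S; upd_lia.
    by refine (hoare_post (hoare_Right _ _ _) _); rewrite /s1 /S; upd_lia.
  + by move=> i Hi; rewrite nz_cont /S /upd /= subn_gt0.
have jn k : 1 < k < 8 -> (j == k) = false by move=> Hk; apply/eqP; case: Hj; lia.
have Sj i : S i j = 0.
  by rewrite /S /upd /otape !jn.
have Wj i : W i j = ws j.
  by rewrite /W /upd /otape jn.
have H4 : hoare (to_end j) (S len) (W len) (upd (S len) j (size (ws j)).+1) (W len) (N * 2 + 2).
  apply: (hoare_weaken (n := size (ws j) * 2 + 2)); first by rewrite leq_add2r leq_mul2r HN orbT.
  by have := @hoare_to_end (W len) (S len) j jK (Sj len); rewrite Wj.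
pose st5 := upd (upd (S len) j (size (ws j)).+1) otape len.
have jo : j != otape by rewrite /otape; case: Hj; lia.
have H5 : hoare (Move K otape Left) (upd (S len) j (size (ws j)).+1) (W len) st5 (W len) 1.
  have E : upd (S len) j (size (ws j)).+1 otape = len.+1.
    by rewrite /upd eq_sym (negbTE jo) /S /upd eqxx.
  have Hlt : 0 < upd (S len) j (size (ws j)).+1 otape by rewrite E.
  by refine (hoare_post (hoare_Left Hlt) _); rewrite E.
have [ts1 He1 Hr1] := hoareE H1 Hr0; have [ts2 He2 Hr2] := hoareE H2 Hr1.
have [ts3 He3 Hr3] := hoareE H3 Hr2; have [ts4 He4 Hr4] := hoareE H4 Hr3.
have [ts5 He5 Hr5] := hoareE H5 Hr4.
have jv : (inord j : 'I_K.+1) = j :> nat by rewrite inordK.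
have ov : (inord otape : 'I_K.+1) = otape :> nat by rewrite inordK // /otape; lia.
have Hoj : (inord otape : 'I_K.+1) != inord j.
  by rewrite -val_eqE /= ov jv eq_sym.
have Hvo := Hr5 (inord otape); have Hvj := Hr5 (inord j).
rewrite jv Wj {1}/st5 /upd (negbTE jo) eqxx in Hvj.
rewrite ov {1}/st5 /W /upd eqxx in Hvo.
have [||ts6 [He6 Hw6 Hk6]] := exits_Carry Hoj _ Hvo.
- by rewrite so.
- rewrite drop_oversize ?so //; apply: nth_None_leading_bits => i.
  by case: Hvj => _ _ ->; rewrite /cont nth_default //= size_map; lia.
rewrite /= ov jv in He6.
exists (perform ts6 (fun k => (scan ts6 k, if k == j :> nat then Right else Stay))); split.
- have He7 := exits_Act (fun y k => (y k, if k == j :> nat then Right else Stay)) ts6.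
  apply: exits_Seq He0 (exits_Seq He1 (exits_Seq He2 (exits_Seq He3 (exits_Seq He4
    (exits_Seq He5 (exits_Seq _ He7)))))).
  by apply: exits_weaken He6; rewrite ltnS leq_mul2r HL orbT.
- rewrite !ffunE jv eqxx /output -/len -[mkseq _ _]/(out len) -Hw6 /read.
  by case: (ts6 (inord j)) => -[l a] [|b r].
- move=> j0; rewrite !ffunE Hk6 -?val_eqE /= ?jv ?ov // ; last by case: (j) j0.
  rewrite eq_sym; case: eqP => // _.
  suff : view (ts5 ord0) 0 (ws 0) by case: (ts5 ord0) => -[l a] r.
  by have := Hr5 ord0; rewrite /st5 /W /upd /= eq_sym; case: eqP.
Qed.
End Main.
End Programs.

Definition tm_of K (c : comp K) : TM :=
  @MkTM K unit (option (cst c)) (Some (cstart c)) (fun s => ~~ s)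
    (fun s y => if s is Some s then ctrans s y else (None, noop y)).

Lemma exits_tm_of K (c : comp K) ins w n ts : exits c (load_all K ins) ts n ->
  read (ts ord0) = w -> computes_in (tm_of c) ins w n.
Proof.
move=> He Hw; pose emb (s : option (cst c)) ts := (s, ts) : config (tm_of c).
have [|m le_mn E] := @exits_embed _ c _ (@step (tm_of c)) emb _ _ _ _ He.
  by move=> s ts0; rewrite /step /= /emb /=; case: ctrans.
have Efix k : iter k (@step (tm_of c)) (emb None ts) = emb None ts.
  by elim: k => //= k ->.
rewrite /computes_in -(subnK le_mn) iterD -[init _ _]/(emb (Some (cstart c)) (load_all K ins)).
by rewrite E Efix.
Qed.

Lemma pbound_poly f : pbound f -> exists q : {poly nat}, forall n, f n <= (q.[n])%R.
Proof.
case=> k Hk; exists (('X + 2%:P) ^+ k)%R => n; apply: leq_trans (Hk n) _.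
by rewrite horner_exp hornerD hornerX hornerC natrE.
Qed.

Theorem exp_computable eL eB : exists (M : TM) (q : {poly nat}),
  forall ins : seq word, size ins <= 2 ->
    computes_in M ins (output eL eB (nth [::] ins)) (q.[sumn (map size ins)])%R.
Proof.
pose K := 8 + need eL + need eB.
have [|f pf Hf] := @prog_correct K eL eB 0 (leqnn _) isT; first by left.
have [q Hq] := pbound_poly pf; exists (tm_of (prog K eL eB 0)), q => ins /Hf [ts [He Hr _]].
apply: exits_tm_of; first exact: exits_weaken (Hq _) He.
by rewrite -Hr; congr (read (ts _)); apply: val_inj; rewrite /= inordK.
Qed.

(** * Closure properties of the functions given by expressions *)

Definition ctx : Type := ((bool -> word) * (nat -> nat))%type.

Definition dfn (f : ctx -> nat) : Prop :=
  exists e, forall iw env, eval e iw env = f (iw, env).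

Fixpoint ren (r : nat -> nat) (e : exp) : exp :=
  match e with
  | Var i => Var (r i)
  | Const n => Const n
  | Add a b => Add (ren r a) (ren r b)
  | Sub a b => Sub (ren r a) (ren r b)
  | Len w => Len w
  | Bit w a => Bit w (ren r a)
  | Sum a b => Sum (ren r a) (ren (scons 0 (S \o r)) b)
  end.

Lemma eval_ren e r iw env : eval (ren r e) iw env = eval e iw (env \o r).
Proof.
elim: e r env => //= [a IHa b IHb|a IHa b IHb|w a IHa|a IHa b IHb] r env;
  rewrite ?IHa ?IHb //.
apply: eq_bigr => j _; rewrite IHb; congr eval.
by apply/funext => -[|i].
Qed.

Fixpoint subst (s : nat -> exp) (e : exp) : exp :=
  match e with
  | Var i => s i
  | Const n => Const n
  | Add a b => Add (subst s a) (subst s b)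
  | Sub a b => Sub (subst s a) (subst s b)
  | Len w => Len w
  | Bit w a => Bit w (subst s a)
  | Sum a b => Sum (subst s a) (subst (scons (Var 0) (ren S \o s)) b)
  end.

Lemma eval_subst e s iw env :
  eval (subst s e) iw env = eval e iw (fun i => eval (s i) iw env).
Proof.
elim: e s env => //= [a IHa b IHb|a IHa b IHb|w a IHa|a IHa b IHb] s env;
  rewrite ?IHa ?IHb //.
apply: eq_bigr => j _; rewrite IHb; congr eval.
by apply/funext => -[|i] //=; rewrite eval_ren.
Qed.

Section Closure.
Implicit Types (g : ctx) (f a b c : ctx -> nat) (p q : ctx -> bool).

Lemma dfn_var i : dfn (fun g => g.2 i).
Proof. by exists (Var i). Qed.

Lemma dfn_const n : dfn (fun _ => n).
Proof. by exists (Const n). Qed.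

Lemma dfn_add a b : dfn a -> dfn b -> dfn (fun g => a g + b g).
Proof. by move=> [ea Ha] [eb Hb]; exists (Add ea eb) => iw env /=; rewrite Ha Hb. Qed.

Lemma dfn_sub a b : dfn a -> dfn b -> dfn (fun g => a g - b g).
Proof. by move=> [ea Ha] [eb Hb]; exists (Sub ea eb) => iw env /=; rewrite Ha Hb. Qed.

Lemma dfn_size w : dfn (fun g => size (g.1 w)).
Proof. by exists (Len w). Qed.

Lemma dfn_nth w a : dfn a -> dfn (fun g => nth false (g.1 w) (a g)).
Proof. by move=> [ea Ha]; exists (Bit w ea) => iw env /=; rewrite Ha. Qed.

Lemma dfn_sum a (F : ctx -> nat -> nat) : dfn a ->
  dfn (fun g => F (g.1, fun i => g.2 i.+1) (g.2 0)) ->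
  dfn (fun g => \sum_(j < a g) F g j).
Proof.
move=> [ea Ha] [eF HF]; exists (Sum ea eF) => iw env /=; rewrite Ha.
by apply: eq_bigr => j _; rewrite HF.
Qed.

Lemma dfn_sum_nat a (F : ctx -> nat -> nat) : dfn a ->
  dfn (fun g => F (g.1, fun i => g.2 i.+1) (g.2 0)) ->
  dfn (fun g => \sum_(0 <= j < a g) F g j).
Proof.
move=> Ha HF; have [e He] := dfn_sum Ha HF.
by exists e => iw env; rewrite He big_mkord.
Qed.

Lemma dfn_eq a b : a =1 b -> dfn a -> dfn b.
Proof. by move=> /funext ->. Qed.

Lemma dfn_S a : dfn a -> dfn (fun g => (a g).+1).
Proof.
by move=> H; apply: dfn_eq (dfn_add H (dfn_const 1)) => g; rewrite addn1.
Qed.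

Lemma dfn_pred a : dfn a -> dfn (fun g => (a g).-1).
Proof.
by move=> H; apply: dfn_eq (dfn_sub H (dfn_const 1)) => g; rewrite subn1.
Qed.

Lemma dfn_mul a b : dfn a -> dfn b -> dfn (fun g => a g * b g).
Proof.
move=> Ha [eb Hb]; apply: (@dfn_eq (fun g => \sum_(j < a g) b g)).
  by move=> g; rewrite sum_nat_const card_ord.
apply: (@dfn_sum a (fun g _ => b g)) => //.
by exists (ren S eb) => iw env; rewrite eval_ren Hb.
Qed.

Lemma dfn_negb p : dfn (fun g => p g) -> dfn (fun g => ~~ p g).
Proof.
by move=> H; apply: dfn_eq (dfn_sub (dfn_const 1) H) => g; case: (p g).
Qed.

Lemma dfn_leq a b : dfn a -> dfn b -> dfn (fun g => a g <= b g).
Proof.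
move=> Ha Hb; apply: dfn_eq (dfn_sub (dfn_const 1) (dfn_sub Ha Hb)) => g.
by rewrite [a g <= b g]/leq; case: (a g - b g).
Qed.

Lemma dfn_and p q : dfn (fun g => p g) -> dfn (fun g => q g) -> dfn (fun g => p g && q g).
Proof.
by move=> Hp Hq; apply: dfn_eq (dfn_mul Hp Hq) => g; case: (p g); case: (q g).
Qed.

Lemma dfn_or p q : dfn (fun g => p g) -> dfn (fun g => q g) -> dfn (fun g => p g || q g).
Proof.
move=> Hp Hq; apply: dfn_eq (dfn_leq (dfn_const 1) (dfn_add Hp Hq)) => g.
by case: (p g); case: (q g).
Qed.

Lemma dfn_implb p q : dfn (fun g => p g) -> dfn (fun g => q g) -> dfn (fun g => p g ==> q g).
Proof.
by move=> Hp Hq; apply: dfn_eq (dfn_or (dfn_negb Hp) Hq) => g; rewrite implybE.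
Qed.

Lemma dfn_eqn a b : dfn a -> dfn b -> dfn (fun g => a g == b g).
Proof.
move=> Ha Hb; apply: dfn_eq (dfn_and (dfn_leq Ha Hb) (dfn_leq Hb Ha)) => g.
by rewrite eqn_leq.
Qed.

Lemma dfn_eqb p q : dfn (fun g => p g) -> dfn (fun g => q g) -> dfn (fun g => p g == q g).
Proof.
by move=> Hp Hq; apply: dfn_eq (dfn_eqn Hp Hq) => g; case: (p g); case: (q g).
Qed.

Lemma dfn_if p a b : dfn (fun g => p g) -> dfn a -> dfn b ->
  dfn (fun g => if p g then a g else b g).
Proof.
move=> Hp Ha Hb.
apply: dfn_eq (dfn_add (dfn_mul Hp Ha) (dfn_mul (dfn_negb Hp) Hb)) => g.
by case: (p g); rewrite /= ?mul1n ?mul0n ?addn0.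
Qed.

Lemma dfn_ifb p q r : dfn (fun g => p g) -> dfn (fun g => q g) -> dfn (fun g => (r g : bool)) ->
  dfn (fun g => if p g then q g else r g : bool).
Proof.
by move=> Hp Hq Hr; apply: dfn_eq (dfn_if Hp Hq Hr) => g; case: (p g).
Qed.

Lemma dfn_has a (P : ctx -> nat -> bool) : dfn a ->
  dfn (fun g => P (g.1, fun i => g.2 i.+1) (g.2 0)) ->
  dfn (fun g => has (P g) (iota 0 (a g))).
Proof.
move=> Ha HP.
apply: dfn_eq (dfn_leq (dfn_const 1) (dfn_sum (F := fun g j => P g j) Ha HP)) => g.
congr nat_of_bool; rewrite lt0n sum_nat_eq0; apply/idP/hasP.
  case/forallPn => j; rewrite /= -lt0n => Hj; exists (nat_of_ord j); first by rewrite mem_iota /= add0n.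
  by move: Hj; case: (P g j).
case=> j; rewrite mem_iota add0n => /= Hj Pj; apply/forallPn.
by exists (Ordinal Hj); rewrite /= Pj.
Qed.

Lemma dfn_all a (P : ctx -> nat -> bool) : dfn a ->
  dfn (fun g => P (g.1, fun i => g.2 i.+1) (g.2 0)) ->
  dfn (fun g => all (P g) (iota 0 (a g))).
Proof.
move=> Ha HP; apply: dfn_eq (dfn_negb (dfn_has (P := fun g j => ~~ P g j) Ha (dfn_negb HP))) => g.
by rewrite -all_predC; congr nat_of_bool; apply: eq_all => j /=; rewrite negbK.
Qed.

Lemma dfn_subst f (s : nat -> exp) : dfn f ->
  dfn (fun g => f (g.1, fun i => eval (s i) g.1 g.2)).
Proof. by move=> [e He]; exists (subst s e) => iw env; rewrite eval_subst He. Qed.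

(** A function of this kind is analysed only once, with variables as arguments; the actual arguments
    are then substituted. *)
Lemma dfn_comp2 (f : (bool -> word) -> nat -> nat -> nat) a b :
  dfn (fun g => f g.1 (g.2 0) (g.2 1)) -> dfn a -> dfn b -> dfn (fun g => f g.1 (a g) (b g)).
Proof.
move=> Hf [ea Ha] [eb Hb].
apply: dfn_eq (dfn_subst (scons ea (scons eb Var)) Hf) => -[iw env] /=.
by rewrite Ha Hb.
Qed.

Lemma dfn_comp3 (f : (bool -> word) -> nat -> nat -> nat -> nat) a b c :
  dfn (fun g => f g.1 (g.2 0) (g.2 1) (g.2 2)) -> dfn a -> dfn b -> dfn c ->
  dfn (fun g => f g.1 (a g) (b g) (c g)).
Proof.
move=> Hf [ea Ha] [eb Hb] [ec Hc].
apply: dfn_eq (dfn_subst (scons ea (scons eb (scons ec Var))) Hf) => -[iw env] /=.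
by rewrite Ha Hb Hc.
Qed.

Lemma dfn_comp4 (f : (bool -> word) -> nat -> nat -> nat -> nat -> nat) a b c d :
  dfn (fun g => f g.1 (g.2 0) (g.2 1) (g.2 2) (g.2 3)) -> dfn a -> dfn b -> dfn c -> dfn d ->
  dfn (fun g => f g.1 (a g) (b g) (c g) (d g)).
Proof.
move=> Hf [ea Ha] [eb Hb] [ec Hc] [ed Hd].
apply: dfn_eq (dfn_subst (scons ea (scons eb (scons ec (scons ed Var)))) Hf) => -[iw env] /=.
by rewrite Ha Hb Hc Hd.
Qed.

Lemma dfn_exp a k : dfn a -> dfn (fun g => a g ^ k).
Proof.
move=> Ha; elim: k => [|k IH]; first exact: dfn_const.
by apply: dfn_eq (dfn_mul Ha IH) => g; rewrite expnS.
Qed.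

Lemma sum_ltn m n : m <= n -> \sum_(j < n) (j < m : nat) = m.
Proof.
elim: n m => [|n IH] m; first by rewrite leqn0 big_ord0 => /eqP.
rewrite leq_eqVlt ltnS big_ord_recr /= => /orP[/eqP->|Hm]; last first.
  by rewrite IH // ltnNge Hm addn0.
rewrite ltnSn (eq_bigr (fun=> 1)) => [|i _]; last by rewrite ltnS ltnW.
by rewrite sum_nat_const card_ord muln1 addn1.
Qed.

(** The quotient counts the positive multiples of [b] up to [a], all of which are of the form
    [q.+1 * b] with [q < a]. *)
Lemma divn_sum (a b : nat) : a %/ b = \sum_(q < a) ((0 < b) && (q.+1 * b <= a)).
Proof.
have [->|b_gt0] := posnP b; first by rewrite divn0 big1.
rewrite -[LHS](sum_ltn (leq_div a b)); apply: eq_bigr => q _.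
by rewrite /= leq_divRL // b_gt0.
Qed.

End Closure.

Ltac dfn_user := fail.

Ltac dfn_step :=
  match goal with
  | |- dfn (fun g => snd g ?i) => exact: (dfn_var i)
  | |- dfn (fun g => size (fst g ?w)) => exact: (dfn_size w)
  | |- dfn (fun g => nat_of_bool (nth false (fst g ?w) (@?a g))) => apply: dfn_nth
  | |- dfn (fun _ => ?n) => exact: (dfn_const n)
  | |- dfn (fun g => (@?a g).+1) => apply: dfn_S
  | |- dfn (fun g => (@?a g).-1) => apply: dfn_pred
  | |- dfn (fun g => @?a g + @?b g) => apply: dfn_add
  | |- dfn (fun g => @?a g - @?b g) => apply: dfn_sub
  | |- dfn (fun g => @?a g * @?b g) => apply: dfn_mul
  | |- dfn (fun g => @?a g ^ ?k) => apply: dfn_exp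
  | |- dfn (fun g => nat_of_bool (@?a g <= @?b g)) => apply: dfn_leq
  | |- dfn (fun g => nat_of_bool (@?a g && @?b g)) => apply: dfn_and
  | |- dfn (fun g => nat_of_bool (@?a g || @?b g)) => apply: dfn_or
  | |- dfn (fun g => nat_of_bool (@?a g ==> @?b g)) => apply: dfn_implb
  | |- dfn (fun g => nat_of_bool (~~ @?a g)) => apply: dfn_negb
  | |- dfn (fun g => nat_of_bool (@?a g == @?b g)) => first [apply: dfn_eqn | apply: dfn_eqb]
  | |- dfn (fun g => nat_of_bool (all (@?P g) (iota 0 (@?a g)))) =>
       apply: dfn_all; cbv beta; cbn [fst snd]
  | |- dfn (fun g => nat_of_bool (has (@?P g) (iota 0 (@?a g)))) =>
       apply: dfn_has; cbv beta; cbn [fst snd]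
  | |- dfn (fun g => nat_of_bool (@?a g)) => first [dfn_user | apply: dfn_ifb]
  | _ => first [dfn_user | apply: dfn_sum_nat; cbv beta; cbn [fst snd] | apply: dfn_if]
  end.

Ltac dfn := cbn [fst snd]; repeat (dfn_step; cbv beta).

Lemma dfn_div a b : dfn a -> dfn b -> dfn (fun g => a g %/ b g).
Proof.
apply: (dfn_comp2 (f := fun _ m n => m %/ n)).
apply: (@dfn_eq (fun g => \sum_(0 <= q < g.2 0) ((0 < g.2 1) && (q.+1 * g.2 1 <= g.2 0)))).
  by move=> g; rewrite [RHS]divn_sum big_mkord.
by dfn.
Qed.

Lemma dfn_mod a b : dfn a -> dfn b -> dfn (fun g => a g %% b g).
Proof.
move=> Ha Hb; apply: dfn_eq (dfn_sub Ha (dfn_mul (dfn_div Ha Hb) Hb)) => g.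
by rewrite {1}(divn_eq (a g) (b g)) addKn.
Qed.

Ltac dfn_user ::=
  match goal with
  | |- dfn (fun g => @?a g %/ @?b g) => apply: dfn_div
  | |- dfn (fun g => @?a g %% @?b g) => apply: dfn_mod
  end.

Lemma output_mkseq eL eB (L : ctx -> nat) (B : ctx -> bool) iw :
  (forall iw env, eval eL iw env = L (iw, env)) ->
  (forall iw env, eval eB iw env = B (iw, env)) ->
  output eL eB iw = mkseq (fun i => B (iw, scons i zeros)) (L (iw, zeros)).
Proof.
move=> HL HB; rewrite /output HL; apply: eq_mkseq => i.
by rewrite HB; case: (B _).
Qed.

Lemma polytime_dfn (L : word -> nat) (B : word -> nat -> bool) :
  dfn (fun g => L (g.1 false)) -> dfn (fun g => B (g.1 false) (g.2 0)) ->
  polytime (fun x => mkseq (B x) (L x)).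
Proof.
move=> [eL HL] [eB HB]; have [M [q Hq]] := exp_computable eL eB.
exists M, q => x; have := Hq [:: x] isT.
by rewrite (@output_mkseq eL eB (fun g => L (g.1 false)) (fun g => B (g.1 false) (g.2 0)) _ HL HB) /= addn0.
Qed.

Lemma polytime_rel_dfn (V : word -> word -> bool) :
  dfn (fun g => V (g.1 false) (g.1 true)) -> polytime_rel V.
Proof.
move=> [eB HB]; have [M [q Hq]] := exp_computable (Const 1) eB.
exists M, q => x y; have := Hq [:: x; y] isT.
by rewrite (@output_mkseq (Const 1) eB (fun _ => 1) (fun g => V (g.1 false) (g.1 true)) _ _ HB) //= addn0.
Qed.

(** * Conflict-free colourings of arbitrary graphs *)

Lemma mem_pairmap (T1 : eqType) (T2 : eqType) (f : T1 -> T1 -> T2) x p a :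
  a \in pairmap f x p -> exists u v, [/\ u \in x :: p, v \in p & a = f u v].
Proof.
elim: p x => //= y p IH x; rewrite inE => /orP[/eqP->|/IH [u [v [Hu Hv ->]]]].
  by exists x, y; rewrite !mem_head.
by exists u, v; split=> //; rewrite inE ?Hu ?Hv orbT.
Qed.

Section Colorability.
Variable T : finType.
Implicit Types (e : rel T) (c : {set T} -> nat) (x y z : T) (p q : seq T).

Definition cf_path e c x y : Prop :=
  exists p, [/\ path e x p, last x p = y, uniq (x :: p) & conflict_free c x p].

Lemma cf_colorable_leq e k k' : k <= k' -> cf_colorable e k -> cf_colorable e k'.
Proof.
move=> le_k [c [Hc Hp]]; exists c; split=> // x y /Hc H; exact: leq_trans H le_k.
Qed.

(** If distinct edges have distinct colours, then every simple path is conflict-free, already by its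
    first edge. So [cfc] is a true minimum on connected graphs and not the default value. *)
Lemma cf_colorable_exists e : (forall x y, connect e x y) -> exists k, cf_colorable e k.
Proof.
move=> He; exists #|{: {set T}}|, (fun S => enum_rank S : nat); split=> [x y _|x y xy].
  exact: ltn_ord.
have /connectP [p0 Hp0 Ey] := He x y; rewrite {}Ey in xy *.
case/shortenP: Hp0 xy => p Hp Up _ xy; exists p; split=> //.
case: p Hp Up xy => [|z p] /= Hp Up xy; first by rewrite eqxx in xy.
exists (enum_rank [set x; z] : nat); rewrite /= eqxx add1n; congr _.+1.
apply/eqP; rewrite -leqn0 leqNgt -has_count; apply/hasPn => a /mem_pairmap.
case=> u [v [Hu Hv ->]]; apply/negP => /eqP /val_inj /enum_rank_inj E.
have : x \in [set u; v]%SET by rewrite E !inE eqxx.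
have Hv' : v \in z :: p by rewrite inE Hv orbT.
by case/andP: Up => Ux _; rewrite !inE => /orP[]/eqP Ex; move: Ux; rewrite Ex ?Hu ?Hv'.
Qed.

Lemma least_exists (P : nat -> Prop) : (exists k, P k) ->
  exists k, P k /\ forall j, P j -> k <= j.
Proof.
move=> H; have H' : exists k, `[< P k >] by case: H => k Hk; exists k; apply/asboolP.
exists (ex_minn H'); case: ex_minnP => k /asboolP Hk Hm; split=> // j Hj.
by apply: Hm; apply/asboolP.
Qed.

Lemma cfc_least e : (exists k, cf_colorable e k) -> least_cf_colors e (cfc e).
Proof. by move=> /least_exists [k Hk]; apply: (xgetPex 0); exists k. Qed.

Lemma cfc_leq e k : cf_colorable e k -> cfc e <= k.
Proof. by move=> H; have [_ Hm] := cfc_least (ex_intro _ k H); apply: Hm. Qed.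

Lemma cfc_eq e k : cf_colorable e k -> (forall j, j < k -> ~ cf_colorable e j) -> cfc e = k.
Proof.
move=> Hk Hj; have [H1 H2] := cfc_least (ex_intro _ k Hk).
apply/eqP; rewrite eqn_leq H2 //= leqNgt; apply/negP => /Hj; exact.
Qed.

Lemma cfc_colorable e k : 0 < k -> cfc e = k -> cf_colorable e k.
Proof.
move=> k_gt0 E; have [[j Hj]|N] := pselect (exists k, cf_colorable e k).
  by have [] := cfc_least (ex_intro _ j Hj); rewrite E.
have E0 : cfc e = 0.
  rewrite /cfc; case: xgetP => // j _ [Hj _]; case: N; by exists j.
by rewrite -E E0 in k_gt0.
Qed.

Lemma cf_path_edge e c x y : e x y -> x != y -> cf_path e c x y.
Proof.
move=> He xy; exists [:: y]; rewrite /= He inE xy; split=> //.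
by exists (c [set x; y]); rewrite /= eqxx.
Qed.

(** With a single colour only paths of one edge are conflict-free. *)
Lemma cf_colorable_gt1 e x z j : x != z -> ~~ e x z -> cf_colorable e j -> 1 < j.
Proof.
move=> xz Nxz [c [Hc /(_ _ _ xz) [p [Hp Ep Up [a Ca]]]]]; rewrite ltnNge; apply/negP => Hj.
have H0 : pairmap (fun u v => c [set u; v]%SET) x p = nseq (size p) 0.
  elim: p x Hp {xz Nxz Ep Up Ca} => //= y p IH x /andP[/Hc Hxy Hp]; rewrite IH //.
  by have -> : c [set x; y]%SET = 0 by lia.
rewrite H0 count_nseq in Ca; have : size p = 1.
  by move: Ca; rewrite /=; case: (_ == _); rewrite ?mul1n ?mul0n.
case: p Hp Ep {Up Ca H0} => [|w [|]] //= /andP[Hxw _] Ew _.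
by rewrite -Ew Hxw in Nxz.
Qed.

End Colorability.

(** * Cut edges and the number [h] *)

Section CutEdges.
Variables (T : finType) (e : rel T).
Hypotheses (sym_e : symmetric e) (irr_e : irreflexive e) (conn_e : connected e).
Implicit Types (x y z : T) (p q : seq T).

Local Notation del := (delete_edge e).

Lemma connected_connect x y : connect e x y.
Proof. by move: conn_e => /andP[_ /forallP/(_ x)/forallP]. Qed.

Lemma sym_del x y : symmetric (del x y).
Proof. by move=> u v; rewrite /delete_edge sym_e [[set u; v]%SET]finset.setUC. Qed.

Lemma cut_edgeE x y : cut_edge e x y = e x y && ~~ connect (del x y) x y.
Proof.
rewrite /cut_edge; case: (boolP (e x y)) => //= exy; congr (~~ _).
rewrite /connected; case/andP: conn_e => -> _ /=; apply/forallP/idP => [/(_ x)/forallP|H u].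
  exact.
apply/forallP => v; have /connectP [p + ->] := connected_connect u v.
elim: p u => [|w p IH] u //= /andP[euw /IH]; apply: connect_trans.
have [E|N] := eqVneq [set u; w]%SET [set x; y]%SET; last first.
  by apply: connect1; rewrite /delete_edge euw.
have : w != u by apply: contraTneq euw => ->; rewrite irr_e.
have : u \in [set x; y]%SET by rewrite -E !inE eqxx.
have : w \in [set x; y]%SET by rewrite -E !inE eqxx orbT.
rewrite !inE => /orP[]/eqP-> /orP[]/eqP->; rewrite ?eqxx // => _.
by rewrite sym_connect_sym //; apply: sym_del.
Qed.

Lemma sym_cut : symmetric (cut_edge e).
Proof.
move=> x y; rewrite !cut_edgeE sym_e; congr (_ && ~~ _).
have -> : del y x = del x y by apply/funext=> u; rewrite /delete_edge finset.setUC.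
exact: sym_connect_sym (@sym_del _ _) _ _.
Qed.

Lemma cut_edge_sub x y : cut_edge e x y -> e x y.
Proof. by case/andP. Qed.

Lemma path_del x y u p : path e u p ->
  (x \notin u :: p) || (y \notin u :: p) -> path (del x y) u p.
Proof.
elim: p u => //= v p IH u /andP[euv Hp] H; rewrite {1}/delete_edge euv /= IH //; last first.
  by case/orP: H; rewrite inE negb_or => /andP[_ ->]; rewrite ?orbT.
rewrite andbT; apply/eqP => E.
have : x \in [set u; v]%SET by rewrite E !inE eqxx.
have : y \in [set u; v]%SET by rewrite E !inE eqxx orbT.
move: H; rewrite !inE !negb_or => H.
by move=> Hy Hx; case/orP: H => /and3P[H1 H2 _]; move: Hx Hy; rewrite ?(negbTE H1) ?(negbTE H2).
Qed.

(** Where another path first differs, the remainders of both paths would join the ends of the cut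
    edge without using it. *)
Lemma cut_path_unique x p q : path (cut_edge e) x p -> uniq (x :: p) ->
  path e x q -> uniq (x :: q) -> last x p = last x q -> q = p.
Proof.
elim: p x q => [|w p IH] x q /=.
  case: q => //= v q _ _ _ /andP[H _] E; by rewrite E mem_last in H.
move=> /andP[xw Hp] /andP[Ux Up]; case: q => [|v q] /=.
  by move=> _ _ E; rewrite -E mem_last in Ux.
move=> /andP[xv Hq] /andP[Vx Vq] E.
suff Ev : v = w by subst v; congr (_ :: _); apply: IH E.
apply/eqP; apply: contraTT xw => Nvw; rewrite cut_edgeE negb_and negbK; apply/orP; right.
have Hp' : path e w p by apply: sub_path Hp => a b /cut_edge_sub.
have H1 : connect (del x w) w (last w p).
  by apply/connectP; exists p => //; apply: path_del => //; rewrite Ux.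
have H2 : connect (del x w) v (last v q).
  by apply/connectP; exists q => //; apply: path_del => //; rewrite Vx.
have H3 : del x w x v.
  rewrite /delete_edge xv /=; apply: contraNneq Nvw => ES.
  have : v \in [set x; w]%SET by rewrite -ES !inE eqxx orbT.
  rewrite !inE => /orP[/eqP Ex|//]; by rewrite Ex irr_e in xv.
rewrite -E in H2; apply: connect_trans (connect1 H3) _; apply: connect_trans H2 _.
by rewrite sym_connect_sym //; apply: sym_del.
Qed.

Lemma path_component (f : rel T) x0 (u : {y : T | connect f x0 y}) p : path f (val u) p ->
  exists2 p', map val p' = p & path (component f x0) u p'.
Proof.
elim: p u => [|w p IH] u /=; first by exists [::].
case/andP=> uw Hp; have Hw : connect f x0 w by apply: connect_trans (valP u) (connect1 uw).
have [p' Ep Hp'] := IH (exist _ w Hw) Hp.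
by exists (exist _ w Hw :: p'); rewrite /= ?Ep //; apply/andP.
Qed.

Lemma component_colorable (f : rel T) c k x0 : symmetric f ->
  (forall x y, f x y -> c [set x; y] < k) ->
  (forall x y, x != y -> connect f x y -> cf_path f c x y) ->
  cf_colorable (component f x0) k.
Proof.
move=> sym_f Hc Hp.
have Eset (u v : {y : T | connect f x0 y}) :
    (val @: [set u; v])%SET = [set val u; val v]%SET by rewrite imsetU1 imset_set1.
exists (fun S : {set {y : T | connect f x0 y}} => c (val @: S)%SET); split=> [u v uv|u v uv].
  by rewrite Eset; apply: Hc.
have Huv : connect f (val u) (val v).
  by apply: connect_trans (valP v); rewrite sym_connect_sym //; apply: valP.
have [p [Hpp Ep Up [a Ha]]] := Hp _ _ uv Huv; have [p' Ep' Hp'] := path_component Hpp.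
exists p'; split=> //.
- by apply: val_inj; rewrite -last_map Ep'.
- by rewrite -(map_inj_uniq val_inj) /= Ep'.
- exists a; rewrite -{}Ha; congr (count_mem a _); move: Ep' => <-.
  by elim: (p') (u) => //= w l IH z; rewrite Eset IH.
Qed.

Lemma h_leq k c : (forall x y, cut_edge e x y -> c [set x; y] < k) ->
  (forall x y, x != y -> connect (cut_edge e) x y -> cf_path (cut_edge e) c x y) ->
  h e <= k.
Proof.
move=> Hc Hp; apply/bigmax_leqP => x _; apply: cfc_leq.
exact: component_colorable sym_cut Hc Hp.
Qed.

(** Within a component of the cut edges the conflict-free path can only be the path of cut edges, so
    a colouring of the whole graph restricts to the component. *)
Lemma h_leq2 : cf_colorable e 2 -> h e <= 2.
Proof.
case=> c [Hc Hp]; apply: (@h_leq 2 c) => [x y /cut_edge_sub/Hc //|x y xy].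
case/connectP => p0 Hp0 Ey; rewrite {}Ey in xy *.
case/shortenP: Hp0 xy => p Hpp Up _ xy; have [q [Hq Eq Uq Cq]] := Hp _ _ xy.
by rewrite (cut_path_unique Hpp Up Hq Uq (esym Eq)) in Cq; exists p.
Qed.

(** An edge between [x] and [z] would close a triangle through the cut edge from [x] to [y]. *)
Lemma cut_edge_path2 x y z : x != z -> cut_edge e x y -> cut_edge e y z -> ~~ e x z.
Proof.
move=> xz xy yz; apply: contraL xy => exz; rewrite cut_edgeE negb_and negbK.
apply/orP; right; have eyz := cut_edge_sub yz.
have Ny : y != z by apply: contraTneq eyz => ->; rewrite irr_e.
apply/connectP; exists [:: z; y] => //=; rewrite andbT.
rewrite /delete_edge exz sym_e eyz /=; apply/andP; split; apply/eqP => E.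
  have : z \in [set x; y]%SET by rewrite -E !inE eqxx orbT.
  by rewrite !inE eq_sym (negbTE xz) eq_sym (negbTE Ny).
have : z \in [set x; y]%SET by rewrite -E !inE eqxx.
by rewrite !inE eq_sym (negbTE xz) eq_sym (negbTE Ny).
Qed.

Lemma h_geq2 x y z : x != z -> cut_edge e x y -> cut_edge e y z -> 1 < h e.
Proof.
move=> xz xy yz; have Nxz := cut_edge_path2 xz xy yz.
have Px : [exists y, cut_edge e x y] by apply/existsP; exists y.
have Hm : cfc (component (cut_edge e) x) <= h e by apply: (bigmax_sup x).
apply: leq_trans Hm.
have [|Hc _] := @cfc_least _ (component (cut_edge e) x).
  apply: cf_colorable_exists => u v.
  have Huv : connect (cut_edge e) (val u) (val v).
    by apply: connect_trans (valP v); rewrite sym_connect_sym; [apply: valP | apply: sym_cut].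
  case/connectP: Huv => p Hpp Ev; have [p' Ep Hp'] := path_component Hpp.
  by apply/connectP; exists p' => //; apply: val_inj; rewrite -last_map Ep.
have Hz : connect (cut_edge e) x z by apply: connect_trans (connect1 xy) (connect1 yz).
pose u : {y : T | connect (cut_edge e) x y} := exist _ x (connect0 _ x).
pose v : {y : T | connect (cut_edge e) x y} := exist _ z Hz.
apply: (@cf_colorable_gt1 _ _ u v) Hc => //.
by apply: contra Nxz; rewrite /component /=; apply: cut_edge_sub.
Qed.

Lemma h2_cut : h e = 2 -> exists x y z, [/\ x != z, cut_edge e x y & cut_edge e y z].
Proof.
move=> Eh; have [//|N] := pselect (exists x y z, [/\ x != z, cut_edge e x y & cut_edge e y z]).
suff : h e <= 1 by rewrite Eh.
apply: (@h_leq 1 (fun _ => 0)) => // x y xy.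
case/connectP => p0 Hp0 Ey; rewrite {}Ey in xy *.
case/shortenP: Hp0 xy => p Hpp Up _ xy; case: p Hpp Up xy => [|w [|w' p]] /=; rewrite ?eqxx //.
  by rewrite andbT => xw _ xnw; apply: cf_path_edge.
move=> /and3P[xw ww' _] /andP[Ux _] _; case: N; exists x, w, w'; split=> //.
by move: Ux; rewrite !inE !negb_or => /and3P[].
Qed.

(** Two extremal numbers are replaced by existence statements that a certificate can carry: the
    colouring bounds both from above, and two adjacent cut edges bound both from below. *)
Lemma h2_cfc2 : (h e = 2 /\ cfc e = 2) <->
  (cf_colorable e 2 /\ exists x y z, [/\ x != z, cut_edge e x y & cut_edge e y z]).
Proof.
split=> [[Hh Hc]|[Hc [x [y [z [xz xy yz]]]]]].
  by split; [apply: cfc_colorable Hc | apply: h2_cut].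
split; first by apply/eqP; rewrite eqn_leq h_leq2 ?(h_geq2 xz xy yz).
apply: cfc_eq => // j Hj Cj.
have := cf_colorable_gt1 xz (cut_edge_path2 xz xy yz) Cj; lia.
Qed.

End CutEdges.

(** * The gadget graph and its colourings *)

Definition ident : Type := (nat * nat)%type.
Definition vertex : Type := (nat * ident)%type.

(* Kinds of vertices.  0: the hub, U = (0, 0), A = (0, 1), B = (0, 2);
   1 and 2: the middle vertices of the two long sides of the diamond
   between U and the port, which has kind 3, of an element y; 4: the element y;
   5 and 6: the ends T0 and T3 of the diamond of a hyperedge t, with middle
   vertices of kind 7 and 8; 9 and 10: the two leaves attached to T3. *)
Section Gadget.
Variables (inc : rel ident) (vy vt : pred ident).

Definition valid (v : vertex) : bool :=
  match v.1 with
  | 0 => (v.2.1 == 0) && (v.2.2 < 3)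
  | 1 | 2 | 3 | 4 => vy v.2
  | 5 | 6 | 7 | 8 | 9 | 10 => vt v.2
  | _ => false
  end.

Definition arc (v w : vertex) : bool :=
  match v.1, w.1 with
  | 0, 0 => w.2.2 == v.2.2.+1
  | 0, 1 | 0, 2 | 0, 3 => v.2.2 == 0
  | 1, 3 | 2, 3 | 3, 4 => v.2 == w.2
  | 4, 5 => inc v.2 w.2
  | 5, 6 | 5, 7 | 5, 8 | 7, 6 | 8, 6 | 6, 9 | 6, 10 => v.2 == w.2
  | _, _ => false
  end.

Definition gadget_adj (v w : vertex) : bool :=
  [&& valid v, valid w & arc v w || arc w v].

(** A colour depends on the kinds of both ends and on the identity of the tail. In particular an
    element shows the same colour to all of its hyperedges. *)
Definition ecol (f : nat -> nat -> ident -> nat) (v w : vertex) : nat :=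
  if arc v w then f v.1 w.1 v.2 else f w.1 v.1 w.2.

Definition cf_joined (f : nat -> nat -> ident -> nat) (x y : vertex) : Prop :=
  exists p, [/\ path gadget_adj x p, last x p = y, uniq (x :: p)
    & exists a, count_mem a (pairmap (ecol f) x p) = 1].

Lemma adj_sym v w : gadget_adj v w = gadget_adj w v.
Proof. by rewrite /gadget_adj andbCA orbC. Qed.

Lemma arc_asym v w : arc v w -> ~~ arc w v.
Proof.
case: v => k i; case: w => l j; rewrite /arc /=.
by do 11?[case: k => [|k]] => //; do 11?[case: l => [|l]] => //= /eqP->; rewrite neq_ltn ltnS leqnSn.
Qed.

Lemma adj_irr v : gadget_adj v v = false.
Proof.
apply/negP => /and3P[_ _]; rewrite orbb => H; by have := arc_asym H; rewrite H.
Qed.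

Lemma ecol_sym f v w : arc v w || arc w v -> ecol f v w = ecol f w v.
Proof.
rewrite /ecol; case: ifP => [H _|_ /= ->//]; by rewrite (negbTE (arc_asym H)).
Qed.

End Gadget.

(** Each diamond is a chord of colour 0, a long side of colour 1 and a long side with one edge of
    either colour. An element has the colour [sig] on the edge from its port and on those to its
    hyperedges. *)
Definition col2 (sig : ident -> bool) (k l : nat) (i : ident) : nat :=
  match k, l with
  | 0, 0 => i.2
  | 0, 1 | 1, 3 | 2, 3 | 5, 7 | 7, 6 | 8, 6 | 6, 10 => 1
  | 3, 4 | 4, 5 => sig i
  | _, _ => 0
  end.

(** No colour depends on an element or a hyperedge, so this colouring serves every hypergraph. *)
Definition col3 (k l : nat) (i : ident) : nat :=
  match k, l with
  | 0, 0 => i.2.*2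
  | 0, 1 | 2, 3 | 8, 6 => 2
  | 1, 3 | 3, 4 | 5, 7 | 7, 6 | 5, 8 | 6, 10 => 1
  | _, _ => 0
  end.

(** ** Small configurations *)

Definition sinc (l : seq (nat * nat)) : rel ident := fun y t => (y.2, t.2) \in l.
Definition sid (n : nat) : pred ident := fun i => (i.1 == 0) && (i.2 < n).

Definition svertices (nY nT : nat) : seq vertex :=
  [:: (0, (0, 0)); (0, (0, 1)); (0, (0, 2))]
  ++ [seq (k, (0, i)) | k <- iota 1 4, i <- iota 0 nY]
  ++ [seq (k, (0, i)) | k <- iota 5 6, i <- iota 0 nT].

Section Small.
Variables (nY nT : nat) (l : seq (nat * nat)) (f : nat -> nat -> ident -> nat).
Notation sadj := (gadget_adj (sinc l) (sid nY) (sid nT)).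

(* Depth-first search, on the positions of the vertices in [svertices],
   for a path from [x] to [y] on which some colour occurs once. *)
Fixpoint search (tab : seq (seq (nat * nat))) n x vis (cols : seq nat) y :
    option (seq nat) :=
  if n is n'.+1 then
    if eqn x y then
      if has (fun a => eqn (count (eqn a) cols) 1) [:: 0; 1; 2] then Some [::] else None
    else
      (fix loop ws := match ws with
       | [::] => None
       | (w, a) :: ws' =>
         if has (eqn w) vis then loop ws' else
         match search tab n' w (w :: vis) (a :: cols) y with
         | Some p => Some (w :: p)
         | None => loop ws'
         end
       end) (nth [::] tab x)
  else None.

Definition sjoined x y p : bool :=
  [&& path sadj x p, last x p == y, uniq (x :: p)
    & has (fun a => count_mem a (pairmap (ecol (sinc l) f) x p) == 1) (iota 0 3)].

(** An answer of the search counts only if it passes [sjoined], so that nothing has to be proved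
    about the search itself. *)
Definition small_ok : bool :=
  let V := svertices nY nT in
  let n := size V in
  let v0 := (0, (0, 0)) in
  let tab := [seq [seq (j, ecol (sinc l) f v (nth v0 V j)) | j <- iota 0 n & sadj v (nth v0 V j)]
              | v <- V] in
  all (fun i => all (fun j => if eqn i j then true else
     if search tab n.+1 i [:: i] [::] j is Some p then
       sjoined (nth v0 V i) (nth v0 V j) [seq nth v0 V k | k <- p]
     else false) (iota 0 n)) (iota 0 n).

Lemma small_okP : small_ok -> forall x y, x \in svertices nY nT ->
  y \in svertices nY nT -> x != y -> exists p, sjoined x y p.
Proof.
move=> /allP H x y Hx Hy xy.
have Hi z : z \in svertices nY nT -> index z (svertices nY nT) \in iota 0 (size (svertices nY nT)).
  by move=> Hz; rewrite mem_iota add0n index_mem.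
move: (H _ (Hi _ Hx)) => /allP/(_ _ (Hi _ Hy)); rewrite -[eqn _ _]/(_ == _).
case: eqP => [E|_]; first by move: xy; rewrite -(nth_index (0, (0, 0)) Hx) E nth_index ?eqxx.
case: search => // p; rewrite !nth_index // => Hp; by eexists; exact: Hp.
Qed.

End Small.

Definition sig_of (s : seq bool) (i : ident) : bool := nth false s i.2.

Lemma ok_hub f : f = col2 (sig_of [::]) \/ f = col3 -> small_ok 0 0 [::] f.
Proof. by case=> ->; vm_compute. Qed.

Lemma ok2_y (s : bool) : small_ok 1 0 [::] (col2 (sig_of [:: s])).
Proof. by case: s; vm_compute. Qed.

Lemma ok2_yy (s s' : bool) : small_ok 2 0 [::] (col2 (sig_of [:: s; s'])).
Proof. by case: s; case: s'; vm_compute. Qed.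

Lemma ok2_t : small_ok 2 1 [:: (0, 0); (1, 0)] (col2 (sig_of [:: false; true])).
Proof. by vm_compute. Qed.

Lemma ok2_ty (s : bool) :
  small_ok 3 1 [:: (0, 0); (1, 0)] (col2 (sig_of [:: false; true; s])).
Proof. by case: s; vm_compute. Qed.

Lemma ok2_tt : small_ok 4 2 [:: (0, 0); (1, 0); (2, 1); (3, 1)]
  (col2 (sig_of [:: false; true; false; true])).
Proof. by vm_compute. Qed.

(** The common element has colour [s], and each hyperedge has an element of the other colour for
    itself. A pair of hyperedges with common elements of both colours is excluded by linearity. *)
Lemma ok2_tt_share (s : bool) : small_ok 3 2 [:: (0, 0); (1, 0); (0, 1); (2, 1)]
  (col2 (sig_of [:: s; ~~ s; ~~ s])).
Proof. by case: s; vm_compute. Qed.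

Lemma ok3 nY nT : (nY, nT) \in [:: (1, 0); (2, 0); (1, 1); (2, 1); (2, 2)] ->
  small_ok nY nT [:: (0, 0); (1, 1)] col3.
Proof. by rewrite !inE => /or4P[|||/orP[]] /eqP[-> ->]; vm_compute. Qed.

Lemma svertices_valid nY nT x : valid (sid nY) (sid nT) x -> x \in svertices nY nT.
Proof.
case: x => k [a i]; rewrite /svertices mem_cat [X in _ || X]mem_cat => Hx.
have [k0|k0] := eqVneq k 0.
  by move: Hx; rewrite k0 /valid /= => /andP[/eqP-> ]; case: i => [|[|[|]]].
have [k5|k5] := ltnP k 5.
  apply/orP; right; apply/orP; left; apply/allpairsPdep; exists k, i.
  rewrite !mem_iota /=; move: Hx; move: k k0 k5; do 5?[case=> [|]] => //= _ _;
    by rewrite /valid /= /sid /= => /andP[/eqP-> ->].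
apply/orP; right; apply/orP; right; apply/allpairsPdep; exists k, i.
rewrite !mem_iota /=; move: Hx; move: k k0 k5; do 11?[case=> [|]] => //= _ _;
  by rewrite /valid /= /sid /= => /andP[/eqP-> ->].
Qed.

Section Embedding.
Variables (inc : rel ident) (vy vt : pred ident) (f f' : nat -> nat -> ident -> nat).
Variables (l : seq (nat * nat)) (ys ts : seq ident).
Notation sval := (valid (sid (size ys)) (sid (size ts))).

Definition emb (v : vertex) : vertex :=
  (v.1, if v.1 == 0 then v.2 else nth (0, 0) (if v.1 < 5 then ys else ts) v.2.2).

Hypotheses (uniq_ys : uniq ys) (uniq_ts : uniq ts) (vys : all vy ys) (vts : all vt ts).
Hypothesis inc_l : forall i j, i < size ys -> j < size ts -> (i, j) \in l ->
  inc (nth (0, 0) ys i) (nth (0, 0) ts j).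
Hypothesis col_emb : forall v w, sval v -> sval w -> arc (sinc l) v w ->
  f v.1 w.1 (emb v).2 = f' v.1 w.1 v.2.

Lemma emb_valid v : sval v -> valid vy vt (emb v).
Proof.
case: v => k [a i]; rewrite /emb /valid /sid /=.
have Hy : (a == 0) && (i < size ys) -> vy (nth (0, 0) ys i).
  by case/andP=> _ Hi; apply: (allP vys); apply: mem_nth.
have Ht : (a == 0) && (i < size ts) -> vt (nth (0, 0) ts i).
  by case/andP=> _ Hi; apply: (allP vts); apply: mem_nth.
by do 11?[case: k => [|k]].
Qed.

(** One direction is what transports paths: the image of a small configuration may have further
    edges in the large graph. *)
Lemma emb_arc v w : sval v -> sval w -> arc (sinc l) v w -> arc inc (emb v) (emb w).
Proof.
case: v => k [a i]; case: w => m [b j]; rewrite /emb /valid /sid /arc /sinc /=.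
by do 11?[case: k => [|k]] => //; do 11?[case: m => [|m]] => //=;
  move=> /andP[/eqP Ea Hi] /andP[/eqP Eb Hj]; subst; first [by [] | by move=> /eqP[->] | exact: inc_l].
Qed.

Lemma emb_inj : {in sval &, injective emb}.
Proof.
move=> [k [a i]] [m [b j]]; rewrite !unfold_in /emb /valid /sid /= => + + [Ekm].
by rewrite -{}Ekm; do 11?[case: k => [|k]] => //= /andP[/eqP Ea Hi] /andP[/eqP Eb Hj]; subst;
  first [by move=> /eqP; rewrite nth_uniq // => /eqP -> | by case=> ->].
Qed.

Lemma emb_adj v w : gadget_adj (sinc l) (sid (size ys)) (sid (size ts)) v w ->
  gadget_adj inc vy vt (emb v) (emb w).
Proof.
case/and3P=> Hv Hw H; rewrite /gadget_adj !emb_valid //=.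
by case/orP: H => /emb_arc ->; rewrite ?orbT.
Qed.

Lemma emb_ecol v w : gadget_adj (sinc l) (sid (size ys)) (sid (size ts)) v w ->
  ecol inc f (emb v) (emb w) = ecol (sinc l) f' v w.
Proof.
case/and3P=> Hv Hw H; rewrite /ecol; case: (boolP (arc (sinc l) v w)) H => /= [H _|_ H].
  by rewrite emb_arc // -col_emb.
by rewrite (negbTE (arc_asym (emb_arc Hw Hv H))) -col_emb.
Qed.

Lemma emb_joined x y : sval x -> sval y -> x != y ->
  small_ok (size ys) (size ts) l f' -> cf_joined inc vy vt f (emb x) (emb y).
Proof.
move=> Hx Hy xy Hok.
have [p /and4P[Hp /eqP Ep Up /hasP[a _ /eqP Ca]]] :=
  small_okP Hok (svertices_valid Hx) (svertices_valid Hy) xy.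
have Vp : all sval (x :: p).
  rewrite /= Hx /=; elim: p (x) Hp {Ep Up Ca} => //= w p IH v /andP[/and3P[_ -> _]] /IH ->.
  by [].
exists (map emb p); split.
- rewrite path_map; apply: sub_path Hp => v w; exact: emb_adj.
- by rewrite last_map Ep.
- rewrite -map_cons map_inj_in_uniq // => v w Hv Hw; apply: emb_inj.
    exact: (allP Vp).
  exact: (allP Vp).
- exists a; rewrite -Ca; congr (count_mem a _).
  elim: p (x) Hp {Ep Up Ca Vp} => //= w p IH v /andP[Hvw /IH ->].
  by rewrite emb_ecol.
Qed.

End Embedding.

Variant part_spec (vy vt : pred ident) : vertex -> Prop :=
  | Hub j of j < 3 : part_spec vy vt (0, (0, j))
  | InY k y of 0 < k < 5 & vy y : part_spec vy vt (k, y)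
  | InT k t of 4 < k < 11 & vt t : part_spec vy vt (k, t).

Lemma valid_hub vy vt j : valid vy vt (0, (0, j)) = (j < 3).
Proof. by []. Qed.

Lemma emb_hub ys ts i : emb ys ts (0, i) = (0, i).
Proof. by []. Qed.

Lemma emb_y ys ts k i : 0 < k < 5 -> emb ys ts (k, (0, i)) = (k, nth (0, 0) ys i).
Proof. by case/andP=> k_gt0 Hk; rewrite /emb /= Hk; case: k k_gt0 {Hk}. Qed.

Lemma emb_t ys ts k i : 4 < k < 11 -> emb ys ts (k, (0, i)) = (k, nth (0, 0) ts i).
Proof. by case/andP=> Hk _; rewrite /emb /= [k < 5]ltnNge Hk; case: k Hk. Qed.

Lemma valid_y vy vt k y : 0 < k < 5 -> valid vy vt (k, y) = vy y.
Proof. by move: k; do 5?[case=> [|]]. Qed.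

Lemma valid_t vy vt k t : 4 < k < 11 -> valid vy vt (k, t) = vt t.
Proof. by move: k; do 11?[case=> [|]]. Qed.

Lemma partP vy vt v : valid vy vt v -> part_spec vy vt v.
Proof.
case: v => k i; case: (posnP k) => [->|k_gt0].
  by case: i => a j; rewrite /valid /= => /andP[/eqP-> Hj]; constructor.
have [k5|k5] := ltnP k 5 => Hv.
  have Hk : 0 < k < 5 by rewrite k_gt0.
  by apply: InY => //; rewrite valid_y in Hv.
have k11 : 4 < k < 11 by move: k5 Hv; clear k_gt0; do 11?[case: k => [|k]].
by apply: InT => //; rewrite valid_t in Hv.
Qed.

Section Covering.
Variables (inc : rel ident) (vy vt : pred ident).
Variable F : seq ident -> nat -> nat -> ident -> nat.

(** [F] receives the chosen elements [ys], since the colouring of the small configuration has to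
    copy the colours of these elements. *)
Definition covered (x y : vertex) : Prop :=
  exists l ys ts x' y',
  [/\ [/\ uniq ys, uniq ts, all vy ys & all vt ts],
      forall i j, (i, j) \in l -> i < size ys -> j < size ts ->
        inc (nth (0, 0) ys i) (nth (0, 0) ts j),
      small_ok (size ys) (size ts) l (F ys),
      valid (sid (size ys)) (sid (size ts)) x' && valid (sid (size ys)) (sid (size ts)) y'
    & emb ys ts x' = x /\ emb ys ts y' = y].

Lemma covered_sym x y : covered x y -> covered y x.
Proof.
move=> [l [ys [ts [x' [y' [H1 H2 H3 H4 [H5 H6]]]]]]].
by exists l, ys, ts, y', x'; rewrite andbC; split.
Qed.

Lemma covered_joined f x y :
  (forall ys ts l v w, valid (sid (size ys)) (sid (size ts)) v -> arc (sinc l) v w ->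
     f v.1 w.1 (emb ys ts v).2 = F ys v.1 w.1 v.2) ->
  covered x y -> x != y -> cf_joined inc vy vt f x y.
Proof.
move=> Hf [l [ys [ts [x' [y' [[Uy Ut Vy Vt] Hl Hok /andP[Hx Hy] [<- <-]]]]]]] xy.
apply: emb_joined Hok => //; last by apply: contraNneq xy => ->.
  by move=> i j Hi Hj /Hl; apply.
by move=> v w Hv _; apply: Hf.
Qed.

End Covering.

Section Completeness.
Variables (inc : rel ident) (vy vt : pred ident).

(** Two vertices belong to at most two elements or hyperedges. Together with one member of either
    colour for each hyperedge they lie in a configuration that has been checked. *)
Lemma gadget_joined2 (sig : ident -> bool) :
  (forall t b, vt t -> exists y, [/\ vy y, inc y t & sig y = b]) ->
  (forall t t' y y', vt t -> vt t' -> t != t' -> y != y' -> inc y t -> inc y' t ->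
     inc y t' -> ~~ inc y' t') ->
  forall x y, valid vy vt x -> valid vy vt y -> x != y ->
  cf_joined inc vy vt (col2 sig) x y.
Proof.
move=> Hsup Hlin x y Vx Vy; pose F ys := col2 (sig_of (map sig ys)).
apply: (covered_joined (F := F)).
  move=> ys ts l [k [a i]] [m [b j]]; rewrite /valid /sid /arc /F /=.
  have Hs : (a == 0) && (i < size ys) -> nat_of_bool (sig (nth (0, 0) ys i)) = sig_of (map sig ys) (a, i).
    by case/andP=> _ Hi; rewrite /sig_of /= (nth_map (0, 0)).
  by do 11?[case: k => [|k]] => //; do 11?[case: m => [|m]] => //= H _; apply: Hs.
wlog le_xy : x y Vx Vy / x.1 <= y.1.
  move=> H; have [le_xy|/ltnW le_yx] := leqP x.1 y.1; first exact: H.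
  by apply: covered_sym; apply: H.
case/partP: Vx le_xy => [i Hi|k yx Hk Vk|k t Hk Vt]; case/partP: Vy => [j Hj|m yy Hm Vm|m t' Hm Vt'] /= le_xy;
  try by exfalso; lia.
- exists [::], [::], [::], (0, (0, i)), (0, (0, j)); split; [by [] | by [] | | | by []].
    by apply: ok_hub; left.
  by rewrite !valid_hub Hi.
- exists [::], [:: yy], [::], (0, (0, i)), (m, (0, 0)); split.
  + by rewrite /= Vm.
  + by move=> a b; rewrite ?inE.
  + exact: ok2_y.
  + by rewrite valid_hub valid_y ?Hi.
  + by rewrite emb_hub emb_y.
- have [y0 [V0 I0 S0]] := Hsup _ false Vt'; have [y1 [V1 I1 S1]] := Hsup _ true Vt'.
  have y01 : y0 != y1 by apply/eqP => E; rewrite E S1 in S0.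
  exists [:: (0, 0); (1, 0)], [:: y0; y1], [:: t'], (0, (0, i)), (m, (0, 0)); split.
  + by rewrite /= !inE y01 V0 V1 Vt'.
  + by move=> a b; rewrite !inE => /orP[]/eqP[-> ->].
  + by rewrite /F /= S0 S1; apply: ok2_t.
  + by rewrite valid_hub valid_t ?Hi.
  + by rewrite emb_hub emb_t.
- have [E|N] := eqVneq yx yy.
    subst yy; exists [::], [:: yx], [::], (k, (0, 0)), (m, (0, 0)); split.
    + by rewrite /= Vk.
    + by move=> a b; rewrite ?inE.
    + exact: ok2_y.
    + by rewrite !valid_y.
    + by rewrite !emb_y.
  exists [::], [:: yx; yy], [::], (k, (0, 0)), (m, (0, 1)); split.
  + by rewrite /= !inE N Vk Vm.
  + by move=> a b; rewrite ?inE.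
  + exact: ok2_yy.
  + by rewrite !valid_y.
  + by rewrite !emb_y.
- have [y0 [V0 I0 S0]] := Hsup _ false Vt'; have [y1 [V1 I1 S1]] := Hsup _ true Vt'.
  have y01 : y0 != y1 by apply/eqP => E; rewrite E S1 in S0.
  have [/norP[N0 N1]|] := boolP (~~ ((yx == y0) || (yx == y1))).
    exists [:: (0, 0); (1, 0)], [:: y0; y1; yx], [:: t'], (k, (0, 2)), (m, (0, 0)); split.
    + by rewrite /= !inE negb_or y01 [y0 == yx]eq_sym N0 [y1 == yx]eq_sym N1 V0 V1 Vt' Vk.
    + by move=> a b; rewrite !inE => /orP[]/eqP[-> ->].
    + by rewrite /F /= S0 S1; apply: ok2_ty.
    + by rewrite valid_y // valid_t.
    + by rewrite emb_y // emb_t.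
  rewrite negbK => Hy.
  exists [:: (0, 0); (1, 0)], [:: y0; y1], [:: t'],
    (k, (0, if yx == y0 then 0 else 1)), (m, (0, 0)); split.
  + by rewrite /= !inE y01 V0 V1 Vt'.
  + by move=> a b; rewrite !inE => /orP[]/eqP[-> ->].
  + by rewrite /F /= S0 S1; apply: ok2_t.
  + by rewrite valid_y // valid_t //; case: ifP.
  + rewrite emb_y // emb_t //; split=> //; congr (_, _).
    by move: Hy; case: eqP => [->|_ /= /eqP->].
- have [y0 [V0 I0 S0]] := Hsup _ false Vt; have [y1 [V1 I1 S1]] := Hsup _ true Vt.
  have y01 : y0 != y1 by apply/eqP => E; rewrite E S1 in S0.
  have [E|N] := eqVneq t t'.
    subst t'; exists [:: (0, 0); (1, 0)], [:: y0; y1], [:: t], (k, (0, 0)), (m, (0, 0)); split.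
    + by rewrite /= !inE y01 V0 V1 Vt.
    + by move=> a b; rewrite !inE => /orP[]/eqP[-> ->].
    + by rewrite /F /= S0 S1; apply: ok2_t.
    + by rewrite !valid_t.
    + by rewrite !emb_t.
  have [z0 [W0 J0 R0]] := Hsup _ false Vt'; have [z1 [W1 J1 R1]] := Hsup _ true Vt'.
  have z01 : z0 != z1 by apply/eqP => E; rewrite E R1 in R0.
  have yz01 : y0 != z1 by apply/eqP => E; rewrite E R1 in S0.
  have yz10 : y1 != z0 by apply/eqP => E; rewrite E R0 in S1.
  have [E0|N0] := eqVneq y0 z0.
    (* This is where linearity enters: the two hyperedges cannot share both chosen members. *)
    have N1 : y1 != z1.
      by apply/negP => /eqP E1; have := Hlin _ _ _ _ Vt Vt' N y01 I0 I1; rewrite E0 E1 J0 J1 => /(_ isT).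
    exists [:: (0, 0); (1, 0); (0, 1); (2, 1)], [:: y0; y1; z1], [:: t; t'], (k, (0, 0)), (m, (0, 1)).
    split.
    + by rewrite /= !inE negb_or y01 yz01 N1 N V0 V1 W1 Vt Vt'.
    + by move=> a b; rewrite !inE => /or4P[]/eqP[-> ->] //= _ _; rewrite E0.
    + by rewrite /F /= S0 S1 R1; apply: (ok2_tt_share false).
    + by rewrite !valid_t.
    + by rewrite !emb_t.
  have [E1|N1] := eqVneq y1 z1.
    exists [:: (0, 0); (1, 0); (0, 1); (2, 1)], [:: y1; y0; z0], [:: t; t'], (k, (0, 0)), (m, (0, 1)).
    split.
    + by rewrite /= !inE negb_or eq_sym y01 yz10 N0 N V0 V1 W0 Vt Vt'.
    + by move=> a b; rewrite !inE => /or4P[]/eqP[-> ->] //= _ _; rewrite E1.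
    + by rewrite /F /= S0 S1 R0; apply: (ok2_tt_share true).
    + by rewrite !valid_t.
    + by rewrite !emb_t.
  exists [:: (0, 0); (1, 0); (2, 1); (3, 1)], [:: y0; y1; z0; z1], [:: t; t'], (k, (0, 0)), (m, (0, 1)).
  split.
  + by rewrite /= !inE !negb_or y01 yz01 yz10 N0 N1 z01 N V0 V1 W0 W1 Vt Vt'.
  + by move=> a b; rewrite !inE => /or4P[]/eqP[-> ->].
  + by rewrite /F /= S0 S1 R0 R1; apply: ok2_tt.
  + by rewrite !valid_t.
  + by rewrite !emb_t.
Qed.

(** Here one member per hyperedge is enough. As every hyperedge has two, its member can be chosen
    different from a given element or from the member chosen for the other hyperedge. *)
Lemma gadget_joined3 :
  (forall t, vt t -> exists y y', [/\ vy y, vy y', y != y', inc y t & inc y' t]) ->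
  forall x y, valid vy vt x -> valid vy vt y -> x != y ->
  cf_joined inc vy vt col3 x y.
Proof.
move=> Hsup x y Vx Vy.
apply: (covered_joined (F := fun _ => col3)).
  by move=> ys ts l [k [a i]] [m [b j]] _ _; do 11?[case: k => [|k]].
have Hother t y0 : vt t -> exists y1, [/\ vy y1, inc y1 t & y1 != y0].
  move=> /Hsup [y1 [y2 [V1 V2 N I1 I2]]]; have [E|N1] := eqVneq y1 y0.
    by exists y2; rewrite -E eq_sym.
  by exists y1.
wlog le_xy : x y Vx Vy / x.1 <= y.1.
  move=> H; have [le_xy|/ltnW le_yx] := leqP x.1 y.1; first exact: H.
  by apply: covered_sym; apply: H.
pose L := [:: (0, 0); (1, 1)].
case/partP: Vx le_xy => [i Hi|k yx Hk Vk|k t Hk Vt]; case/partP: Vy => [j Hj|m yy Hm Vm|m t' Hm Vt'] /= le_xy;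
  try by exfalso; lia.
- exists [::], [::], [::], (0, (0, i)), (0, (0, j)); split; [by [] | by [] | | | by []].
    by apply: ok_hub; right.
  by rewrite !valid_hub Hi.
- exists L, [:: yy], [::], (0, (0, i)), (m, (0, 0)); split.
  + by rewrite /= Vm.
  + by move=> a b; rewrite ?inE.
  + exact: ok3.
  + by rewrite valid_hub valid_y ?Hi.
  + by rewrite emb_hub emb_y.
- have [y0 [V0 I0 _]] := Hother _ (0, 0) Vt'.
  exists L, [:: y0], [:: t'], (0, (0, i)), (m, (0, 0)); split.
  + by rewrite /= V0 Vt'.
  + by move=> a b; rewrite !inE => /orP[]/eqP[-> ->].
  + exact: ok3.
  + by rewrite valid_hub valid_t ?Hi.
  + by rewrite emb_hub emb_t.
- have [E|N] := eqVneq yx yy.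
    subst yy; exists L, [:: yx], [::], (k, (0, 0)), (m, (0, 0)); split.
    + by rewrite /= Vk.
    + by move=> a b; rewrite ?inE.
    + exact: ok3.
    + by rewrite !valid_y.
    + by rewrite !emb_y.
  exists L, [:: yx; yy], [::], (k, (0, 0)), (m, (0, 1)); split.
  + by rewrite /= !inE N Vk Vm.
  + by move=> a b; rewrite ?inE.
  + exact: ok3.
  + by rewrite !valid_y.
  + by rewrite !emb_y.
- have [y0 [V0 I0 N0]] := Hother _ yx Vt'.
  exists L, [:: y0; yx], [:: t'], (k, (0, 1)), (m, (0, 0)); split.
  + by rewrite /= !inE N0 V0 Vk Vt'.
  + by move=> a b; rewrite !inE => /orP[]/eqP[-> ->].
  + exact: ok3.
  + by rewrite valid_y // valid_t.
  + by rewrite emb_y // emb_t.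
- have [y0 [V0 I0 _]] := Hother _ (0, 0) Vt; have [y1 [V1 I1 N1]] := Hother _ y0 Vt'.
  have [E|N] := eqVneq t t'.
    subst t'; exists L, [:: y0], [:: t], (k, (0, 0)), (m, (0, 0)); split.
    + by rewrite /= V0 Vt.
    + by move=> a b; rewrite !inE => /orP[]/eqP[-> ->].
    + exact: ok3.
    + by rewrite !valid_t.
    + by rewrite !emb_t.
  exists L, [:: y0; y1], [:: t; t'], (k, (0, 0)), (m, (0, 1)); split.
  + by rewrite /= !inE eq_sym N1 N V0 V1 Vt Vt'.
  + by move=> a b; rewrite !inE => /orP[]/eqP[-> ->].
  + exact: ok3.
  + by rewrite !valid_t.
  + by rewrite !emb_t.
Qed.

End Completeness.

(** * The gadget on a finite type: colourability, connectedness and [h] *)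

Section GadgetGraph.
Variables (inc : rel ident) (vy vt : pred ident).
Variables (V : finType) (dec : V -> vertex) (enc : vertex -> V).
Hypotheses (encK : forall v, valid vy vt v -> dec (enc v) = v)
  (decK : forall x, enc (dec x) = x) (dec_valid : forall x, valid vy vt (dec x)).
Hypothesis members2 : forall t, vt t ->
  exists y y', [/\ vy y, vy y', y != y', inc y t & inc y' t].

Notation adj := (gadget_adj inc vy vt).
Definition grel : rel V := fun x y => adj (dec x) (dec y).

Lemma grel_simple : simple_graph grel.
Proof. by split=> x => [y|]; rewrite /grel ?adj_irr // adj_sym. Qed.

Lemma sym_grel : symmetric grel. Proof. by case: grel_simple. Qed.
Lemma irr_grel : irreflexive grel. Proof. by case: grel_simple. Qed.

Lemma adj_valid v w : adj v w -> valid vy vt v /\ valid vy vt w.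
Proof. by case/and3P. Qed.

Lemma path_valid v p : valid vy vt v -> path adj v p -> all (valid vy vt) (v :: p).
Proof.
move=> Hv Hp; rewrite /= Hv /=; elim: p v Hp {Hv} => //= w p IH v /andP[/adj_valid[_ ->]].
exact: IH.
Qed.

Lemma enc_path v p : valid vy vt v -> path adj v p -> path grel (enc v) (map enc p).
Proof.
elim: p v => //= w p IH v Hv /andP[vw Hp]; have [_ Hw] := adj_valid vw.
by rewrite /grel !encK // vw; apply: IH.
Qed.

Lemma enc_inj : {in valid vy vt &, injective enc}.
Proof. by move=> v w Hv Hw /(congr1 dec); rewrite !encK. Qed.

Lemma enc_uniq v p : valid vy vt v -> path adj v p -> uniq (v :: p) ->
  uniq (enc v :: map enc p).
Proof.
move=> Hv Hp; rewrite -map_cons map_inj_in_uniq // => a b Ha Hb; apply: enc_inj;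
  exact: (allP (path_valid Hv Hp)).
Qed.

(* Colours are transferred to sets of vertices through the oriented edges. *)
Definition set_color (f : nat -> nat -> ident -> nat) (S : {set V}) : nat :=
  if [pick uv : V * V | (S == [set uv.1; uv.2])%SET && arc inc (dec uv.1) (dec uv.2)]
    is Some uv then ecol inc f (dec uv.1) (dec uv.2) else 0.

Lemma set2_eq (x y a b : V) : [set x; y]%SET = [set a; b]%SET ->
  (x = a /\ y = b) \/ (x = b /\ y = a) \/ (x = y /\ a = b).
Proof.
move=> E; have : x \in [set a; b]%SET by rewrite -E !inE eqxx.
have : y \in [set a; b]%SET by rewrite -E !inE eqxx orbT.
have : a \in [set x; y]%SET by rewrite E !inE eqxx.
have : b \in [set x; y]%SET by rewrite E !inE eqxx orbT.
by rewrite !inE => /orP[]/eqP h1 /orP[]/eqP h2 /orP[]/eqP h3 /orP[]/eqP h4; subst; intuition.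
Qed.

Lemma set_colorE f x y : grel x y -> set_color f [set x; y] = ecol inc f (dec x) (dec y).
Proof.
case/and3P=> _ _ Hxy; rewrite /set_color; case: pickP => [[u v] /= /andP[/eqP E Huv]|N].
  case: (set2_eq E) => [[-> ->//]|[[-> ->]|[_ Euv]]]; last first.
    by move: (arc_asym Huv); rewrite Euv -{1}Euv Huv.
  by apply: ecol_sym; rewrite Huv.
case/orP: Hxy => H; first by have := N (x, y); rewrite /= eqxx H.
by have := N (y, x); rewrite /= finset.setUC eqxx H.
Qed.

(** Kinds are at most 10, so 20 covers any two of them; the tail of an arc that starts in the hub is
    U or A, with index below 2. *)
Lemma ecol_lt f k : (forall i j a, i + j <= 20 -> (i == 0) ==> (a.2 < 2) -> f i j a < k) ->
  forall v w, adj v w -> ecol inc f v w < k.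
Proof.
move=> Hf v w; wlog H : v w / arc inc v w.
  move=> H' H; case/and3P: (H) => _ _ /orP[H1|H1]; first exact: H'.
  by rewrite ecol_sym ?H1 ?orbT //; apply: H'; rewrite // adj_sym.
case/and3P; rewrite /ecol H; move: v w H => [i [a b]] [j [a' b']] H Hv Hw _.
apply: Hf; move: H Hv Hw; rewrite /arc /valid /=;
  do 11?[case: i => [|i]] => //; do 11?[case: j => [|j]] => //=.
- by move=> /eqP-> _ /andP[_ H].
- by move=> /eqP->.
- by move=> /eqP->.
- by move=> /eqP->.
Qed.

Lemma joined_colorable f k : 
  (forall i j a, i + j <= 20 -> (i == 0) ==> (a.2 < 2) -> f i j a < k) ->
  (forall v w, valid vy vt v -> valid vy vt w -> v != w -> cf_joined inc vy vt f v w) ->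
  cf_colorable grel k.
Proof.
move=> Hf Hj; exists (set_color f); split=> [x y xy|x y xy].
  by rewrite set_colorE //; apply: ecol_lt.
have xy' : dec x != dec y by apply: contraNneq xy => E; rewrite -[x]decK E decK.
have [p [Hp Ep Up [a Ca]]] := Hj _ _ (dec_valid x) (dec_valid y) xy'.
exists (map enc p); split.
- by rewrite -[x]decK; apply: enc_path.
- by rewrite -[in LHS](decK x) last_map Ep decK.
- by rewrite -[x]decK; apply: enc_uniq.
- exists a; rewrite -Ca; congr (count_mem a _); rewrite -[in LHS](decK x).
  elim: p (dec x) (dec_valid x) Hp {Ep Up Ca xy'} => //= w p IH v Hv /andP[vw Hp].
  by have [_ Hw] := adj_valid vw; rewrite IH // set_colorE /grel !encK.
Qed.

(** The paths of the three-colouring serve here merely as paths. *)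
Lemma grel_connected : connected grel.
Proof.
have VU : valid vy vt (0, (0, 0)) by [].
apply/andP; split; first by apply/card_gt0P; exists (enc (0, (0, 0))).
apply/forallP => x; apply/forallP => y; have [->|xy] := eqVneq x y; first exact: connect0.
have xy' : dec x != dec y by apply: contraNneq xy => E; rewrite -[x]decK E decK.
have [p [Hp Ep _ _]] := gadget_joined3 members2 (dec_valid x) (dec_valid y) xy'.
apply/connectP; exists (map enc p); first by rewrite -[x]decK; apply: enc_path.
by rewrite -[in RHS](decK x) last_map Ep decK.
Qed.

Lemma colorable3 : cf_colorable grel 3.
Proof.
apply: (joined_colorable (f := col3)); last exact: gadget_joined3.
move=> i j [a b] _; case: i => [|i]; first by case: j => [|[|j]] //=; case: b => [|[|]].
by move=> _; do 11?[case: i => [|i]] => //; do 11?[case: j => [|j]].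
Qed.

Lemma colorable2 (sig : ident -> bool) :
  (forall t b, vt t -> exists y, [/\ vy y, inc y t & sig y = b]) ->
  (forall t t' y y', vt t -> vt t' -> t != t' -> y != y' -> inc y t -> inc y' t ->
     inc y t' -> ~~ inc y' t') ->
  cf_colorable grel 2.
Proof.
move=> H1 H2; apply: (joined_colorable (f := col2 sig)); last exact: gadget_joined2.
move=> i j [a b] _; case: i => [|i]; first by case: j => [|[|j]] //=; case: b => [|[|]].
by move=> _; do 11?[case: i => [|i]] => //; do 11?[case: j => [|j]] => //=; case: (sig _).
Qed.

(* The components of the graph of the cut edges are stars. *)
Definition center (v : vertex) : vertex :=
  match v.1 with
  | 0 => (0, (0, 1))
  | 3 | 4 => (3, v.2)
  | 6 | 9 | 10 => (6, v.2)
  | _ => v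
  end.

(** Marks one of the two outer vertices in the stars around A and around T3; a cut edge will have
    colour 1 when it contains a marked vertex. *)
Definition second (v : vertex) : bool := (v.1 == 10) || (v == (0, (0, 2))).

Lemma center_adj v w : adj v w -> center v = center w -> v = center v \/ w = center w.
Proof.
wlog H : v w / arc inc v w.
  move=> H' H E; case/and3P: (H) => _ _ /orP[H1|H1]; first exact: H'.
  by case: (H' w v H1 _ (esym E)) => [|?|?]; [rewrite adj_sym | right | left].
move=> /and3P[+ + _]; move: v w H => [i [a b]] [j [a' b']]; rewrite /arc /valid /center /=.
do 11?[case: i => [|i]] => //; do 11?[case: j => [|j]] => //=; try by [left | right].
by move=> /eqP-> /andP[/eqP-> _] /andP[/eqP-> ]; case: b => [|[|]]; by [left | right].
Qed.

Lemma second_center v w : valid vy vt v -> valid vy vt w -> v != w ->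
  center v = center w -> v != center v -> w != center w -> second v != second w.
Proof.
move: v w => [i [a b]] [j [a' b']]; rewrite /valid /center /second /=.
do 11?[case: i => [|i]] => //; do 11?[case: j => [|j]] => //=;
  try by move=> _ _ + [Ea Eb]; rewrite ?Ea ?Eb ?eqxx.
by move=> /andP[/eqP-> ] + /andP[/eqP-> ]; case: b => [|[|[|]]] //; case: b' => [|[|[|]]].
Qed.

Lemma not_cut x y p : path grel x p -> last x p = y -> uniq (x :: p) -> p != [:: y] ->
  ~~ cut_edge grel x y.
Proof.
move=> Hp Ep Up; apply: contra => Hc.
have [_ Hsym] := grel_simple; have Hxy := cut_edge_sub Hc.
apply/eqP; apply: (cut_path_unique sym_grel irr_grel grel_connected (p := [:: y]) _ _ Hp Up).
- by rewrite /= Hc.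
- by rewrite /= inE andbT; apply: contraTneq Hxy => ->; rewrite irr_grel.
- by rewrite Ep.
Qed.

Lemma not_cut_enc v w p : valid vy vt v -> path adj v p -> last v p = w -> uniq (v :: p) ->
  1 < size p -> ~~ cut_edge grel (enc v) (enc w).
Proof.
move=> Hv Hp Ep Up Sp; apply: (not_cut (enc_path Hv Hp)) => //.
- by rewrite last_map Ep.
- exact: enc_uniq.
- by apply: contraTneq Sp => /(congr1 size); rewrite size_map => ->.
Qed.

(** An edge that leaves its star lies on a cycle: a triangle inside a diamond, or, between an
    element and a hyperedge, the detour over the hub and another member. *)
Lemma cut_center x y : cut_edge grel x y -> center (dec x) = center (dec y).
Proof.
move=> Hc; have Hxy := cut_edge_sub Hc; apply: contraPP Hc => Nc; apply/negP.
rewrite -[x]decK -[y]decK; move: (Hxy : adj (dec x) (dec y)) Nc.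
move: (dec x) (dec y) => v w {x y Hxy}.
wlog H : v w / arc inc v w.
  move=> H' H E; case/and3P: (H) => _ _ /orP[H1|H1]; first exact: H'.
  rewrite (sym_cut sym_grel irr_grel grel_connected); apply: H' => //; first by rewrite adj_sym.
  by move=> E'; apply: E.
move=> /and3P[Hv Hw _] Nc.
have VU : valid vy vt (0, (0, 0)) by [].
have tri k l m a b z : valid vy vt (k, a) -> valid vy vt (l, b) -> valid vy vt (m, z) ->
    [&& k != l, l != m & k != m] ->
    arc inc (k, a) (m, z) || arc inc (m, z) (k, a) -> arc inc (m, z) (l, b) || arc inc (l, b) (m, z) ->
    ~~ cut_edge grel (enc (k, a)) (enc (l, b)).
  move=> H1 H2 H3 /and3P[kl lm km] H4 H5.
  apply: (@not_cut_enc _ _ [:: (m, z); (l, b)]) => //.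
    by rewrite /= /gadget_adj H1 H2 H3 H4 H5.
  by rewrite /= !inE !xpair_eqE (negbTE km) (negbTE kl) [m == l]eq_sym (negbTE lm).
move: v w H Hv Hw Nc => [i [a0 a]] [j [b0 b]]; rewrite /arc /valid /center /=.
do 11?[case: i => [|i]] => //; do 11?[case: j => [|j]] => //=.
- move=> /eqP-> /andP[/eqP-> _] Hb _.
  by apply: (tri _ _ 3 _ _ (b0, b)) => //; rewrite /arc /= eqxx.
- move=> /eqP-> /andP[/eqP-> _] Hb _.
  by apply: (tri _ _ 3 _ _ (b0, b)) => //; rewrite /arc /= eqxx.
- move=> /eqP-> /andP[/eqP-> _] Hb _.
  by apply: (tri _ _ 1 _ _ (b0, b)) => //; rewrite /arc /= eqxx.
- by move=> /eqP[-> ->] Hb _ _; apply: (tri _ _ 0 _ _ (0, 0)).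
- by move=> /eqP[-> ->] Hb _ _; apply: (tri _ _ 0 _ _ (0, 0)).
- by move=> /eqP[-> ->].
- move=> Hi Ha Hb _.
  have [y' [Hy' Na Hi']] : exists y', [/\ vy y', y' != (a0, a) & inc y' (b0, b)].
    have [y [y' [H1 H2 N I1 I2]]] := members2 Hb.
    have [E|Ny] := eqVneq y (a0, a); last by exists y.
    by exists y'; rewrite -E eq_sym.
  apply: (@not_cut_enc _ _ [:: (3, (a0, a)); (0, (0, 0)); (3, y'); (4, y'); (5, (b0, b))]) => //.
    by rewrite /= /gadget_adj /valid /arc /= Ha Hb Hy' Hi' !eqxx.
  rewrite /= !inE !xpair_eqE /= !negb_or; move: Na; case: y' {Hy' Hi'} => y0 y.
  by rewrite !xpair_eqE [y0 == a0]eq_sym [y == a]eq_sym => ->.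
- move=> /eqP[-> ->] Hb _ _.
  by apply: (tri _ _ 7 _ _ (b0, b)) => //; rewrite /arc /= eqxx.
- move=> /eqP[-> ->] Hb _ _.
  by apply: (tri _ _ 6 _ _ (b0, b)) => //; rewrite /arc /= eqxx.
- move=> /eqP[-> ->] Hb _ _.
  by apply: (tri _ _ 6 _ _ (b0, b)) => //; rewrite /arc /= eqxx.
- by move=> /eqP[-> ->].
- by move=> /eqP[-> ->].
- move=> /eqP[-> ->] Hb _ _.
  by apply: (tri _ _ 5 _ _ (b0, b)) => //; rewrite /arc /= eqxx.
- move=> /eqP[-> ->] Hb _ _.
  by apply: (tri _ _ 5 _ _ (b0, b)) => //; rewrite /arc /= eqxx.
Qed.

Lemma connect_stable (r : rel V) (S : pred V) x y :
  (forall u v, S u -> r u v -> S v) -> connect r x y -> S x -> S y.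
Proof.
move=> HS /connectP[p Hp ->]; elim: p x Hp => //= z p IH x /andP[xz Hp] Sx.
by apply: (IH z Hp); apply: HS xz.
Qed.

Definition U : vertex := (0, (0, 0)).
Definition A : vertex := (0, (0, 1)).
Definition B : vertex := (0, (0, 2)).

Lemma adj_B w : adj B w -> w = A.
Proof.
case/and3P=> _; case: w => k [a b]; rewrite /valid /arc /=.
do 11?[case: k => [|k]] => //= /andP[/eqP-> Hb]; case: b Hb => [|[|[|]]] //.
Qed.

Lemma adj_A w : adj A w -> w = B \/ w = U.
Proof.
case/and3P=> _; case: w => k [a b]; rewrite /valid /arc /=.
by do 11?[case: k => [|k]] => //= /andP[/eqP-> Hb]; case: b Hb => [|[|[|]]] //; by [left | right].
Qed.

Lemma cut_BA : cut_edge grel (enc B) (enc A).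
Proof.
rewrite (cut_edgeE sym_grel irr_grel grel_connected) /grel !encK //=.
apply/negP => /(connect_stable (S := pred1 (enc B))) H.
suff /eqP/(congr1 dec) : pred1 (enc B) (enc A) by rewrite !encK.
apply: H => //= u v /eqP-> /andP[]; rewrite /grel encK // => /adj_B Ev.
by rewrite -(decK v) Ev eqxx.
Qed.

Lemma cut_AU : cut_edge grel (enc A) (enc U).
Proof.
rewrite (cut_edgeE sym_grel irr_grel grel_connected) /grel !encK //=.
apply/negP => /(connect_stable (S := pred2 (enc A) (enc B))) H.
suff : pred2 (enc A) (enc B) (enc U).
  by case/orP => /eqP/(congr1 dec); rewrite !encK.
apply: H; last by rewrite /= eqxx.
move=> u v /= /orP[]/eqP-> /andP[]; rewrite /grel encK //.
  move=> /adj_A [] Ev; rewrite -(decK v) Ev ?eqxx ?orbT //.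
by move=> /adj_B Ev _; rewrite -(decK v) Ev eqxx.
Qed.

(** The path from B over A to U gives the lower bound. For the upper bound, two vertices in a
    component are adjacent or joined over the centre of their star, and in the latter case exactly
    one of them is marked by [second]. *)
Lemma h_grel : h grel = 2.
Proof.
apply/eqP; rewrite eqn_leq andbC; apply/andP; split.
  apply: (h_geq2 sym_grel irr_grel grel_connected _ cut_BA cut_AU).
  by apply/negP => /eqP/(congr1 dec); rewrite !encK.
apply: (@h_leq _ _ sym_grel irr_grel grel_connected 2 (fun S : {set V} => [exists z in S, second (dec z)])).
  by move=> x y _; rewrite ltnS leq_b1.
move=> x y xy Hc.
have Hcen : forall u v, connect (cut_edge grel) u v -> center (dec u) = center (dec v).
  move=> u v /connectP[p Hp ->]; elim: p u Hp => //= z p IH u /andP[/cut_center-> /IH ->].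
  by [].
have Hfirst u v : u != v -> connect (cut_edge grel) u v ->
    exists2 z, cut_edge grel u z & connect (cut_edge grel) z v.
  move=> uv /connectP[[|z p] /=]; first by move=> _ E; rewrite E eqxx in uv.
  by case/andP=> uz Hp E; exists z => //; apply/connectP; exists p.
have dec_inj : injective dec by apply: can_inj decK.
have Hcen2 u z : cut_edge grel u z -> dec u != center (dec u) -> dec z = center (dec u).
  move=> Hu Nu; have E := cut_center Hu.
  case: (center_adj (cut_edge_sub Hu : adj (dec u) (dec z)) E) => Ec; last by rewrite Ec -E.
  by rewrite -Ec eqxx in Nu.
have Hsym := sym_cut sym_grel irr_grel grel_connected.
have Hyx : connect (cut_edge grel) y x by rewrite sym_connect_sym.
have Exy := Hcen _ _ Hc.
have edge u v : u != v -> cut_edge grel u v ->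
   cf_path (cut_edge grel) (fun S : {set V} => [exists z in S, second (dec z)]) u v.
  by move=> uv Huv; apply: cf_path_edge.
have [Ex|Nx] := eqVneq (dec x) (center (dec x)).
  have [|z Hz _] := Hfirst y x _ Hyx; first by rewrite eq_sym.
  apply: edge => //; rewrite Hsym; suff -> : x = z by [].
  apply: (dec_inj); rewrite Ex Exy (Hcen2 _ _ Hz) //.
  by rewrite -Exy -Ex (inj_eq dec_inj) eq_sym.
have [z Hz _] := Hfirst x y xy Hc; have Ez := Hcen2 _ _ Hz Nx.
have [Ey|Ny] := eqVneq (dec y) (center (dec y)).
  by apply: edge => //; suff -> : y = z by []; apply: (dec_inj); rewrite Ey -Exy Ez.
have [|z' Hz' _] := Hfirst y x _ Hyx; first by rewrite eq_sym.
have Ez' := Hcen2 _ _ Hz' Ny.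
have E : z' = z by apply: (dec_inj); rewrite Ez' -Exy.
rewrite {}E in Hz' Ez'.
have xz : x != z by apply: contraNneq Nx => E; rewrite -Ez -E.
have yz : y != z by apply: contraNneq Ny => E; rewrite -Ez' -E.
have Hcol u v : u != v -> [exists w in [set u; v]%SET, second (dec w)] = second (dec u) || second (dec v).
  move=> _; apply/existsP/orP => [[w /andP[]]|[] H].
  - by rewrite !inE => /orP[]/eqP->; [left | right].
  - by exists u; rewrite !inE eqxx.
  - by exists v; rewrite !inE eqxx orbT.
have Sz : second (dec z) = false.
  rewrite Ez; move: Nx; case: (dec x) => k [a b]; rewrite /second /center /=; do 11?[case: k => [|k]] => //=; rewrite eqxx.
exists [:: z; y]; split=> //.
- by rewrite /= Hz Hsym Hz'.
- by rewrite /= !inE negb_or xz xy eq_sym yz.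
- have := second_center (dec_valid x) (dec_valid y) _ Exy Nx Ny.
  rewrite (inj_eq dec_inj) => /(_ xy) H; exists 1; rewrite /= Hcol // Hcol 1?eq_sym // Sz orbF /=.
  by move: H; case: second; case: second.
Qed.

End GadgetGraph.

(** * Monochromatic paths in a 2-coloured gadget *)

Section Soundness.
Variables (inc : rel ident) (vy vt : pred ident) (col : vertex -> vertex -> nat).
Notation adj := (gadget_adj inc vy vt).
Hypothesis col_sym : forall v w, col v w = col w v.
Hypothesis col_lt2 : forall v w, adj v w -> col v w < 2.
Hypothesis joined : forall v w, valid vy vt v -> valid vy vt w -> v != w ->
  exists p, [/\ path adj v p, last v p = w, uniq (v :: p)
    & exists a, count_mem a (pairmap col v p) = 1].

Definition mono (i : nat) : rel vertex := fun v w => adj v w && (col v w == i).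

(** The part of a hyperedge behind T0: its middle vertices, T3 and the leaves. It can be entered
    through T0 only. *)
Definition inside (t : ident) (v : vertex) : bool := (5 < v.1) && (v.2 == t).

Lemma adj_into_inside t v w : adj v w -> ~~ inside t v -> inside t w -> v = (5, t).
Proof.
case/and3P; case: v => k [a b]; case: w => m [a' b']; rewrite /inside /valid /arc /=.
do 11?[case: k => [|k]] => //=; do 11?[case: m => [|m]] => //= _ _;
  rewrite ?orbF //=.
all: try by move=> /eqP[-> ->] _ /eqP ->.
all: by move=> /eqP[-> ->] /negbTE ->.
Qed.

Lemma path_outside t v p : path adj v p -> ~~ inside t v -> (5, t) \notin v :: p ->
  ~~ inside t (last v p).
Proof.
elim: p v => //= w p IH v /andP[vw Hp] Hv; rewrite inE negb_or => /andP[N1 N2].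
apply: IH => //; apply/negP => /(adj_into_inside vw Hv) E; by rewrite E eqxx in N1.
Qed.

Lemma adj_end t v : adj v (5, t) -> ~~ inside t v -> exists y, [/\ v = (4, y), inc y t & vy y].
Proof.
case/and3P; case: v => k [a b]; rewrite /inside /valid /arc /=.
do 11?[case: k => [|k]] => //=; rewrite ?orbF.
  by move=> H _ Hi _; exists (a, b).
all: by move=> _ _ /eqP->; rewrite eqxx.
Qed.

Lemma path_entry t p : path adj U p -> (5, t) \notin p -> adj (last U p) (5, t) ->
  exists y, [/\ last U p = (4, y), inc y t & vy y].
Proof.
move=> Hp Np /adj_end; apply.
by apply: path_outside Hp _ _; rewrite // inE negb_or Np.
Qed.

(** Avoiding the vertex T0 of [t] makes any hyperedge that the path crosses just before [v]
    different from [t]. *)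
Definition reached i t v := exists p,
  [/\ path (mono i) U p, uniq (U :: p), (5, t) \notin p & last U p = v].

Lemma mono_path i v p : path (mono i) v p -> path adj v p.
Proof. by apply: sub_path => a b /andP[]. Qed.

(** The first two colours are the two different ones, so the colour that occurs once is used up
    there; the rest, its last member [i] included, is all of the other colour. *)
Lemma count_two (a i : nat) c s :
  c < 2 -> i < 2 -> all (fun k => k < 2) s ->
  count_mem a [:: c, 1 - c & rcons s i] = 1 -> all (pred1 i) s.
Proof.
move=> c2 i2 Hs; rewrite /= -cats1 count_cat /= => Ha.
have a2 : a < 2.
  rewrite ltnNge; apply/negP => a2; have /count_memPn E : a \notin s.
    by apply: contraL a2 => /(allP Hs); rewrite -ltnNge.
  by rewrite E in Ha; lia.
have /count_memPn Na : count_mem a s = 0.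
  by move: Ha; case: (c) c2 => [|[|]] // _; case: (a) a2 => [|[|]] //= _; lia.
apply/allP => k Hk /=; have k2 := allP Hs _ Hk.
have : k != a by apply: contraNneq Na => <-.
by rewrite /= in k2; lia.
Qed.

Lemma adj_leaf k t v : k \in [:: 9; 10] -> adj v (k, t) -> v = (6, t).
Proof.
rewrite !inE => Hk; case/and3P => _ _; case: v => m [a b]; rewrite /arc /=.
by case/orP: Hk => /eqP->; do 11?[case: m => [|m]] => //=; rewrite ?orbF // => /eqP->.
Qed.

Lemma leaf_adj k t v : k \in [:: 9; 10] -> adj (k, t) v -> v = (6, t).
Proof. by move=> Hk; rewrite adj_sym; apply: adj_leaf. Qed.

(** The only path from B to U has the two edges at A, and it is conflict-free only if they
    differ. *)
Lemma hub_colors : col B A = 1 - col A U.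
Proof.
have [p [Hp Ep Up [a Ca]]] := joined (v := B) (w := U) isT isT isT.
have BA : adj B A by []. have AU : adj A U by [].
move: (col_lt2 BA) (col_lt2 AU) => c1 c2.
case: p Hp Ep Up Ca => [|z p] //= /andP[/adj_B -> Hp].
case: p Hp => [|z' p] //= /andP[/adj_A [] -> Hp] Ep; first by rewrite !inE eqxx ?orbT.
case: p Hp Ep => [|w p] /= _ Ep; first by move=> _; lia.
have -> : U \in w :: p by rewrite -Ep mem_last.
by rewrite /= !andbF.
Qed.

Lemma leaf_colors t : vt t -> col (6, t) (9, t) = 1 - col (6, t) (10, t).
Proof.
move=> Ht; have H9 : adj (6, t) (9, t) by rewrite /gadget_adj /valid /arc /= Ht eqxx.
have H10 : adj (6, t) (10, t) by rewrite /gadget_adj /valid /arc /= Ht eqxx.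
move: (col_lt2 H9) (col_lt2 H10) => c1 c2.
have [p [Hp Ep Up [a Ca]]] := joined (v := (9, t)) (w := (10, t)) Ht Ht isT.
case: p Hp Ep Up Ca => [|z p] //= /andP[/leaf_adj -> //].
case/lastP: p => [|p z'] //; rewrite rcons_path last_rcons => /andP[Hp Hl] Ez; subst z'.
have El := adj_leaf (k := 10) isT Hl.
case: p Hp {Hl} El => [|w p] /= _ El; last first.
  have Hm : (6, t) \in w :: p by rewrite -{1}El mem_last.
  by case/and3P=> _ N _ _; move: N; rewrite -rcons_cons mem_rcons in_cons Hm orbT.
by rewrite [col (9, t) _]col_sym => _; lia.
Qed.

Lemma pairmap_mono i v p : path adj v p -> all (pred1 i) (pairmap col v p) -> path (mono i) v p.
Proof.
by elim: p v => //= w p IH v /andP[vw Hp] /andP[/eqP Ei Ha]; rewrite /mono vw Ei eqxx /=; apply: IH.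
Qed.

Lemma pairmap_lt2 v p : path adj v p -> all (fun k => k < 2) (pairmap col v p).
Proof. by elim: p v => //= w p IH v /andP[/col_lt2 -> /IH]. Qed.

Lemma mono_to_end t i : vt t -> i < 2 -> exists q,
  [/\ path (mono i) U q, uniq (U :: q) & last U q = (6, t)].
Proof.
move=> Ht i2; have Hl := leaf_colors Ht.
have [k [Hk Ek]] : exists k, k \in [:: 9; 10] /\ col (6, t) (k, t) = i.
  have H10 : adj (6, t) (10, t) by rewrite /gadget_adj /valid /arc /= Ht eqxx.
  move: (col_lt2 H10) => c2.
  have [E|N] := eqVneq (col (6, t) (10, t)) i; first by exists 10.
  exists 9; split=> //; rewrite Hl; move: N c2.
  by case: (i) i2 => [|[|]] //; case: (col _ _) => [|[|]].
have Vk : valid vy vt (k, t) by move: Hk; rewrite !inE => /orP[]/eqP->.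
have NB : B != (k, t) by move: Hk; rewrite !inE => /orP[]/eqP->.
have [p [Hp Ep Up [a Ca]]] := joined (v := B) isT Vk NB.
have c2 : col A U < 2 by apply: col_lt2.
case: p Hp Ep Up Ca => [|z p] /=; first by move=> _ E; rewrite E eqxx in NB.
case/andP=> /adj_B -> Hp Ep /andP[NBp Up].
have NA : A != (k, t) by move: Hk; rewrite !inE => /orP[]/eqP->.
case: p Hp Ep NBp Up => [|z' p] /=; first by move=> _ E; rewrite E eqxx in NA.
case/andP=> /adj_A [] -> Hp Ep; first by rewrite !inE eqxx ?orbT.
move=> _ /andP[_ Up].
have NU : U != (k, t) by move: Hk; rewrite !inE => /orP[]/eqP->.
case/lastP: p Hp Ep Up => [|q z'']; first by move=> _ /= E; rewrite E eqxx in NU.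
rewrite last_rcons rcons_path => /andP[Hq Hz] E; subst z''.
have El := adj_leaf Hk Hz; rewrite mem_rcons inE negb_or rcons_uniq => /andP[/andP[_ N1] /andP[_ Uq]] Ca.
exists q; split=> //; last by rewrite /= N1 Uq.
apply: pairmap_mono => //.
have := @count_two a i (col B A) (pairmap col U q).
have -> : 1 - col B A = col A U by have := hub_colors; lia.
apply=> //; [by apply: col_lt2 | exact: pairmap_lt2 | ].
by rewrite -Ca /= -!cats1 pairmap_cat /= El Ek.
Qed.

Lemma mono_into t i : vt t -> i < 2 -> exists y,
  [/\ vy y, inc y t, col (4, y) (5, t) = i & reached i t (4, y)].
Proof.
move=> Ht i2; have [q [Hq Uq Eq]] := mono_to_end Ht i2.
have Hin : (5, t) \in q.
  apply: contraT => Nq; have := path_outside (mono_path Hq) _ _; rewrite Eq.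
  by move/(_ t); rewrite /inside /= eqxx inE negb_or Nq; apply.
case/splitPr: Hin Hq Uq => q1 q2; rewrite cat_path => /andP[Hq1 /andP[Hl _]].
rewrite -cat_cons cat_uniq => /and3P[U1 N _].
have N1 : (5, t) \notin q1.
  by move: N; rewrite /= negb_or inE => /andP[].
have /andP[Ha /eqP Hc] := Hl.
have [y [Ey Iy Vy]] := path_entry (mono_path Hq1) N1 Ha.
by exists y; rewrite -Ey; split=> //; exists q1.
Qed.

(** The last step to [y] comes from the port or from some T0. In the second case that T0 was in turn
    entered from a member, and the hyperedge has been crossed in the colour [i]. *)
Lemma reached_member t i y : inc y t -> reached i t (4, y) ->
  col (3, y) (4, y) = i \/
  exists t' y', [/\ vt t' /\ vy y', t' != t, y' != y, inc y t' /\ inc y' t'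
    & col (4, y) (5, t') = i /\ col (4, y') (5, t') = i].
Proof.
move=> Iy [p [Hp Up Np Ep]]; case/lastP: p Hp Up Np Ep => [|p z] //.
rewrite rcons_path last_rcons => /andP[Hp Hz] Up Np Ez; subst z.
case/andP: Hz => Ha /eqP Hc; have /and3P[Vl _ Harc] := Ha.
have [E|[t' E It']] : last U p = (3, y) \/ exists2 t', last U p = (5, t') & inc y t'.
- case: (last U p) Harc => k [a b]; rewrite /arc /=.
  do 11?[case: k => [|k]] => //=; rewrite ?orbF //; first by move/eqP->; left.
  by move=> It; right; exists (a, b).
- by left; rewrite -E.
right; case/lastP: p {Ha Harc} Hp Up Np E Vl Hc => [|p z] //.
rewrite rcons_path last_rcons => /andP[Hp Hz] Up Np E Vl Hc; subst z.
case/andP: Hz => Hza /eqP Hzc.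
move: Up; rewrite -!rcons_cons !rcons_uniq => /and3P[N4 N5 Up].
have N5' : (5, t') \notin p by move: N5; rewrite inE negb_or => /andP[].
have [y' [Ey' Iy' Vy']] := path_entry (mono_path Hp) N5' Hza.
exists t', y'; split=> //.
- by move: Np; rewrite mem_rcons in_cons negb_or mem_rcons in_cons negb_or => /andP[_ /andP[+ _]]; apply: contraNneq => ->.
- apply: contraNneq N4 => E; rewrite mem_rcons inE; apply/orP; right.
  by rewrite -E -Ey' mem_last.
- by split; [rewrite col_sym | rewrite -Ey'].
Qed.

End Soundness.

(** * Copies of points, links, and the hypergraph read off from a 2-colouring *)

Section Hypergraph.
Variables (nc nx : nat) (hinc : nat -> nat -> bool).

(* The copies (c, x), c < nc, of a point x, and a further copy (nc, x), which
   is linked to each of them; a link is a hyperedge with two members. *)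
Definition copies (y : ident) : bool := (y.1 <= nc) && (y.2 < nx).
(** For [x < nx] the pair [(c, x)] is the link of copy [c] of [x] to the common copy; [(c, nx)] is
    the given hyperedge [c], taken on the copies numbered [c]. *)
Definition hyperedges (t : ident) : bool := (t.1 < nc) && (t.2 <= nx).
Definition member (y t : ident) : bool :=
  if t.2 < nx then (y.2 == t.2) && ((y.1 == nc) || (y.1 == t.1))
  else (y.1 == t.1) && hinc t.1 y.2.

Definition splitting (f : nat -> bool) : Prop :=
  forall c b, c < nc -> exists x, [/\ x < nx, hinc c x & f x = b].

Hypothesis two : forall c, c < nc -> exists x x',
  [/\ x < nx, x' < nx, x != x', hinc c x & hinc c x'].

Lemma hyper_members t : hyperedges t ->
  exists y y', [/\ copies y, copies y', y != y', member y t & member y' t].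
Proof.
case: t => c x /andP[/= Hc Hx]; rewrite /member /copies /=; have [lt_x|le_x] := ltnP x nx.
  exists (nc, x), (c, x); rewrite /= !eqxx leqnn lt_x ltnW //= orbT; split=> //.
  by rewrite xpair_eqE eqxx andbT; apply: contraTneq Hc => ->; rewrite ltnn.
have [x1 [x2 [H1 H2 N I1 I2]]] := two Hc.
exists (c, x1), (c, x2); rewrite /= !eqxx ltnW //=; split=> //.
by rewrite xpair_eqE eqxx.
Qed.

Lemma hyper_linear t t' y y' : hyperedges t -> hyperedges t' -> t != t' -> y != y' ->
  member y t -> member y' t -> member y t' -> ~~ member y' t'.
Proof.
case: t => c x; case: t' => c' x'; case: y => a b; case: y' => a' b'.
rewrite /hyperedges /member /= !xpair_eqE => /andP[Hc Hx] /andP[Hc' Hx'] Nt Ny.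
case: (ltnP x nx) => Lx; case: (ltnP x' nx) => Lx' H1 H2 H3; apply/negP => H4.
- move: H1 H2 H3 H4 => /andP[/eqP E1 H1] /andP[/eqP E2 H2] /andP[/eqP E3 H3] /andP[/eqP E4 H4].
  move: H1 H2 H3 H4; do 4!case/orP=> /eqP ?; subst; lia.
- move: H1 H2 H3 H4 => /andP[/eqP E1 H1] /andP[/eqP E2 H2] /andP[/eqP E3 H3] /andP[/eqP E4 H4].
  by subst; rewrite !eqxx in Ny.
- move: H1 H2 H3 H4 => /andP[/eqP E1 H1] /andP[/eqP E2 H2] /andP[/eqP E3 H3] /andP[/eqP E4 H4].
  by subst; rewrite !eqxx in Ny.
- move: H1 H2 H3 H4 => /andP[/eqP E1 H1] /andP[/eqP E2 H2] /andP[/eqP E3 H3] /andP[/eqP E4 H4].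
  by move: Nt; rewrite -E1 -E3 eqxx /=; lia.
Qed.

(** The common copies get the opposite colour, so that the links have members of both colours. *)
Lemma hyper_sig f : splitting f -> forall t b, hyperedges t -> exists y,
  [/\ copies y, member y t & (if y.1 == nc then ~~ f y.2 else f y.2) = b].
Proof.
move=> Hf [c x] b /andP[/= Hc Hx]; rewrite /member /copies /=.
have Nc : (c == nc) = false by apply/eqP; lia.
have [lt_x|le_x] := ltnP x nx.
  have [E|N] := eqVneq (f x) b.
    by exists (c, x); rewrite /= !eqxx Nc lt_x ltnW.
  exists (nc, x); rewrite /= !eqxx leqnn lt_x; split=> //.
  by move: N; case: (f x); case: (b).
have [x1 [H1 I1 E1]] := Hf c b Hc.
by exists (c, x1); rewrite /= !eqxx Nc ltnW.
Qed.

Section Split.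
Variable col : vertex -> vertex -> nat.
Notation adj := (gadget_adj member copies hyperedges).
Hypothesis col_sym : forall v w, col v w = col w v.
Hypothesis col_lt2 : forall v w, adj v w -> col v w < 2.
Hypothesis joined : forall v w, valid copies hyperedges v -> valid copies hyperedges w -> v != w ->
  exists p, [/\ path adj v p, last v p = w, uniq (v :: p)
    & exists a, count_mem a (pairmap col v p) = 1].

Let sg y := col (3, y) (4, y).
Let K y t := col (4, y) (5, t).

Let supply t i : hyperedges t -> i < 2 -> exists y, [/\ copies y, member y t, K y t = i &
  sg y = i \/ exists t' y', [/\ hyperedges t' /\ copies y', t' != t, y' != y,
    member y t' /\ member y' t' & K y t' = i /\ K y' t' = i]].
Proof.
move=> Ht Hi; have [y [Vy Iy Ec Hr]] := mono_into col_sym col_lt2 joined Ht Hi.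
by exists y; split=> //; apply: reached_member Hr.
Qed.

(** A link has only these two members, and it is entered in both colours. *)
Let link_colors c x : c < nc -> x < nx -> K (nc, x) (c, x) <> K (c, x) (c, x).
Proof.
move=> Hc Hx E; have Ht : hyperedges (c, x) by rewrite /hyperedges /= Hc ltnW.
have [|y0 [_ M0 E0 _]] := @supply (c, x) 0 Ht; first by [].
have [|y1 [_ M1 E1 _]] := @supply (c, x) 1 Ht; first by [].
have H y : member y (c, x) -> K y (c, x) = K (c, x) (c, x).
  case: y => a b; rewrite /member /= Hx => /andP[/eqP-> /orP[]/eqP->] //.
by rewrite H // in E0; rewrite H // E0 in E1.
Qed.

(** A link crossed in one colour would have both members in that colour. *)
Let through_clause y y' t i : hyperedges t -> copies y -> copies y' -> y' != y ->
  member y t -> member y' t -> K y t = i -> K y' t = i -> nx <= t.2.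
Proof.
move=> /andP[Hc Hx] Vy Vy' Ny; case: t Hc Hx => c x /= Hc _; rewrite /member /=.
have [lt_x|//] := ltnP x nx.
case: y Vy Ny => a b _; case: y' Vy' => a' b' _ Ny /andP[/= /eqP E1 H1] /andP[/= /eqP E2 H2] Ky Ky'.
have := link_colors Hc lt_x.
move: Ny Ky Ky'; rewrite {}E1 {}E2; move: H1 H2 => /orP[]/eqP-> /orP[]/eqP->; rewrite ?eqxx //;
  by move=> _ -> ->.
Qed.

(** The common copy lies in links only, and these are not crossed. So it is reached from its port,
    and its colour does not depend on [c]. *)
Let hub_copy c x : c < nc -> x < nx -> K (nc, x) (c, x) = sg (nc, x).
Proof.
move=> Hc Hx; have Ht : hyperedges (c, x) by rewrite /hyperedges /= Hc ltnW.
have Hv : copies (nc, x) by rewrite /copies /= leqnn.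
have Ha : adj (4, (nc, x)) (5, (c, x)).
  by rewrite /gadget_adj /valid /arc /= Ht Hv /member /= Hx !eqxx.
have [y [Vy My Ky Hy]] := supply Ht (col_lt2 Ha).
have Ey : y = (nc, x).
  case: y My Ky {Vy Hy} => a b; rewrite /member /= Hx => /andP[/eqP-> /orP[]/eqP->] // Kc.
  by case: (link_colors Hc Hx); apply: esym Kc.
move: Hy; rewrite Ey; case=> [-> //|[t' [y' [[Ht' Vy'] N1 N2 [M1 M2] [K1 K2]]]]].
have := through_clause Ht' Hv Vy' N2 M1 M2 K1 K2.
case: t' Ht' M1 {N1 M2 K1 K2} => c' x' /andP[/= Hc' _]; rewrite /member /= [x' < nx]ltnNge.
by move=> + Hn; rewrite Hn /= => /andP[/eqP E _]; lia.
Qed.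

(** A member [(c, x)] by which hyperedge [c] is entered in colour [i] has no other hyperedge to come
    from but its link, which is not crossed; so its port edge has colour [i]. Its edge to the link
    has colour [i] too, and the link forces [1 - i] on the common copy. The reversal is the reason
    for comparing with 0. *)
Lemma coloring_splits : splitting (fun x => col (3, (nc, x)) (4, (nc, x)) == 0).
Proof.
move=> c b Hc; pose i := nat_of_bool b.
have Ht : hyperedges (c, nx) by rewrite /hyperedges /= Hc leqnn.
have [|[a x] [/andP[/= _ Hx] My Ky Hy]] := @supply (c, nx) i Ht; first by rewrite /i; case: (b).
move: My; rewrite /member /= ltnn => /andP[/eqP Ea Hi]; subst a.
have Vy : copies (c, x) by rewrite /copies /= ltnW.
exists x; split=> //; rewrite -/(sg (nc, x)).
have Sy : sg (c, x) = i.
  case: Hy => // -[t' [y' [[Ht' Vy'] N1 N2 [M1 M2] [K1 K2]]]].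
  have Hn := through_clause Ht' Vy Vy' N2 M1 M2 K1 K2.
  case: t' Ht' M1 N1 Hn {M2 K1 K2} => c' x' /andP[/= Hc' Hx']; rewrite /member /= [x' < nx]ltnNge.
  move=> + + Hn; rewrite Hn /= => /andP[/eqP-> _]; rewrite xpair_eqE eqxx /=; lia.
have Hl : hyperedges (c, x) by rewrite /hyperedges /= Hc ltnW.
have Ha : adj (4, (c, x)) (5, (c, x)).
  by rewrite /gadget_adj /valid /arc /= Hl Vy /member /= Hx !eqxx orbT.
have [[a' b'] [Vy' My Ky' Hy']] := supply Hl (col_lt2 Ha).
have Eb : (a', b') = (c, x).
  move: My Ky'; rewrite /member /= Hx => /andP[/eqP-> /orP[]/eqP->] // Kc.
  by case: (link_colors Hc Hx); apply: Kc.
have Ej : col (4, (c, x)) (5, (c, x)) = i.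
  (* The link may also be reached by crossing hyperedge [c] itself, but there the edge of [(c, x)]
     has the colour [i] as well. *)
  move: Hy'; rewrite Eb Sy; case=> [->//|[t' [y' [[Ht' Vy''] N1 N2 [M1 M2] [K1 K2]]]]].
  have Hn := through_clause Ht' Vy Vy'' N2 M1 M2 K1 K2.
  rewrite -K1 -Ky; congr (K _ _).
  case: t' Ht' M1 Hn {N1 M2 K1 K2} => c' x' /andP[/= Hc' Hx']; rewrite /member /= [x' < nx]ltnNge.
  by move=> + Hn; rewrite Hn /= => /andP[/eqP-> _]; congr (_, _); apply/eqP; rewrite eqn_leq Hx'.
have := link_colors Hc Hx; rewrite hub_copy // /K Ej.
have Hs : adj (3, (nc, x)) (4, (nc, x)).
  by rewrite /gadget_adj /valid /arc /copies /= leqnn Hx eqxx.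
have := col_lt2 Hs; rewrite -/(sg _); rewrite /i; case: (b) => /=; case: (sg _) => [|[|]] //.
Qed.

End Split.
End Hypergraph.

(** * Mixed-radix numbering of the vertices *)

Section Numbering.
Variables (nc nx : nat).

Definition ncopies := nc.+1 * nx.
Definition nedges := nc * nx.+1.
Definition nvertices := 3 + 4 * ncopies + 6 * nedges.

Definition decode (v : nat) : vertex :=
  if v < 3 then (0, (0, v))
  else if v < 3 + 4 * ncopies then
    (1 + (v - 3) %/ ncopies, (((v - 3) %% ncopies) %/ nx, ((v - 3) %% ncopies) %% nx))
  else
    (5 + (v - (3 + 4 * ncopies)) %/ nedges,
      (((v - (3 + 4 * ncopies)) %% nedges) %/ nx.+1,
       ((v - (3 + 4 * ncopies)) %% nedges) %% nx.+1)).

Definition number (w : vertex) : nat :=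
  if w.1 == 0 then w.2.2
  else if w.1 < 5 then 3 + ((w.1 - 1) * ncopies + (w.2.1 * nx + w.2.2))
  else 3 + 4 * ncopies + ((w.1 - 5) * nedges + (w.2.1 * nx.+1 + w.2.2)).

Notation vval := (valid (copies nc nx) (hyperedges nc nx)).

Lemma valid_kind w : vval w -> [\/ w.1 = 0 /\ w.2.1 = 0 /\ w.2.2 < 3,
  0 < w.1 < 5 /\ w.2.1 <= nc /\ w.2.2 < nx | 4 < w.1 < 11 /\ w.2.1 < nc /\ w.2.2 <= nx].
Proof.
case/partP => [j Hj|k y Hk /andP[? ?]|k t Hk /andP[? ?]].
- by apply: Or31.
- by apply: Or32.
- by apply: Or33.
Qed.

Lemma lex_lt i j m n : i < m -> j < n -> i * n + j < m * n.
Proof. by move=> Hi Hj; nia. Qed.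

Lemma number_lt w : vval w -> number w < nvertices.
Proof.
case: w => k [i j] /valid_kind; rewrite /number /nvertices /= => -[[-> [_ H]]|[Hk [Hi Hj]]|[Hk [Hi Hj]]].
- rewrite eqxx; lia.
- have -> : (k == 0) = false by lia.
  have -> : k < 5 by lia.
  have := @lex_lt i j nc.+1 nx Hi Hj; rewrite -/ncopies => H.
  have := @lex_lt (k - 1) (i * nx + j) 4 ncopies _ H; lia.
- have -> : (k == 0) = false by lia.
  have -> : (k < 5) = false by lia.
  have := @lex_lt i j nc nx.+1 Hi; rewrite ltnS -/nedges => /(_ Hj) H.
  have := @lex_lt (k - 5) (i * nx.+1 + j) 6 nedges _ H; lia.
Qed.

Lemma numberK w : vval w -> decode (number w) = w.
Proof.
case: w => k [i j] /valid_kind; rewrite /number /decode /= => -[[-> [-> H]]|[Hk [Hi Hj]]|[Hk [Hi Hj]]].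
- by rewrite eqxx H.
- have -> : (k == 0) = false by lia.
  have -> : k < 5 by lia.
  have H := @lex_lt i j nc.+1 nx Hi Hj; rewrite -/ncopies in H.
  have H' := @lex_lt (k - 1) (i * nx + j) 4 ncopies _ H.
  have -> : (3 + ((k - 1) * ncopies + (i * nx + j)) < 3) = false by rewrite ltnNge leq_addr.
  have -> : 3 + ((k - 1) * ncopies + (i * nx + j)) < 3 + 4 * ncopies by rewrite ltn_add2l H' //; lia.
  rewrite addKn; have nx0 : 0 < nx by lia.
  rewrite divnMDl ?modnMDl ?(modn_small H) ?(divn_small H) ?divnMDl ?modnMDl //; last by lia.
  by rewrite (divn_small Hj) (modn_small Hj) !addn0; congr (_, _); lia.
- have -> : (k == 0) = false by lia.
  have -> : (k < 5) = false by lia.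
  have H := @lex_lt i j nc nx.+1 Hi Hj; rewrite -/nedges in H.
  set v := _ + (_ + _); have -> : (v < 3) = false by rewrite /v ltnNge -!addnA leq_addr.
  have -> : (v < 3 + 4 * ncopies) = false by rewrite /v ltnNge leq_addr.
  rewrite {}/v addKn.
  rewrite divnMDl ?modnMDl ?(modn_small H) ?(divn_small H) ?divnMDl ?modnMDl //; last by lia.
  have Hj' : j < nx.+1 by lia.
  by rewrite (divn_small Hj') (modn_small Hj') !addn0; congr (_, _); lia.
Qed.

Lemma decode_valid v : v < nvertices -> vval (decode v) /\ number (decode v) = v.
Proof.
rewrite /nvertices /decode => Hv; case: (ltnP v 3) => [H3|H3]; first by split.
case: ltnP => Hy.
  have Hlt : v - 3 < 4 * ncopies by lia.
  have n0 : 0 < ncopies by case: (ncopies) Hlt; lia.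
  have x0 : 0 < nx by move: n0; rewrite muln_gt0.
  have Hk : (v - 3) %/ ncopies < 4 by rewrite ltn_divLR.
  set u := (v - 3) %% ncopies; have Hu : u < ncopies by rewrite ltn_mod.
  have Hu1 : u %/ nx < nc.+1 by rewrite ltn_divLR.
  have Hu2 : u %% nx < nx by rewrite ltn_mod.
  split; first by rewrite valid_y ?addKn /copies /= ?Hu2 ?andbT //; lia.
  rewrite /number /=; have -> : 1 + (v - 3) %/ ncopies < 5 by lia.
  by rewrite addKn -divn_eq /u -divn_eq; lia.
have Hlt : v - (3 + 4 * ncopies) < 6 * nedges by lia.
have n0 : 0 < nedges by case: (nedges) Hlt; lia.
have Hk : (v - (3 + 4 * ncopies)) %/ nedges < 6 by rewrite ltn_divLR.
set u := (v - (3 + 4 * ncopies)) %% nedges; have Hu : u < nedges by rewrite ltn_mod.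
have Hu1 : u %/ nx.+1 < nc by rewrite ltn_divLR.
have Hu2 : u %% nx.+1 < nx.+1 by rewrite ltn_mod.
split; first by rewrite valid_t /hyperedges /= ?Hu1 //; lia.
rewrite /number /=.
by rewrite addKn -divn_eq /u -divn_eq; lia.
Qed.

End Numbering.

(** * The graph of a hypergraph and its conflict-free connection number *)

Section HyperGraph.
Variables (nc nx : nat) (hinc : nat -> nat -> bool).
Hypothesis two : forall c, c < nc -> exists x x',
  [/\ x < nx, x' < nx, x != x', hinc c x & hinc c x'].

Notation n := (nvertices nc nx).
Notation vy := (copies nc nx).
Notation vt := (hyperedges nc nx).

Definition hyper_adj (u v : nat) : bool :=
  gadget_adj (member nc nx hinc) vy vt (decode nc nx u) (decode nc nx v).
Definition hyper_graph : rel 'I_n := fun u v => hyper_adj u v.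

Let dec (x : 'I_n) : vertex := decode nc nx x.
Let enc (w : vertex) : 'I_n := insubd (Ordinal (isT : 0 < n)) (number nc nx w).

Let encK w : valid vy vt w -> dec (enc w) = w.
Proof. by move=> Hw; rewrite /dec /enc insubdK ?numberK //; apply: number_lt. Qed.

Let decK x : enc (dec x) = x.
Proof.
apply: val_inj; rewrite /enc /dec; have [_ E] := decode_valid (ltn_ord x).
by rewrite insubdK ?E //; apply: ltn_ord.
Qed.

Let dec_valid x : valid vy vt (dec x).
Proof. by have [] := decode_valid (ltn_ord x). Qed.

Let members2 := hyper_members two.

Lemma hyper_graph_simple : simple_graph hyper_graph.
Proof. exact: (grel_simple _ _ _ dec). Qed.

Lemma hyper_graph_connected : connected hyper_graph.
Proof. exact: (grel_connected encK decK dec_valid members2). Qed.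

Lemma hyper_graph_h : h hyper_graph = 2.
Proof. exact: (h_grel encK decK dec_valid members2). Qed.

Lemma hyper_graph_colorable3 : cf_colorable hyper_graph 3.
Proof. exact: (colorable3 encK decK dec_valid members2). Qed.

Lemma splitting_colorable f : splitting nc nx hinc f -> cf_colorable hyper_graph 2.
Proof.
move=> Hf; exact: (colorable2 encK decK dec_valid (sig := fun y => if y.1 == nc then ~~ f y.2 else f y.2) (hyper_sig Hf) (hyper_linear two)).
Qed.

Lemma colorable_splitting : cf_colorable hyper_graph 2 -> exists f, splitting nc nx hinc f.
Proof.
case=> c [Hc Hp].
exists (fun x => c [set enc (3, (nc, x)); enc (4, (nc, x))]%SET == 0).
apply: (@coloring_splits nc nx hinc (fun v w => c [set enc v; enc w]%SET)).
- by move=> v w; rewrite finset.setUC.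
- move=> v w vw; apply: Hc; have [Hv Hw] := adj_valid vw.
  by rewrite /hyper_graph /hyper_adj -!/(dec _) !encK.
move=> v w Hv Hw vw; have Ne : enc v != enc w.
  by apply: contraNneq vw => E; rewrite -(encK Hv) E encK.
have [p [Hpp Ep Up [a Ca]]] := Hp _ _ Ne.
exists (map dec p); split.
- rewrite -(encK Hv) path_map; exact: Hpp.
- by rewrite -(encK Hv) last_map Ep encK.
- by rewrite -(encK Hv) -map_cons map_inj_uniq //; apply: can_inj decK.
- exists a; rewrite -Ca; congr (count_mem a _).
  rewrite -{1}(encK Hv); elim: p (enc v) {Hpp Ep Up Ca} => //= z p IH u.
  by rewrite !decK IH.
Qed.

Lemma hyper_graph_cfc2 f : splitting nc nx hinc f -> cfc hyper_graph = 2.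
Proof.
move=> /splitting_colorable H2; have [_ //] : h hyper_graph = 2 /\ cfc hyper_graph = 2.
have [Hs Hi] := hyper_graph_simple.
apply/(h2_cfc2 Hs Hi hyper_graph_connected); split=> //.
exact: (h2_cut Hs Hi hyper_graph_connected hyper_graph_h).
Qed.

Lemma hyper_graph_cfc3 : ~ (exists f, splitting nc nx hinc f) -> cfc hyper_graph = 3.
Proof.
move=> N; apply: cfc_eq; first exact: hyper_graph_colorable3.
move=> j Hj /cf_colorable_leq H; apply: N; apply: colorable_splitting.
by apply: H; rewrite -ltnS.
Qed.

End HyperGraph.

(** * The computation tableau as a set of clauses *)

Section Tableau.
Variable M : TM.
Notation tapeno := 'I_(ntapes M).+1.
Notation msym := (symbol (aux M)).
Definition local_view : finType := (state M * {ffun tapeno -> msym})%type.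

Definition next (v : local_view) : state M * (tapeno -> msym * move) :=
  if final v.1 then (v.1, fun k => (v.2 k, Stay)) else trans v.1 v.2.

Definition view_of (c : config M) : local_view := (c.1, [ffun i => scanned (c.2 i)]).

Lemma step_next c : step c =
  ((next (view_of c)).1, [ffun i => write_move (c.2 i) ((next (view_of c)).2 i)]).
Proof.
case: c => q ts; rewrite /step /next /=; case: ifP => _; last by case: trans.
by congr (_, _); apply/ffunP => i; rewrite !ffunE /= ffunE; case: (ts i) => -[].
Qed.

Variables (x : word) (Q time D : nat).

(* Position [D] is that of the head. *)
Definition cell (tp : tape (aux M)) (p : nat) : msym :=
  if p < D then nth None tp.1.1 (D - p.+1)
  else if p == D then tp.1.2 else nth None tp.2 (p - D.+1).

Definition src (m : move) (p : nat) : nat :=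
  match m with Left => p.-1 | Stay => p | Right => p.+1 end.

(** The head stays at [D] and the contents shift, so a new cell is a copy of a neighbour, or the
    written symbol where that arrives. At 0 a move to the left has no cell to copy from. *)
Lemma cell_move tp a m p : 0 < p ->
  cell (write_move tp (a, m)) p = if src m p == D then a else cell tp (src m p).
Proof.
case: tp => -[l b] r p0; rewrite /cell; case: m => /=.
- rewrite nth_behead; case: (ltngtP p D) => Hp.
  + have -> : (p.-1 == D) = false by lia.
    have -> : p.-1 < D by lia.
    by congr nth; lia.
  + case: eqP => E.
      by have -> : p - D.+1 = 0; first lia.
    have -> : (p.-1 < D) = false by lia.
    by have -> : p - D.+1 = (p.-1 - D.+1).+1; first lia.
  + have -> : (p.-1 == D) = false by lia.
    have -> : p.-1 < D by lia.
    by rewrite -nth0; congr nth; lia.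
- by case: ltngtP.
- rewrite nth_behead; case: (ltngtP p D) => Hp.
  + case: eqP => E.
      by have -> : D - p.+1 = 0; first lia.
    have -> : p.+1 < D by lia.
    by have -> : D - p.+1 = (D - p.+2).+1; first lia.
  + have -> : (p.+1 == D) = false by lia.
    have -> : (p.+1 < D) = false by lia.
    by congr nth; lia.
  + have -> : (p.+1 == D) = false by lia.
    have -> : (p.+1 < D) = false by lia.
    by rewrite -nth0; congr nth; lia.
Qed.

Lemma cell_head tp : cell tp D = scanned tp.
Proof. by rewrite /cell ltnn eqxx. Qed.

Lemma cell_load w p :
  cell (load w) p = if p < D then None else nth None [seq Some (inl b) | b <- w] (p - D).
Proof.
rewrite /cell /load /=; case: ltngtP => Hp.
- by rewrite nth_nil.
- by rewrite nth_behead; congr nth; lia.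
- by rewrite Hp subnn nth0.
Qed.

(* Propositional variables: the state and the contents of the cells; the
   certificate is described by "has length at most p" and by its bits. *)
Definition atom : finType := (state M + tapeno * msym + bool)%type.
Definition st q : atom := inl (inl q).
Definition ce k a : atom := inl (inr (k, a)).
Definition len : atom := inr true.
Definition cbit : atom := inr false.

(** In this order: four special clauses (initial state, monotony of [len], length at most [Q],
    answer not [false]), initial contents, certificate on tape 1, next state, symbol written, symbol
    shifted. *)
Definition family : finType :=
  ('I_4 + tapeno * msym + option bool + local_view + local_view * tapeno
   + local_view * tapeno * msym)%type.

(** Positions are coded so that [patterns] is a fixed finite list for each family; the input and the
    indices enter through [guard] and [instance] alone. *)
Definition pos (i p : nat) : nat :=
  match i with 0 => p | 1 => p.+1 | 2 => p.-1 | 3 => D | 4 => p - D | _ => 0 end.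

Definition src_code (m : move) : nat := match m with Left => 2 | Stay => 0 | Right => 1 end.

Lemma pos_src m p : pos (src_code m) p = src m p.
Proof. by case: m. Qed.

(* A literal: sign, atom, time shift, code of the position. *)
Definition pattern : Type := (bool * atom * bool * nat)%type.

Definition premises (v : local_view) : seq pattern :=
  (false, st v.1, false, 5) :: [seq (false, ce k (v.2 k), false, 3) | k <- enum tapeno].

(** A filtered list, since the machine may have tape 0 only. *)
Definition ce1 (a : msym) : seq pattern :=
  [seq (true, ce k a, false, 0) | k : tapeno <- enum tapeno & val k == 1].

Definition patterns (f : family) : seq pattern :=
  match f with
  | inl (inl (inl (inl (inl i)))) =>
    match val i with
    | 0 => [:: (true, st (start M), false, 5)]
    | 1 => [:: (false, len, false, 0); (true, len, false, 1)]
    | 2 => [:: (true, len, false, 0)]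
    | _ => [:: (false, ce ord0 (Some (inl false)), false, 3)]
    end
  | inl (inl (inl (inl (inr ka)))) => [:: (true, ce ka.1 ka.2, false, 0)]
  | inl (inl (inl (inr None))) => (false, len, false, 4) :: ce1 None
  | inl (inl (inl (inr (Some b)))) =>
      (true, len, false, 4) :: (~~ b, cbit, false, 4) :: ce1 (Some (inl b))
  | inl (inl (inr v)) => rcons (premises v) (true, st (next v).1, true, 5)
  | inl (inr (v, k)) => rcons (premises v) (true, ce k ((next v).2 k).1, true, 0)
  | inr (v, k, b) => rcons (rcons (premises v)
      (false, ce k b, false, src_code ((next v).2 k).2)) (true, ce k b, true, 0)
  end.

(** [D] cells on each side of the head. Each step loses one more cell at either border, and
    [time <= D] keeps the scanned cell determined to the end. *)
Definition row_width := D.*2.+1.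

Definition input_symbol (p : nat) (a : msym) : bool :=
  match a with
  | None => (p < D) || (size x <= p - D)
  | Some (inl b) => [&& D <= p, p - D < size x & nth false x (p - D) == b]
  | Some (inr _) => false
  end.

Definition guard (f : family) (t p : nat) : bool :=
  match f with
  | inl (inl (inl (inl (inl i)))) =>
    match val i with
    | 0 => (t == 0) && (p == 0)
    | 1 => (t == 0) && (p.+1 < row_width)
    | 2 => (t == 0) && (p == Q)
    | _ => (t == time) && (p == 0)
    end
  | inl (inl (inl (inl (inr (k, a))))) =>
    (t == 0) && (if k == 0 :> nat then input_symbol p a
                 else (a == None) && ((k != 1 :> nat) || (p < D)))
  | inl (inl (inl (inr _))) => [&& t == 0, 0 < ntapes M & D <= p]
  | inl (inl (inr v)) => (t < time) && (p == 0)
  | inl (inr (v, k)) => [&& t < time, 0 < p & pos (src_code ((next v).2 k).2) p == D]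
  | inr (v, k, b) => [&& t < time, 0 < p, p.+1 < row_width
                       & pos (src_code ((next v).2 k).2) p != D]
  end.

Definition instance (t p : nat) (l : pattern) : bool * atom * nat * nat :=
  let: (s, a, d, i) := l in (s, a, t + d, pos i p).

Definition true_in (al : atom -> nat -> nat -> bool) (l : bool * atom * nat * nat) : bool :=
  let: (s, a, t, p) := l in al a t p == s.

Definition satisfying (al : atom -> nat -> nat -> bool) : Prop :=
  forall f t p, t <= time -> p < row_width -> guard f t p ->
    has (true_in al) (map (instance t p) (patterns f)).

Hypotheses (time_D : time <= D) (Q_D : Q <= D).

Lemma input_symbolE p a : input_symbol p a = (cell (load x) p == a).
Proof.
rewrite cell_load /input_symbol; case: (ltnP p D) => Hp.
  by case: a => [[b|a]|].
have [lt_p|le_p] := ltnP (p - D) (size x).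
  by rewrite (nth_map false) //; case: a => [[b|a]|].
by rewrite [nth None _ _]nth_default ?size_map //; case: a => [[b|a]|].
Qed.

Definition run (y : word) (t : nat) : config M := iter t (@step M) (init M [:: x; y]).

Lemma runS y t : run y t.+1 = step (run y t).
Proof. by []. Qed.

Lemma has_premises (al : atom -> nat -> nat -> bool) t p (v : local_view) s : al (st v.1) t 0 ->
  (forall k, al (ce k (v.2 k)) t D) ->
  has (true_in al) (map (instance t p) (premises v ++ s)) ->
  has (true_in al) (map (instance t p) s).
Proof.
move=> Hs Hc; rewrite map_cat has_cat => /orP[|//] /=.
rewrite addn0 Hs /= => /hasP[l /mapP[l' /mapP[k _ ->] ->]] /=.
by rewrite addn0 Hc.
Qed.

Section Forced.
Variable al : atom -> nat -> nat -> bool.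
Hypothesis al_sat : satisfying al.

(** Since [len] is monotone and true at [Q], the place where it becomes true is a length. *)
Definition certificate : word :=
  mkseq (al cbit 0) (find (al len 0) (iota 0 Q)).

Lemma certificate_size : size certificate <= Q.
Proof. by rewrite size_mkseq -[X in _ <= X](size_iota 0 Q) find_size. Qed.

Lemma len_Q : al len 0 Q.
Proof.
have := @al_sat (inl (inl (inl (inl (inl (inord 2)))))) 0 Q; rewrite /= inordK //= /row_width.
by rewrite eqxx !orbF addn0 => H; apply/eqP; apply: H => //; lia.
Qed.

Lemma len_mono p q : p <= q -> q < row_width -> al len 0 p -> al len 0 q.
Proof.
move=> /subnK <-; elim: (q - p) => // d IH; rewrite addSn => Hd Hp.
have := @al_sat (inl (inl (inl (inl (inl (inord 1)))))) 0 (d + p); rewrite /= inordK //= Hd.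
rewrite IH //; last exact: ltnW.
by rewrite !orbF => H; apply/eqP; apply: H => //; lia.
Qed.

Lemma certificate_len p : p < row_width -> al len 0 p = (size certificate <= p).
Proof.
move=> Hp; rewrite size_mkseq; set m := find _ _.
have Hm : al len 0 m.
  have [H|N] := boolP (has (al len 0) (iota 0 Q)).
    by have := nth_find 0 H; rewrite nth_iota //; rewrite has_find size_iota in H.
  by rewrite /m hasNfind // size_iota len_Q.
have mQ : m <= Q by rewrite -[X in _ <= X](size_iota 0 Q) find_size.
have [le_m|lt_m] := leqP m p; first exact: len_mono Hm.
have := before_find 0 lt_m; rewrite nth_iota //; exact: leq_trans lt_m mQ.
Qed.

Lemma forced_init k p : p < row_width -> al (ce k (cell ((run certificate 0).2 k) p)) 0 p.
Proof.
move=> Hp; rewrite /run /= ffunE.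
have [k0|k0] := eqVneq (k : nat) 0.
  rewrite k0 /=; have := @al_sat (inl (inl (inl (inl (inr (k, cell (load x) p)))))) 0 p.
  by rewrite /= k0 eqxx input_symbolE eqxx orbF addn0 => H; apply/eqP; apply: H.
have Hdef a : cell (load (nth [::] [:: x; certificate] k)) p = a -> a = None ->
    (k != 1 :> nat) || (p < D) -> al (ce k a) 0 p.
  move=> _ -> H; have := @al_sat (inl (inl (inl (inl (inr (k, None)))))) 0 p.
  by rewrite /= (negbTE k0) H orbF addn0 => H'; apply/eqP; apply: H'.
have [k1|k1] := eqVneq (k : nat) 1; last first.
  apply: (Hdef _ erefl); last by rewrite k1.
  rewrite cell_load; case: ltnP => // _; rewrite [nth [::] _ _]nth_default ?nth_nil //=.
  by move: k0 k1; case: (nat_of_ord k) => [|[|]].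
have [lt_p|le_p] := ltnP p D.
  by apply: (Hdef _ erefl); rewrite ?lt_p ?orbT // cell_load lt_p.
have nt : 0 < ntapes M by have := ltn_ord k; rewrite k1.
have Hk a : has (true_in al) (map (instance 0 p) (ce1 a)) -> al (ce k a) 0 p.
  case/hasP=> l /mapP[l' /mapP[k' + ->] ->] /=; rewrite mem_filter => /andP[/eqP Ek _].
  by rewrite addn0 => /eqP; have -> : k' = k by apply: val_inj; rewrite /= Ek k1.
rewrite k1 cell_load ltnNge le_p /=.
have Hp' : p - D < row_width by apply: leq_ltn_trans (leq_subr _ _) Hp.
have := certificate_len Hp'; have [le_s|lt_s] := leqP (size certificate) (p - D) => Hl.
  rewrite nth_default; last by rewrite size_map.
  apply: Hk.
  by have := @al_sat (inl (inl (inl (inr None)))) 0 p; rewrite /= nt le_p Hl /=; apply.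
rewrite (nth_map false) //; apply: Hk.
set b := nth _ _ _; have := @al_sat (inl (inl (inl (inr (Some b))))) 0 p.
rewrite /= nt le_p Hl /= => /(_ isT Hp isT); have -> : al cbit (0 + false) (p - D) = b.
  by move: lt_s; rewrite /b size_mkseq => lt_s; rewrite nth_mkseq.
by case: (b).
Qed.

(** The clauses are implications from one row to the next, so whatever holds in the run is forced,
    in the cone of cells that the borders have not influenced. Other atoms may be true as well; no
    clause makes a symbol exclude another. *)
Lemma forced t : t <= time ->
  al (st (run certificate t).1) t 0 /\
  forall k p, t <= p -> p + t < row_width -> al (ce k (cell ((run certificate t).2 k) p)) t p.
Proof.
elim: t => [_|t IH lt_t].
  split; last by move=> k p _; rewrite addn0; apply: forced_init.
  have := @al_sat (inl (inl (inl (inl (inl (inord 0)))))) 0 0; rewrite /= inordK //=.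
  by rewrite orbF => H; apply/eqP; apply: H.
have [Hs Hc] := IH (ltnW lt_t); set v := view_of (run certificate t).
have Hv k : al (ce k (v.2 k)) t D.
  by rewrite ffunE -cell_head; apply: Hc; rewrite /row_width; lia.
rewrite runS step_next; split=> [|k p Htp Hpw] /=.
  have H := @al_sat (inl (inl (inr v))) t 0 (ltnW lt_t) isT.
  have {H} : has (true_in al) (map (instance t 0) (rcons (premises v) (true, st (next v).1, true, 5))).
    by apply: H; rewrite /= lt_t.
  by rewrite -cats1 => /(has_premises Hs Hv); rewrite /= orbF addn1 => /eqP.
rewrite ffunE; case E: ((next v).2 k) => [a m].
rewrite cell_move; last lia.
have H := @al_sat _ t p (ltnW lt_t).
have pw : p < row_width by lia.
case: eqP => [Es|/eqP Ns].
  have {H} : has (true_in al) (map (instance t p)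
      (rcons (premises v) (true, ce k ((next v).2 k).1, true, 0))).
    by apply: (H (inl (inr (v, k))) pw); rewrite /= lt_t E pos_src Es eqxx andbT; lia.
  by rewrite -cats1 => /(has_premises Hs Hv); rewrite /= orbF addn1 E => /eqP.
set b := cell _ _.
have {H} : has (true_in al) (map (instance t p) (rcons (rcons (premises v)
      (false, ce k b, false, src_code ((next v).2 k).2)) (true, ce k b, true, 0))).
  apply: (H (inr (v, k, b)) pw); rewrite /= lt_t E pos_src Ns andbT; lia.
rewrite -!cats1 -catA => /(has_premises Hs Hv); rewrite /= orbF addn1 addn0 E pos_src Hc /=.
- by move/eqP.
- by case: (m) => /=; lia.
- by case: (m) => /=; lia.
Qed.

Lemma read_scanned (A : finType) (tp : tape A) b s : read tp = b :: s -> scanned tp = Some (inl b).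
Proof. by case: tp => -[l [[b'|a]|]] r //= [->]. Qed.

(** The answer is known to be a single bit, and its symbol is forced; so forbidding the symbol of
    [false] amounts to acceptance. *)
Lemma forced_accepts b : halts_with (run certificate time) [:: b] -> b.
Proof.
case=> _ /read_scanned Hb; have [_ /(_ ord0 D time_D)] := forced (leqnn time).
rewrite cell_head Hb => H; have := @al_sat (inl (inl (inl (inl (inl (inord 3)))))) time 0 (leqnn _) isT.
rewrite /= inordK //= !eqxx addn0 orbF => /(_ isT).
by move: H; case: (b) => //; rewrite /row_width => ->; [|lia].
Qed.

End Forced.

Section Accepting.
Variable y : word.
Hypothesis size_y : size y <= Q.
Hypothesis accepts : halts_with (run y time) [:: true].

Definition run_atoms (a : atom) (t p : nat) : bool :=
  match a with
  | inl (inl q) => (run y t).1 == q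
  | inl (inr (k, s)) => cell ((run y t).2 k) p == s
  | inr true => size y <= p
  | inr false => nth false y p
  end.

(** A clause about a view other than the present one is satisfied by a negated premise. *)
Lemma view_premises t p v s :
  (v = view_of (run y t) -> has (true_in run_atoms) (map (instance t p) s)) ->
  has (true_in run_atoms) (map (instance t p) (premises v ++ s)).
Proof.
move=> H; rewrite map_cat has_cat.
have [Ev|Nv] := eqVneq v (view_of (run y t)); first by rewrite H // orbT.
apply/orP; left; rewrite /premises /= addn0.
have [Eq|Nq] := eqVneq (run y t).1 v.1 => //=.
have [k Nk] : exists k, v.2 k != scanned ((run y t).2 k).
  apply/existsP; apply: contraNT Nv; rewrite negb_exists => /forallP Hk.
  case: (v) Eq Hk => q f /= <- Hk; apply/eqP; rewrite /view_of; congr (_, _); apply/ffunP => k.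
  by rewrite ffunE; apply/eqP; move: (Hk k); rewrite negbK.
apply/hasP; exists (instance t p (false, ce k (v.2 k), false, 3)).
  by apply: map_f; apply: map_f; rewrite mem_enum.
by rewrite /= addn0 cell_head eqbF_neg eq_sym.
Qed.

Lemma run_satisfying : satisfying run_atoms.
Proof.
have Hce1 a p : 0 < ntapes M -> D <= p -> nth None [seq Some (inl b) | b <- y] (p - D) = a ->
    has (true_in run_atoms) (map (instance 0 p) (ce1 a)).
  move=> nt Hp Ea; pose k : tapeno := inord 1; have Ek : k = 1 :> nat by rewrite inordK.
  apply/hasP; exists (instance 0 p (true, ce k a, false, 0)).
    by apply: map_f; apply/mapP; exists k => //; rewrite mem_filter /= Ek eqxx mem_enum.
  by rewrite /= ?addn0 /run /= ffunE Ek /= cell_load ltnNge Hp /= Ea eqxx.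
move=> [[[[[i|[k a]]|o]|v]|[v k]]|[[v k] b]] t p Ht Hp.
- case: i => -[|[|[|[|]]]] //= _.
  + by case/andP=> /eqP-> _; rewrite /= eqxx.
  + move=> _; rewrite /= !eqbF_neg !eqb_id; case: leqP => //= H; by rewrite (leqW H).
  + by case/andP=> _ /eqP->; rewrite /= eqb_id size_y.
  + case/andP=> /eqP-> _; rewrite /= ?addn0 cell_head orbF.
    by case: accepts => _ /read_scanned ->.
- rewrite /guard => /andP[/eqP-> H]; rewrite /= orbF ?addn0 /run /= ffunE eqb_id.
  move: H; have [k0|k0] := eqVneq (k : nat) 0.
    by rewrite k0 /= input_symbolE.
  case/andP=> /eqP-> H; rewrite cell_load; case: ltnP H => // Hp'; rewrite orbF => k1.
  by rewrite [nth [::] _ _]nth_default ?nth_nil //=; move: k0 k1; case: (nat_of_ord k) => [|[|]].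
- rewrite /guard => /and3P[/eqP-> nt Hp']; case: o => [b|] /=.
    rewrite ?addn0 eqb_id; have [//|lt_y] := leqP (size y) (p - D); rewrite /=.
    have [Eb|Nb] := eqVneq (nth false y (p - D)) b; last first.
      by move: Nb; case: nth; case: (b).
    by rewrite Hce1 ?orbT // (nth_map false) // Eb.
  rewrite ?addn0 !eqbF_neg; have [le_y|//] := leqP (size y) (p - D).
  by rewrite Hce1 // nth_default ?size_map.
- rewrite /guard => /andP[lt_t _]; rewrite [patterns _]/= -cats1; apply: view_premises => ->.
  by rewrite /= addn1 runS step_next eqxx.
- rewrite /guard => /and3P[lt_t p0 /eqP Es]; rewrite [patterns _]/= -cats1; apply: view_premises => Ev.
  rewrite /= addn1 runS step_next /= ffunE -Ev; case E: ((next v).2 k) Es => [a m] /= Es.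
  by rewrite cell_move // -pos_src Es eqxx /= eqxx.
- rewrite /guard => /and4P[lt_t p0 _ Ns]; rewrite [patterns _]/= -!cats1 -catA; apply: view_premises => Ev.
  rewrite /= addn1 ?addn0 runS step_next /= ffunE -Ev; case E: ((next v).2 k) Ns => [a m] /= Ns.
  by rewrite cell_move // -pos_src (negbTE Ns) eqbF_neg eqb_id; case: eqP.
Qed.

End Accepting.
End Tableau.

(** * From clauses to 2-colouring of hypergraphs *)

Section SatHypergraph.
Variables (M : TM) (x : word) (Q time D : nat).
Notation width := (row_width D).

Definition natoms := #|atom M| * (time.+1 * width).
Definition index (a : atom M) (t p : nat) : nat :=
  enum_rank a * (time.+1 * width) + (t * width + p).

Definition npoints := natoms.*2.+1.
Definition nhyper := natoms + #|family M| * (time.+1 * width).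

(* The literals of a variable [v] are the points [2 v] (positive) and
   [2 v + 1]; the last point is false in every clause. *)
Definition zpoint := natoms.*2.
Definition point (l : bool * atom M * nat * nat) : nat :=
  let: (s, a, t, p) := l in (index a t p).*2 + ~~ s.

(** Every index has to name a hyperedge. Where the guard fails it is [{0, 1}], the two literals of
    the variable 0, which have different colours in any case. *)
Definition clause_edge (f : family M) (t p i : nat) : bool :=
  if guard x Q time D f t p then
    (i == zpoint) || (i \in [seq point (instance D t p l) | l <- patterns f])
  else i < 2.

Definition sat_inc (c i : nat) : bool :=
  if c < natoms then i %/ 2 == c
  else let u := c - natoms in
    has (fun f : family M => (enum_rank f == u %/ (time.+1 * width) :> nat) &&
      clause_edge f ((u %% (time.+1 * width)) %/ width) ((u %% (time.+1 * width)) %% width) i)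
      (enum (family M)).

Hypotheses (time_D : time <= D) (Q_D : Q <= D).

Lemma index_lt a t p : t <= time -> p < width -> index a t p < natoms.
Proof.
move=> Ht Hp; rewrite /index /natoms.
have H := @lex_lt t p time.+1 width Ht Hp.
by have := @lex_lt (enum_rank a) (t * width + p) _ _ (ltn_ord _) H.
Qed.

Lemma index_decode v : v < natoms -> exists a t p, [/\ t <= time, p < width & index a t p = v].
Proof.
move=> Hv; set w := time.+1 * width; have w0 : 0 < w by rewrite /w muln_gt0 /=.
have Ha : v %/ w < #|atom M| by rewrite ltn_divLR.
exists (enum_val (Ordinal Ha)), (v %% w %/ width), (v %% w %% width); split.
- by rewrite -ltnS ltn_divLR // ltn_mod.
- by rewrite ltn_mod.
- by rewrite /index enum_valK /= -divn_eq -/w -divn_eq.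
Qed.

Lemma index_inj a t p a' t' p' : t <= time -> p < width -> t' <= time -> p' < width ->
  index a t p = index a' t' p' -> [/\ a = a', t = t' & p = p'].
Proof.
move=> Ht Hp Ht' Hp'; rewrite /index; set w := time.+1 * width.
have H := @lex_lt t p time.+1 width Ht Hp; have H' := @lex_lt t' p' time.+1 width Ht' Hp'.
have w0 : 0 < w by apply: leq_ltn_trans H.
move=> E; have E1 : enum_rank a = enum_rank a' :> nat.
  by have := congr1 (fun v => v %/ w) E; rewrite /= !divnMDl // !divn_small // !addn0.
have E2 : t * width + p = t' * width + p'.
  by have := congr1 (fun v => v %% w) E; rewrite /= !modnMDl !modn_small.
split; first by apply: enum_rank_inj; apply: val_inj.
  by have := congr1 (fun v => v %/ width) E2; rewrite /= !divnMDl // !divn_small // !addn0.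
by have := congr1 (fun v => v %% width) E2; rewrite /= !modnMDl !modn_small.
Qed.

Lemma patterns_range f t p : p < width -> guard x Q time D f t p ->
  all (fun l : pattern M => (l.1.2 ==> (t < time)) && (pos D l.2 p < width)) (patterns f).
Proof.
move=> Hp; have HD : D < width by rewrite /row_width; lia.
have HpD : p - D < width by apply: leq_ltn_trans (leq_subr _ _) Hp.
have Hpr v : all (fun l : pattern M => (l.1.2 ==> (t < time)) && (pos D l.2 p < width)) (premises v).
  by rewrite /premises /= all_map; apply/allP => k _ /=.
have Hc a : all (fun l : pattern M => (l.1.2 ==> (t < time)) && (pos D l.2 p < width)) (ce1 a).
  by rewrite /ce1 all_map; apply/allP => k _ /=.
move: f => [[[[[f|ka]|o]|v]|[v k]]|[[v k] b]].
- by case: f => -[|[|[|[|]]]] //= _ /andP[_ H]; rewrite ?Hp ?H ?HD.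
- by rewrite /= Hp.
- by case: o => [b|] _ /=; rewrite HpD Hc.
- by rewrite /guard => /andP[H _]; rewrite /patterns -cats1 all_cat Hpr /= H.
- by rewrite /guard => /and3P[H _ _]; rewrite /patterns -cats1 all_cat Hpr /= H Hp.
- rewrite /guard => /and4P[H p0 Hp1 _]; rewrite /patterns -!cats1 !all_cat Hpr /= H Hp andbT.
  by case: ((next v).2 k).2 => /=; rewrite ?andbT //; apply: leq_ltn_trans (leq_pred _) Hp.
Qed.

Lemma instance_range (f : family M) t p l : t <= time -> p < width -> guard x Q time D f t p ->
  l \in map (@instance M D t p) (patterns f) -> l.1.2 <= time /\ l.2 < width.
Proof.
move=> Ht Hp Hg /mapP[pat Hl ->]; have := allP (patterns_range Hp Hg) _ Hl.
case: pat {Hl} => [[[s a] d] i] /= /andP[Hd ->]; split=> //.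
by case: d Hd => /=; rewrite ?addn1 ?addn0.
Qed.

Lemma patterns_neq0 (f : family M) : patterns f != [::].
Proof.
case: f => [[[[[f|ka]|o]|v]|[v k]]|[[v k] b]] //=; first by case: f => -[|[|[|[|]]]].
by case: o.
Qed.

Lemma natoms_gt0 : 0 < natoms.
Proof. by rewrite !muln_gt0 /= andbT; apply/card_gt0P; exists (len M). Qed.

Lemma clause_index (f : family M) t p : t <= time -> p < width ->
  let c := natoms + (enum_rank f * (time.+1 * width) + (t * width + p)) in
  c < nhyper /\ forall i, sat_inc c i = clause_edge f t p i.
Proof.
move=> Ht Hp c; have H := @lex_lt t p time.+1 width Ht Hp.
have H' := @lex_lt (enum_rank f) (t * width + p) _ _ (ltn_ord _) H.
have w0 : 0 < time.+1 * width by apply: leq_ltn_trans H.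
split=> [|i]; first by rewrite ltn_add2l.
rewrite /sat_inc /c ltnNge leq_addr /= addKn divnMDl // modnMDl divn_small // modn_small // addn0.
rewrite divnMDl // modnMDl divn_small // modn_small // addn0.
apply/hasP/idP => [[g _ /andP[/eqP E]]|Hf].
  by have -> : g = f by apply: enum_rank_inj; apply: val_inj.
by exists f; rewrite ?mem_enum // eqxx.
Qed.

Lemma hyper_index c : natoms <= c -> c < nhyper -> exists (f : family M) t p,
  [/\ t <= time, p < width & c = natoms + (enum_rank f * (time.+1 * width) + (t * width + p))].
Proof.
move=> Hc Hc'; set w := time.+1 * width; have w0 : 0 < w by rewrite /w muln_gt0 /=.
have Hf : (c - natoms) %/ w < #|family M|.
  by rewrite ltn_divLR // ltn_subLR.
exists (enum_val (Ordinal Hf)), ((c - natoms) %% w %/ width), ((c - natoms) %% w %% width); split.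
- by rewrite -ltnS ltn_divLR // ltn_mod.
- by rewrite ltn_mod.
- by rewrite enum_valK /= -divn_eq -divn_eq subnKC.
Qed.

Lemma point_lt l : l.1.2 <= time -> l.2 < width -> point l < zpoint.
Proof.
case: l => [[[s a] t] p] /= Ht Hp; have := index_lt a Ht Hp; rewrite /zpoint.
by case: s => /=; lia.
Qed.

Lemma sat_inc_two c : c < nhyper -> exists i i',
  [/\ i < npoints, i' < npoints, i != i', sat_inc c i & sat_inc c i'].
Proof.
have n0 := natoms_gt0; move=> Hc; have [lt_c|le_c] := ltnP c natoms.
  exists c.*2, c.*2.+1; rewrite /sat_inc lt_c /npoints; split; lia.
have [f [t [p [Ht Hp ->]]]] := hyper_index le_c Hc.
have [_ E] := clause_index f Ht Hp.
have [Hg|Hg] := boolP (guard x Q time D f t p); last first.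
  by exists 0, 1; rewrite !E /clause_edge (negbTE Hg) /npoints; split; lia.
case Ep: (patterns f) (patterns_neq0 f) => [|pat l] // _.
have Hin : instance D t p pat \in map (@instance M D t p) (patterns f) by rewrite Ep mem_head.
have [H1 H2] := instance_range Ht Hp Hg Hin; have Hlt := point_lt H1 H2.
exists zpoint, (point (instance D t p pat)); rewrite !E /clause_edge Hg eqxx Ep /= mem_head orbT.
by rewrite /npoints -/zpoint; split=> //; lia.
Qed.

Lemma splitting_satisfying g : splitting nhyper npoints sat_inc g ->
  exists al, @satisfying M x Q time D al.
Proof.
(* Complementing a splitting gives a splitting, so the colour of [zpoint] may be taken as falsity. A
   clause then has a point of the other colour, a true literal. *)
move=> Hg; pose h i := g i (+) g zpoint; exists (fun a t p => h (index a t p).*2).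
have Hneg v : v < natoms -> h v.*2.+1 = ~~ h v.*2.
  move=> Hv; have Hv' : v < nhyper by apply: leq_trans Hv (leq_addr _ _).
  have [i [_ Ii Gi]] := Hg v false Hv'; have [j [_ Ij Gj]] := Hg v true Hv'.
  move: Ii Ij; rewrite /sat_inc Hv => /eqP Ei /eqP Ej; rewrite /h.
  have [Hi Hj] : (i = v.*2 \/ i = v.*2.+1) /\ (j = v.*2 \/ j = v.*2.+1) by split; lia.
  by move: Gi Gj; case: Hi => ->; case: Hj => -> -> // ->; case: (g zpoint).
move=> f t p Ht Hp Hgd; have [Hc E] := clause_index f Ht Hp.
have [i [_ + Gi]] := Hg _ (~~ g zpoint) Hc; rewrite E /clause_edge Hgd.
case/orP=> [/eqP Ei|/mapP[l Hl Ei]]; first by move: Gi; rewrite Ei; case: (g zpoint).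
apply/hasP; exists (instance D t p l); first exact: map_f.
have [H1 H2] := instance_range Ht Hp Hgd (map_f _ Hl).
have Hi : h i by rewrite /h Gi; case: (g zpoint).
move: H1 H2 Hi; rewrite {}Ei; case: (instance D t p l) => [[[s a] t'] p'] /= H1 H2.
have Hv := index_lt a H1 H2; case: s => /=; rewrite ?addn0 ?addn1 ?eqb_id //.
by rewrite Hneg // eqbF_neg.
Qed.

Lemma satisfying_splitting al : @satisfying M x Q time D al ->
  exists g, splitting nhyper npoints sat_inc g.
Proof.
move=> Hal; pose v i := [pick w : atom M * 'I_time.+1 * 'I_width | index w.1.1 w.1.2 w.2 == i %/ 2].
pose g i := (i != zpoint) && (if v i is Some w then al w.1.1 w.1.2 w.2 (+) odd i else false).
have Hg l : l.1.2 <= time -> l.2 < width -> g (point l) = true_in al l.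
  case: l => [[[s a] t] p] /= Ht Hp; have Hlt := @point_lt (s, a, t, p) Ht Hp.
  have Hi := index_lt a Ht Hp.
  have E : ((index a t p).*2 + ~~ s) %/ 2 = index a t p by case: (s) => /=; lia.
  rewrite /g /v E; case: pickP => [[[a' t'] p'] /= /eqP E'|N]; last first.
    by have := N (a, Ordinal (Ht : t < time.+1), Ordinal Hp); rewrite /= eqxx.
  have [-> -> ->] := index_inj (ltn_ord t' : t' <= time) (ltn_ord p') Ht Hp E'.
  have -> : ((index a t p).*2 + ~~ s != zpoint) by move: Hlt => /=; rewrite ltn_neqAle => /andP[].
  by rewrite oddD odd_double /=; case: s {Hlt E} => /=; case: (al a t p).
exists g => c b Hc; have [lt_c|le_c] := ltnP c natoms.
  have [a [t [p [Ht Hp Ec]]]] := index_decode lt_c.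
  pose l := (b == al a t p, a, t, p); have Hlt := @point_lt l Ht Hp.
  exists (point l); split.
  - by rewrite /npoints -/zpoint; lia.
  - by rewrite /sat_inc lt_c /l /point Ec; case: (b == _) => /=; lia.
  - by rewrite Hg //= ; case: b {l Hlt}; case: (al a t p).
have [f [t [p [Ht Hp ->]]]] := hyper_index le_c Hc.
have [_ E] := clause_index f Ht Hp.
have n0 := natoms_gt0.
case: b; last first.
  have [Hgd|Hgd] := boolP (guard x Q time D f t p).
    by exists zpoint; rewrite E /clause_edge Hgd /g eqxx; split=> //; rewrite /npoints -/zpoint.
  have [a [t' [p' [Ht' Hp' Ei]]]] := index_decode n0.
  pose l := (~~ al a t' p', a, t', p'); have Hlt := @point_lt l Ht' Hp'.
  exists (point l); rewrite E /clause_edge (negbTE Hgd) Hg //; split.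
  - by rewrite /npoints -/zpoint; lia.
  - by rewrite /point /l Ei; case: (~~ ~~ _).
  - by rewrite /=; case: (al a t' p').
have [Hgd|Hgd] := boolP (guard x Q time D f t p).
  have /hasP[l' /mapP[l Hl ->] Hl'] := Hal f t p Ht Hp Hgd.
  have [H1 H2] := instance_range Ht Hp Hgd (map_f _ Hl); have Hlt := point_lt H1 H2.
  exists (point (instance D t p l)); rewrite E /clause_edge Hgd Hg //; split=> //.
    by rewrite /npoints -/zpoint; lia.
  by apply/orP; right; apply: (map_f (fun l => point (instance D t p l))).
have [a [t' [p' [Ht' Hp' Ei]]]] := index_decode n0.
pose l := (al a t' p', a, t', p'); have Hlt := @point_lt l Ht' Hp'.
exists (point l); rewrite E /clause_edge (negbTE Hgd) Hg //; split.
- by rewrite /npoints -/zpoint; lia.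
- by rewrite /point /l Ei; case: (~~ _).
- by rewrite /=; case: (al a t' p').
Qed.

End SatHypergraph.

(** * The incidence and adjacency relations as expressions *)

Lemma dfn_double a : dfn a -> dfn (fun g => (a g).*2).
Proof. by move=> H; apply: dfn_eq (dfn_add H H) => g; rewrite addnn. Qed.

Ltac dfn_user ::=
  match goal with
  | H : dfn ?a |- dfn ?a => exact: H
  | H : dfn ?a |- dfn (fun g => ?a g) => exact: H
  | |- dfn (fun g => @?a g %/ @?b g) => apply: dfn_div
  | |- dfn (fun g => @?a g %% @?b g) => apply: dfn_mod
  | |- dfn (fun g => (@?a g).*2) => apply: dfn_double
  end.

(** The list is fixed, so the disjunction is written out inside the expression, whose size depends
    on the machine but not on the input. *)
Lemma dfn_has_seq (T : Type) (s : seq T) (F : T -> ctx -> bool) :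
  (forall l, dfn (fun g => F l g)) -> dfn (fun g => has (fun l => F l g) s).
Proof. by move=> HF; elim: s => [|l s IH] /=; last have Hl := HF l; dfn. Qed.

Lemma dfn_mem_seq (T : Type) (s : seq T) (F : T -> ctx -> nat) (a : ctx -> nat) :
  dfn a -> (forall l, dfn (F l)) -> dfn (fun g => a g \in [seq F l g | l <- s]).
Proof.
move=> Ha HF; apply: (dfn_eq (a := fun g => has (fun l => a g == F l g) s)).
  by move=> g; congr nat_of_bool; elim: s => //= l s ->; rewrite inE.
by apply: dfn_has_seq => l; have Hl := HF l; dfn.
Qed.

Section SatInc.
Variables (M : TM) (Q T D : ctx -> nat).
Hypotheses (HQ : dfn Q) (HT : dfn T) (HD : dfn D).

Lemma dfn_natoms : dfn (fun g => natoms M (T g) (D g)).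
Proof. by rewrite /natoms /row_width; dfn. Qed.

Lemma dfn_npoints : dfn (fun g => npoints M (T g) (D g)).
Proof. by have H := dfn_natoms; rewrite /npoints; dfn. Qed.

Lemma dfn_nhyper : dfn (fun g => nhyper M (T g) (D g)).
Proof. by have H := dfn_natoms; rewrite /nhyper /row_width; dfn. Qed.

Variables (t p : ctx -> nat).
Hypotheses (Ht : dfn t) (Hp : dfn p).

Lemma dfn_pos i : dfn (fun g => pos (D g) i (p g)).
Proof. by case: i => [|[|[|[|[|i]]]]]; rewrite /pos; dfn. Qed.

Lemma dfn_input_symbol a : dfn (fun g => @input_symbol M (g.1 false) (D g) (p g) a).
Proof. by case: a => [[b|a]|]; rewrite /input_symbol; dfn. Qed.

Lemma dfn_guard (f : family M) :
  dfn (fun g => guard (g.1 false) (Q g) (T g) (D g) f (t g) (p g)).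
Proof.
case: f => [[[[[[[|[|[|i]]] Hi]|[k a]]|o]|v]|[v k]]|[[v k] b]]; rewrite /guard /row_width /=.
- by dfn.
- by dfn.
- by dfn.
- by dfn.
- have H := dfn_input_symbol a; case: (nat_of_ord k == 0); first by dfn.
  by case: (a == None); case: (nat_of_ord k != 1); dfn.
- by dfn.
- by dfn.
- by have H := dfn_pos (src_code ((next v).2 k).2); dfn.
- by have H := dfn_pos (src_code ((next v).2 k).2); dfn.
Qed.

Lemma dfn_point l : dfn (fun g => point (T g) (D g) (@instance M (D g) (t g) (p g) l)).
Proof.
by case: l => [[[s a] d] i]; have H := dfn_pos i; rewrite /point /instance /index /row_width; dfn.
Qed.

Lemma dfn_clause_edge (f : family M) i : dfn i ->
  dfn (fun g => clause_edge (g.1 false) (Q g) (T g) (D g) f (t g) (p g) (i g)).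
Proof.
move=> Hi; have H := dfn_guard f; have H' := dfn_natoms.
have H2 := dfn_mem_seq (patterns f) Hi dfn_point.
by rewrite /clause_edge /zpoint; dfn.
Qed.

End SatInc.

Lemma dfn_sat_inc M (Q T D c i : ctx -> nat) : dfn Q -> dfn T -> dfn D -> dfn c -> dfn i ->
  dfn (fun g => sat_inc M (g.1 false) (Q g) (T g) (D g) (c g) (i g)).
Proof.
move=> HQ HT HD Hc Hi; have Hn := dfn_natoms M HT HD; rewrite /sat_inc.
apply: dfn_ifb; [by dfn | by dfn |].
apply: dfn_has_seq => f; apply: dfn_and; first by rewrite /row_width; dfn.
by apply: dfn_clause_edge => //; rewrite /row_width; dfn.
Qed.

Section Adjacency.

Definition kd nc nx v := if v < 3 then 0 else
  if v < 3 + 4 * ncopies nc nx then 1 + (v - 3) %/ ncopies nc nx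
  else 5 + (v - (3 + 4 * ncopies nc nx)) %/ nedges nc nx.

Definition id1 nc nx v := if v < 3 then 0 else
  if v < 3 + 4 * ncopies nc nx then ((v - 3) %% ncopies nc nx) %/ nx
  else ((v - (3 + 4 * ncopies nc nx)) %% nedges nc nx) %/ nx.+1.

Definition id2 nc nx v := if v < 3 then v else
  if v < 3 + 4 * ncopies nc nx then ((v - 3) %% ncopies nc nx) %% nx
  else ((v - (3 + 4 * ncopies nc nx)) %% nedges nc nx) %% nx.+1.

Lemma decodeE nc nx v : decode nc nx v = (kd nc nx v, (id1 nc nx v, id2 nc nx v)).
Proof. by rewrite /decode /kd /id1 /id2; case: ifP => // _; case: ifP. Qed.

(** Turns the match on kinds into arithmetical tests. *)
Lemma arcE inc k a b m a' b' : arc inc (k, (a, b)) (m, (a', b')) =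
  [|| [&& k == 0, m == 0 & b' == b.+1],
      [&& k == 0, 0 < m, m <= 3 & b == 0],
      [&& k == 4, m == 5 & inc (a, b) (a', b')]
    | [&& a == a', b == b' &
       [|| ((k == 1) || (k == 2)) && (m == 3), (k == 3) && (m == 4),
           [&& k == 5, 6 <= m & m <= 8], ((k == 7) || (k == 8)) && (m == 6)
         | (k == 6) && ((m == 9) || (m == 10))]]].
Proof.
rewrite /arc /=; do 11?[case: k => [|k]] => //=; do 11?[case: m => [|m]] => //=;
  by rewrite ?andbT ?andbF ?orbF ?xpair_eqE.
Qed.

Variables (nc nx : ctx -> nat) (hinc : ctx -> nat -> nat -> bool).
Hypotheses (Hnc : dfn nc) (Hnx : dfn nx).
Hypothesis Hinc : forall c i, dfn c -> dfn i -> dfn (fun g => hinc g (c g) (i g)).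

Lemma dfn_arc_kinds k a b m a' b' : dfn k -> dfn a -> dfn b -> dfn m -> dfn a' -> dfn b' ->
  dfn (fun g => arc (member (nc g) (nx g) (hinc g)) (k g, (a g, b g)) (m g, (a' g, b' g))).
Proof.
move=> Hk Ha Hb Hm Ha' Hb'; have Hi := Hinc Ha' Hb.
apply: (dfn_eq (fun g => esym (congr1 nat_of_bool
  (arcE (member (nc g) (nx g) (hinc g)) (k g) (a g) (b g) (m g) (a' g) (b' g))))).
rewrite /member /=; dfn.
Qed.

Lemma dfn_arc u v : dfn u -> dfn v ->
  dfn (fun g => arc (member (nc g) (nx g) (hinc g))
    (decode (nc g) (nx g) (u g)) (decode (nc g) (nx g) (v g))).
Proof.
move=> Hu Hv.
have -> : (fun g => nat_of_bool (arc (member (nc g) (nx g) (hinc g))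
    (decode (nc g) (nx g) (u g)) (decode (nc g) (nx g) (v g)))) =
  (fun g => nat_of_bool (arc (member (nc g) (nx g) (hinc g))
    (kd (nc g) (nx g) (u g), (id1 (nc g) (nx g) (u g), id2 (nc g) (nx g) (u g)))
    (kd (nc g) (nx g) (v g), (id1 (nc g) (nx g) (v g), id2 (nc g) (nx g) (v g))))).
  by apply/funext => g; rewrite !decodeE.
by apply: dfn_arc_kinds; rewrite /kd /id1 /id2 /ncopies /nedges; dfn.
Qed.

End Adjacency.

Lemma allpairs_iota (r : nat -> nat -> bool) n m a :
  [seq r i j | i <- iota a m, j <- iota 0 n] =
  [seq r (k %/ n) (k %% n) | k <- iota (a * n) (m * n)].
Proof.
elim: m a => // m IH a; rewrite [m.+1 * n]mulSn iotaD map_cat -[a * n + n]mulSnr -IH.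
congr (_ ++ _).
have -> : iota (a * n) n = map (addn (a * n)) (iota 0 n) by rewrite -iotaDl addn0.
rewrite -map_comp; apply/eq_in_map => j.
rewrite mem_iota add0n /= => Hj; have n0 : 0 < n by apply: leq_ltn_trans Hj.
by rewrite divnMDl // modnMDl divn_small // modn_small // addn0.
Qed.

(** Gives each bit of the code by a formula in its place, which is the form that [polytime_dfn]
    takes. *)
Lemma encode_mkseq n (r : nat -> nat -> bool) :
  encode (fun i j : 'I_n => r i j) =
  mkseq (fun i => if i < n then true else if i == n then false
                  else r ((i - n.+1) %/ n) ((i - n.+1) %% n)) (n.+1 + n * n).
Proof.
have Hr : iota 0 n.+1 = rcons (iota 0 n) n by rewrite -addn1 iotaD cats1 add0n.
rewrite /encode /mkseq iotaD map_cat add0n Hr map_rcons cat_rcons ltnn eqxx.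
congr (_ ++ _ :: _).
  apply: (@eq_from_nth _ false) => [|i]; rewrite size_nseq ?size_map ?size_iota // => Hi.
  by rewrite nth_nseq Hi (nth_map 0) ?size_iota // nth_iota // add0n Hi.
have -> : [seq r i j | i : 'I_n <- enum 'I_n, j : 'I_n <- enum 'I_n] =
    [seq r i j | i <- iota 0 n, j <- iota 0 n].
  by rewrite -val_enum_ord allpairs_mapl allpairs_mapr.
rewrite allpairs_iota mul0n.
have -> : iota n.+1 (n * n) = map (addn n.+1) (iota 0 (n * n)) by rewrite -iotaDl addn0.
rewrite -map_comp.
apply: eq_map => k /=; have -> : (n.+1 + k < n) = false by lia.
have -> : (n.+1 + k == n) = false by lia.
by rewrite addKn.
Qed.

Lemma dfn_horner (q : {poly nat}) (a : ctx -> nat) : dfn a -> dfn (fun g => (q.[a g])%R : nat).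
Proof.
move=> Ha; elim/poly_ind: q => [|p c IH].
  by apply: dfn_eq (dfn_const 0) => g; rewrite horner0.
by apply: dfn_eq (dfn_add (dfn_mul IH Ha) (dfn_const c)) => g; rewrite hornerMXaddC.
Qed.

(** * The reduction *)

Section Reduction.
Variables (M : TM) (q r : {poly nat}).

Definition cert_bound n : nat := (q.[n])%R.
Definition time_bound n : nat := (r.[(n + cert_bound n)%N])%R.
(** The sum is an upper bound for both the time and the certificate length, as the tableau
    requires. *)
Definition head_pos n := time_bound n + cert_bound n.
Definition red_nc n := nhyper M (time_bound n) (head_pos n).
Definition red_nx n := npoints M (time_bound n) (head_pos n).
Definition red_order n := nvertices (red_nc n) (red_nx n).
Definition red_inc (x : word) : nat -> nat -> bool :=
  sat_inc M x (cert_bound (size x)) (time_bound (size x)) (head_pos (size x)).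

Definition red_arc (x : word) (u v : nat) : bool :=
  let dec := decode (red_nc (size x)) (red_nx (size x)) in
  arc (member (red_nc (size x)) (red_nx (size x)) (red_inc x)) (dec u) (dec v).

Definition red_bit (x : word) (i : nat) : bool :=
  let n := red_order (size x) in
  if i < n then true else if i == n then false
  else red_arc x ((i - n.+1) %/ n) ((i - n.+1) %% n) ||
       red_arc x ((i - n.+1) %% n) ((i - n.+1) %/ n).

Definition red_size (x : word) : nat :=
  (red_order (size x)).+1 + red_order (size x) * red_order (size x).

Definition reduction (x : word) : word := mkseq (red_bit x) (red_size x).

Definition red_graph (x : word) : rel 'I_(red_order (size x)) :=
  @hyper_graph (red_nc (size x)) (red_nx (size x)) (red_inc x).
Arguments red_graph : clear implicits.

(** Every number below the order decodes to a valid vertex, so adjacency is an arc in one of the two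
    directions. *)
Lemma reduction_encode x : reduction x = encode (red_graph x).
Proof.
have Hv (i : 'I_(red_order (size x))) : valid (copies (red_nc (size x)) (red_nx (size x)))
    (hyperedges (red_nc (size x)) (red_nx (size x))) (decode (red_nc (size x)) (red_nx (size x)) i).
  by case: (@decode_valid (red_nc (size x)) (red_nx (size x)) i (ltn_ord i)).
have E : red_graph x = (fun i j : 'I_(red_order (size x)) => red_arc x i j || red_arc x j i).
  by apply/funext => i; apply/funext => j; rewrite /red_graph /hyper_graph /hyper_adj /gadget_adj !Hv.
rewrite E (encode_mkseq _ (fun i j => red_arc x i j || red_arc x j i)).
by rewrite /reduction /red_size; apply: eq_mkseq.
Qed.

Lemma dfn_bounds : [/\ dfn (fun g => cert_bound (size (g.1 false))),
  dfn (fun g => time_bound (size (g.1 false))) & dfn (fun g => head_pos (size (g.1 false)))].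
Proof.
have HQ : dfn (fun g => cert_bound (size (g.1 false))) by rewrite /cert_bound; apply: dfn_horner; dfn.
have HT : dfn (fun g => time_bound (size (g.1 false))).
  by rewrite /time_bound; apply: dfn_horner; dfn.
by split=> //; rewrite /head_pos; dfn.
Qed.

Lemma dfn_red_order : dfn (fun g => red_order (size (g.1 false))).
Proof.
have [HQ HT HD] := dfn_bounds; have Hc := dfn_nhyper M HT HD; have Hx := dfn_npoints M HT HD.
by rewrite /red_order /nvertices /ncopies /nedges /red_nc /red_nx; dfn.
Qed.

Lemma dfn_red_arc u v : dfn u -> dfn v -> dfn (fun g => red_arc (g.1 false) (u g) (v g)).
Proof.
move=> Hu Hv.
have [HQ HT HD] := dfn_bounds; have Hc := dfn_nhyper M HT HD; have Hx := dfn_npoints M HT HD.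
apply: (dfn_arc (hinc := fun g => red_inc (g.1 false)) Hc Hx _ Hu Hv).
by move=> c i Hci Hi; apply: dfn_sat_inc.
Qed.

Lemma dfn_red_size : dfn (fun g => red_size (g.1 false)).
Proof. by have H := dfn_red_order; rewrite /red_size; dfn. Qed.

Lemma dfn_red_bit : dfn (fun g => red_bit (g.1 false) (g.2 0)).
Proof.
have H := dfn_red_order; rewrite /red_bit.
apply: dfn_ifb; [by dfn | by dfn |]; apply: dfn_ifb; [by dfn | by dfn |].
by apply: dfn_or; apply: dfn_red_arc; dfn.
Qed.

Lemma polytime_reduction : polytime reduction.
Proof. exact: polytime_dfn dfn_red_size dfn_red_bit. Qed.

Lemma red_order_two x : forall c, c < red_nc (size x) -> exists i i',
  [/\ i < red_nx (size x), i' < red_nx (size x), i != i', red_inc x c i & red_inc x c i'].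
Proof. by move=> c; apply: sat_inc_two; rewrite /head_pos ?leq_addr ?leq_addl. Qed.

Lemma reduction_cfc (V : word -> word -> bool) x :
  (forall y, size y <= cert_bound (size x) ->
     computes_in M [:: x; y] [:: V x y] (time_bound (size x))) ->
  let ok := exists y, size y <= cert_bound (size x) /\ V x y in
  [/\ simple_graph (red_graph x), connected (red_graph x), h (red_graph x) = 2,
      ok -> cfc (red_graph x) = 2 & ~ ok -> cfc (red_graph x) = 3].
Proof.
move=> HV ok; have two := @red_order_two x.
have TD : time_bound (size x) <= head_pos (size x) by rewrite leq_addr.
have QD : cert_bound (size x) <= head_pos (size x) by rewrite leq_addl.
split.
- exact: hyper_graph_simple.
- exact: (hyper_graph_connected two).
- exact: (hyper_graph_h two).
- move=> [y [Hy Vy]]; have Hh := HV y Hy; rewrite Vy in Hh.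
  have [g Hg] := satisfying_splitting TD QD (run_satisfying Hy Hh).
  exact: (hyper_graph_cfc2 two Hg).
- move=> N; apply: (hyper_graph_cfc3 two) => -[g Hg]; apply: N.
  have [al Hal] := splitting_satisfying TD QD Hg.
  exists (certificate (cert_bound (size x)) al); split; first exact: certificate_size.
  by apply: (forced_accepts TD QD Hal); apply: HV; apply: certificate_size.
Qed.

End Reduction.

Arguments red_graph : clear implicits.

Lemma computes_in_leq M ins w n n' : n <= n' -> computes_in M ins w n -> computes_in M ins w n'.
Proof.
move=> /subnK <-; elim: (n' - n) => //= k IH /IH; rewrite /computes_in addSn iterS.
by case: (iter _ _ _) => q ts [/= Hf Hr]; rewrite /step Hf.
Qed.

Lemma horner_leq (q : {poly nat}) m n : m <= n -> (q.[m])%R <= (q.[n])%R.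
Proof.
move=> le_mn; elim/poly_ind: q => [|p c IH]; first by rewrite !horner0.
by rewrite !hornerMXaddC leq_add2r leq_mul.
Qed.

Lemma NP_reduction L : NP L -> exists M q r, forall x,
  [/\ simple_graph (red_graph M q r x), connected (red_graph M q r x),
      h (red_graph M q r x) = 2, L x -> cfc (red_graph M q r x) = 2
    & ~ L x -> cfc (red_graph M q r x) = 3].
Proof.
move=> [V [q [[M [r Hr]] HL]]]; exists M, q, r => x.
have [|H1 H2 H3 H4 H5] := @reduction_cfc M q r V x.
  move=> y Hy; apply: computes_in_leq (Hr x y); apply: horner_leq.
  by rewrite leq_add2l.
split=> // [/HL H|N]; [exact: H4 | by apply: H5 => /HL].
Qed.

(** * Certificates and their verification *)

Lemma mkseqS (U : Type) (k : nat -> U) l : mkseq k l.+1 = k 0 :: mkseq (k \o S) l.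
Proof. by rewrite /mkseq /= -[1]addn0 iotaDl -map_comp. Qed.

Lemma iotaS l : iota 0 l.+1 = 0 :: map S (iota 0 l).
Proof. by rewrite /= -[1]addn0 iotaDl. Qed.

Lemma walk_path (T : Type) (e : rel T) (f : nat -> T) l :
  path e (f 0) (mkseq (f \o S) l) = all (fun s => e (f s) (f s.+1)) (iota 0 l).
Proof.
elim: l f => // l IH f; rewrite mkseqS iotaS /= all_map; congr (_ && _).
exact: (IH (f \o S)).
Qed.

Lemma walk_last (T : Type) (f : nat -> T) l : last (f 0) (mkseq (f \o S) l) = f l.
Proof. by elim: l f => // l IH f; rewrite mkseqS /=; apply: (IH (f \o S)). Qed.

Lemma walk_pairmap (T U : Type) (k : T -> T -> U) (f : nat -> T) l :
  pairmap k (f 0) (mkseq (f \o S) l) = mkseq (fun s => k (f s) (f s.+1)) l.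
Proof.
elim: l f => // l IH f; rewrite !mkseqS /=; congr (_ :: _); exact: (IH (f \o S)).
Qed.

Lemma walk_nth (T : Type) (x : T) p : p = mkseq (nth x (x :: p) \o S) (size p).
Proof. by rewrite -[LHS](mkseq_nth x). Qed.

Lemma count_mkseq (a : nat) (k : nat -> nat) l :
  count_mem a (mkseq k l) = \sum_(0 <= s < l) (k s == a).
Proof. by rewrite /mkseq count_map -sumn_count sumnE big_map /index_iota subn0. Qed.

Section Verifier.
Variables (w y : word) (n : nat).

Definition adjb i j := nth false w (n.+1 + (i * n + j)).
Definition colb i j := nth false y (i * n + j).
Definition cutb b v := nth false y (n * n + (b * n + v)).
(** A vertex is the number of ones in a block of [n] bits, read by a bounded sum. The offset skips
    the [n * n] colours and the two sets of [n] bits. *)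
Definition pathv i j s :=
  \sum_(0 <= v < n) nth false y (n * n + (2 * n) + (((i * n + j) * n.+1 + s) * n + v)).

(* [pathv i j] lists the vertices of a path from [i] to [j], of length [pathv i j n]. *)
Definition path_ok i j : bool :=
  [&& pathv i j 0 == i, pathv i j (pathv i j n) == j,
    all (fun s => (pathv i j s < n) && all (fun t => (pathv i j s == pathv i j t) ==> (s == t))
      (iota 0 (pathv i j n).+1)) (iota 0 (pathv i j n).+1),
    all (fun s => adjb (pathv i j s) (pathv i j s.+1)) (iota 0 (pathv i j n))
  & has (fun a => \sum_(0 <= s < pathv i j n) (colb (pathv i j s) (pathv i j s.+1) == a :> nat) == 1)
      (iota 0 2)].

(** A set that contains [u] but not [v], and that no other edge leaves, is a certificate for a cut
    edge. *)
Definition cut_ok b u v : bool :=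
  [&& adjb u v, cutb b u, ~~ cutb b v
    & all (fun s => all (fun t => (cutb b s && ~~ cutb b t && adjb s t) ==> (s == u) && (t == v))
        (iota 0 n)) (iota 0 n)].

Definition verify : bool :=
  [&& size w == n.+1 + n * n, all (fun i => nth false w i) (iota 0 n), ~~ nth false w n,
    all (fun i => all (fun j => [&& adjb i j == adjb j i, ~~ adjb i i, colb i j == colb j i
      & (i != j) ==> path_ok i j]) (iota 0 n)) (iota 0 n)
  & has (fun u => has (fun v => has (fun t => [&& u != t, cut_ok 0 u v & cut_ok 1 v t])
      (iota 0 n)) (iota 0 n)) (iota 0 n)].

End Verifier.

(** The order is not parsed from the word: all numbers below its length are tried. *)
Definition verifier (w y : word) : bool := has (verify w y) (iota 0 (size w)).

Lemma dfn_adjb n i j : dfn n -> dfn i -> dfn j -> dfn (fun g => adjb (g.1 false) (n g) (i g) (j g)).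
Proof. by move=> Hn Hi Hj; rewrite /adjb; dfn. Qed.

Lemma dfn_colb n i j : dfn n -> dfn i -> dfn j -> dfn (fun g => colb (g.1 true) (n g) (i g) (j g)).
Proof. by move=> Hn Hi Hj; rewrite /colb; dfn. Qed.

Lemma dfn_cutb n b v : dfn n -> dfn b -> dfn v -> dfn (fun g => cutb (g.1 true) (n g) (b g) (v g)).
Proof. by move=> Hn Hi Hj; rewrite /cutb; dfn. Qed.

Lemma dfn_pathv n i j s : dfn n -> dfn i -> dfn j -> dfn s ->
  dfn (fun g => pathv (g.1 true) (n g) (i g) (j g) (s g)).
Proof.
by apply: (dfn_comp4 (f := fun iw => pathv (iw true))); rewrite /pathv; dfn.
Qed.

Ltac dfn_user ::=
  match goal with
  | H : dfn ?a |- dfn ?a => exact: H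
  | H : dfn ?a |- dfn (fun g => ?a g) => exact: H
  | |- dfn (fun g => @?a g %/ @?b g) => apply: dfn_div
  | |- dfn (fun g => @?a g %% @?b g) => apply: dfn_mod
  | |- dfn (fun g => nat_of_bool (adjb _ _ _ _)) => apply: dfn_adjb
  | |- dfn (fun g => nat_of_bool (colb _ _ _ _)) => apply: dfn_colb
  | |- dfn (fun g => nat_of_bool (cutb _ _ _ _)) => apply: dfn_cutb
  | |- dfn (fun g => pathv _ _ _ _ _) => apply: dfn_pathv
  | |- dfn _ => first [apply: dfn_adjb | apply: dfn_colb | apply: dfn_cutb | apply: dfn_pathv]
  end.

Lemma dfn_path_ok n i j : dfn n -> dfn i -> dfn j ->
  dfn (fun g => path_ok (g.1 false) (g.1 true) (n g) (i g) (j g)).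
Proof.
apply: (dfn_comp3 (f := fun iw n i j => path_ok (iw false) (iw true) n i j)).
by rewrite /path_ok; dfn.
Qed.

Lemma dfn_cut_ok n b u v : dfn n -> dfn b -> dfn u -> dfn v ->
  dfn (fun g => cut_ok (g.1 false) (g.1 true) (n g) (b g) (u g) (v g)).
Proof.
apply: (dfn_comp4 (f := fun iw n b u v => cut_ok (iw false) (iw true) n b u v)).
by rewrite /cut_ok; dfn.
Qed.

Ltac dfn_user ::=
  match goal with
  | |- dfn _ => first [apply: dfn_adjb | apply: dfn_colb | apply: dfn_cutb | apply: dfn_pathv
                       | apply: dfn_path_ok | apply: dfn_cut_ok]
  end.

Lemma dfn_verifier : dfn (fun g => verifier (g.1 false) (g.1 true)).
Proof. by rewrite /verifier /verify; dfn. Qed.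

Lemma verify_sound w y n : verify w y n -> h2_cfc 2 w.
Proof.
case/and5P=> /eqP Sw /allP W1 W2 /allP Hpairs /hasP[u0 Iu0 /hasP[v0 Iv0 /hasP[t0 It0]]].
case/and3P=> ut0 Hcut0 Hcut1; rewrite !mem_iota !add0n /= in Iu0 Iv0 It0.
have Hp (i j : 'I_n) : [&& adjb w n i j == adjb w n j i, ~~ adjb w n i i,
    colb y n i j == colb y n j i & ((i : nat) != j) ==> path_ok w y n i j].
  have /Hpairs/allP : (i : nat) \in iota 0 n by rewrite mem_iota /=.
  by apply; rewrite mem_iota /=.
pose e : rel 'I_n := fun i j => adjb w n i j.
have Hs : symmetric e by move=> i j; have /and4P[/eqP H _ _ _] := Hp i j.
have Hi : irreflexive e by move=> i; have /and4P[_ /negbTE H _ _] := Hp i i.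
have Ew : w = encode e.
  rewrite (encode_mkseq n (adjb w n)); apply: (@eq_from_nth _ false); first by rewrite size_mkseq.
  move=> k Hk; rewrite nth_mkseq -?Sw //; case: (ltngtP k n) => [lt_k|gt_k|->].
  - by have /W1 -> : k \in iota 0 n by rewrite mem_iota.
  - by rewrite /adjb -divn_eq subnKC.
  - exact: negbTE.
(* The set of ends determines an edge up to order, and the colour matrix is symmetric. *)
pose c (S : {set 'I_n}) : nat := [exists i, exists j, (S == [set i; j])%SET && colb y n i j].
have Ec i j : e i j -> c [set i; j]%SET = colb y n i j.
  move=> Hij; congr nat_of_bool; apply/existsP/idP => [[a /existsP[b /andP[/eqP E Hab]]]|H]; last first.
    by exists i; apply/existsP; exists j; rewrite eqxx.
  case: (set2_eq E) => [[-> ->]//|[[-> ->]|[Eij _]]]; last by rewrite Eij Hi in Hij.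
  by have /and4P[_ _ /eqP <- _] := Hp a b.
have Hcol : cf_colorable e 2.
  exists c; split=> [i j Hij|i j Nij]; first by rewrite Ec // ltnS leq_b1.
  have /and4P[_ _ _ /implyP/(_ Nij)] := Hp i j.
  rewrite /path_ok; set P := pathv y n i j; set l := P n.
  case/and5P=> /eqP P0 /eqP Pl /allP Hu /allP Ha /hasP[a _ Hc].
  have Pn s : s <= l -> P s < n.
    by move=> Hsl; have /Hu/andP[] : s \in iota 0 l.+1 by rewrite mem_iota.
  pose f s : 'I_n := insubd i (P s).
  have fE s : s <= l -> f s = P s :> nat by move=> /Pn H; rewrite /f insubdK.
  have f0 : f 0 = i by apply: val_inj; rewrite /= fE.
  have fl : f l = j by apply: val_inj; rewrite /= fE.
  have fe s : s \in iota 0 l -> e (f s) (f s.+1).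
    move=> Is; have := Ha _ Is; move: Is; rewrite mem_iota /= => Hsl.
    by rewrite /e !fE // ltnW.
  exists (mkseq (f \o S) l); rewrite -f0; split.
  - by rewrite walk_path; apply/allP.
  - by rewrite walk_last.
  - rewrite -mkseqS map_inj_in_uniq ?iota_uniq // => s t; rewrite !mem_iota /= => Hsl Htl Est.
    have /Hu/andP[_ /allP/(_ t)] : s \in iota 0 l.+1 by rewrite mem_iota.
    rewrite mem_iota => /(_ Htl)/implyP H; apply/eqP; apply: H.
    by rewrite -!fE // Est.
  - exists a; rewrite walk_pairmap count_mkseq -(eqP Hc) !big_mkord; apply: eq_bigr => s _.
    have Is : (s : nat) \in iota 0 l by rewrite mem_iota /=.
    by rewrite Ec ?fe // !fE // ltnW.
pose u : 'I_n := Ordinal Iu0; pose v : 'I_n := Ordinal Iv0; pose t : 'I_n := Ordinal It0.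
have Hconn : connected e.
  apply/andP; split; first by apply/card_gt0P; exists u.
  apply/forallP => i; apply/forallP => j; have [->|Nij] := eqVneq i j; first exact: connect0.
  by case: Hcol => d [_ /(_ _ _ Nij) [p [Hpp <- _ _]]]; apply/connectP; exists p.
have Hcut b (a d : 'I_n) : cut_ok w y n b a d -> cut_edge e a d.
  case/and4P=> Had Sa Sd /allP Hall; rewrite (cut_edgeE Hs Hi Hconn) {1}/e Had /=.
  apply/negP => /(connect_stable (S := fun z : 'I_n => cutb y n b z)) H.
  suff : cutb y n b d by rewrite (negbTE Sd).
  apply: H => // z z' Sz /andP[Hz Nz]; apply: contraNT Nz => Sz'.
  have /Hall/allP/(_ z') : (z : nat) \in iota 0 n by rewrite mem_iota /=.
  rewrite mem_iota /= => /(_ (ltn_ord z')); rewrite Sz Sz' -/(e z z') Hz /= => /andP[/eqP E1 /eqP E2].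
  by have -> : z = a by [apply: val_inj]; have -> : z' = d by [apply: val_inj].
have [H1 H2] : h e = 2 /\ cfc e = 2.
  apply/(h2_cfc2 Hs Hi Hconn); split=> //; exists u, v, t; split.
  - by rewrite -val_eqE.
  - exact: (Hcut 0 u v Hcut0).
  - exact: (Hcut 1 v t Hcut1).
by exists n, e; split.
Qed.

Definition cert_size n := n * n + 2 * n + (n * n * n.+1) * n.

(* Colours [C], sets [S] and values [P i j s], the latter in unary. *)
Definition cert_word n (C : nat -> nat -> bool) (S : nat -> nat -> bool)
    (P : nat -> nat -> nat -> nat) : word :=
  mkseq (fun k =>
    if k < n * n then C (k %/ n) (k %% n)
    else if k < n * n + 2 * n then S ((k - n * n) %/ n) ((k - n * n) %% n)
    else let u := k - (n * n + 2 * n) in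
      u %% n < P (u %/ n %/ n.+1 %/ n) (u %/ n %/ n.+1 %% n) (u %/ n %% n.+1)) (cert_size n).

Section Certificate.
Variables (n : nat) (C S : nat -> nat -> bool) (P : nat -> nat -> nat -> nat).
Let y := cert_word n C S P.

Lemma colb_cert i j : i < n -> j < n -> colb y n i j = C i j.
Proof.
move=> Hi Hj; have H := lex_lt Hi Hj; rewrite /colb /y nth_mkseq; last first.
  by rewrite /cert_size -addnA ltn_addr.
by rewrite H divnMDl ?modnMDl ?divn_small ?modn_small ?addn0 //; apply: leq_ltn_trans Hj.
Qed.

Lemma cutb_cert b v : b < 2 -> v < n -> cutb y n b v = S b v.
Proof.
move=> Hb Hv; have H := lex_lt Hb Hv; rewrite /cutb /y nth_mkseq; last first.
  by rewrite /cert_size ltn_addr // ltn_add2l.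
rewrite ltnNge leq_addr /= ltn_add2l H addKn.
by rewrite divnMDl ?modnMDl ?divn_small ?modn_small ?addn0 //; apply: leq_ltn_trans Hv.
Qed.

Lemma pathv_cert i j s : i < n -> j < n -> s < n.+1 -> P i j s <= n -> pathv y n i j s = P i j s.
Proof.
move=> Hi Hj Hs HP; rewrite /pathv -[RHS](sum_ltn HP) big_mkord; apply: eq_bigr => v _.
have n0 : 0 < n by apply: leq_ltn_trans Hj.
have H1 := lex_lt Hi Hj; have H2 := lex_lt H1 Hs; have H3 := lex_lt H2 (ltn_ord v).
rewrite /y nth_mkseq; last by rewrite /cert_size ltn_add2l.
set k := n * n + 2 * n; rewrite [k + _ < n * n]ltnNge -[k in n * n <= k + _]/(n * n + 2 * n).
rewrite -addnA leq_addr /= [_ < k]ltnNge addnA leq_addr /= addKn.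
rewrite !(divnMDl, modnMDl) // !(divn_small (ltn_ord v)) !(modn_small (ltn_ord v)) addn0.
rewrite !(divnMDl, modnMDl) // !(divn_small Hs) !(modn_small Hs) addn0.
by rewrite !(divnMDl, modnMDl) // (divn_small Hj) (modn_small Hj) addn0.
Qed.

End Certificate.

Lemma verify_complete n (e : rel 'I_n) : simple_graph e -> connected e -> h e = 2 -> cfc e = 2 ->
  exists y, size y = cert_size n /\ verify (encode e) y n.
Proof.
move=> [Hs Hi] Hconn Hh Hc.
have [[c [Hc2 Hcf]] [u [v [t [ut uv vt]]]]] := (h2_cfc2 Hs Hi Hconn).1 (conj Hh Hc).
have i0 : 'I_n by exact: u.
pose o k : 'I_n := insubd i0 k.
have oE k : k < n -> o k = k :> nat by move=> Hk; rewrite /o insubdK.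
have oK (i : 'I_n) : o i = i by apply: val_inj; rewrite /= oE.
pose C i j := c [set o i; o j]%SET == 1.
(* The side of the first end after the cut edge is deleted. *)
pose Sb b k := if b == 0 then connect (delete_edge e u v) u (o k) else connect (delete_edge e v t) v (o k).
have Hpath (i j : 'I_n) : exists f : nat -> nat, i != j ->
    [/\ f 0 = i, f n < n, f (f n) = j, forall s, s <= f n -> f s < n
      & [/\ forall s s', s <= f n -> s' <= f n -> f s = f s' -> s = s',
          forall s, s < f n -> e (o (f s)) (o (f s.+1))
        & exists a, \sum_(0 <= s < f n) (c [set o (f s); o (f s.+1)]%SET == a) = 1]].
  have [->|Nij] := eqVneq i j; first by exists id => /eqP.
  have [p [Hp Ep Up [a Ca]]] := Hcf _ _ Nij.
  pose g k := nth i (i :: p) k.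
  have Sp : size p < n by have := card_uniqP Up; have := max_card (mem (i :: p)); rewrite card_ord /= => ? E; rewrite -E.
  (* The at most [n] vertices of the path occupy places below [n]; place [n] is free for the
     length. *)
  pose f k := if k == n then size p else g k : nat.
  have fn : f n = size p by rewrite /f eqxx.
  have Ne k : k <= size p -> f k = g k by move=> Hk; rewrite /f ifN //; apply/eqP; lia.
  have Hpw : p = mkseq (g \o S) (size p) := walk_nth i p.
  exists f => _; rewrite fn; split.
  - by rewrite Ne.
  - exact: Sp.
  - by rewrite Ne // /g -last_nth Ep.
  - by move=> s Hsp; rewrite Ne.
  split.
  - move=> s s' H H'; rewrite !Ne // => /val_inj/eqP.
    by rewrite /g nth_uniq // => /eqP.
  - move=> s H; rewrite !Ne ?(ltnW H) // !oK.
    move: Hp; rewrite {1}Hpw -[i in path _ i]/(g 0) walk_path => /allP; apply.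
    by rewrite mem_iota.
  - exists a; rewrite -Ca [in RHS]Hpw -[i in pairmap _ i]/(g 0) walk_pairmap count_mkseq !big_mkord.
    by apply: eq_bigr => s _; rewrite !Ne ?(ltnW (ltn_ord s)) // !oK.
have [F HF] := choice (fun ij : 'I_n * 'I_n => Hpath ij.1 ij.2).
(* [F] is unconstrained for [i = j] and beyond the end of a path; the minimum keeps every value
   within a block of [n] bits. *)
pose P i j s := minn n (F (o i, o j) s).
exists (cert_word n C Sb P); split; first by rewrite size_mkseq.
have Pv (i j : 'I_n) s : s < n.+1 -> pathv (cert_word n C Sb P) n i j s = minn n (F (i, j) s).
  by move=> H; rewrite pathv_cert ?geq_minl // /P !oK.
have Ew : encode e = encode (fun i j : 'I_n => e (o i) (o j)).
  by congr encode; apply/funext => i; apply/funext => j; rewrite !oK.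
have Ae i j : i < n -> j < n -> adjb (encode e) n i j = e (o i) (o j).
  move=> Hi' Hj'; have H := lex_lt Hi' Hj'.
  rewrite /adjb Ew (encode_mkseq n (fun i j => e (o i) (o j))) nth_mkseq ?ltn_add2l //.
  have L1 m : (n.+1 + m < n) = false by lia.
  have L2 m : (n.+1 + m == n) = false by lia.
  rewrite L1 L2.
  by rewrite addKn divnMDl ?modnMDl ?divn_small ?modn_small ?addn0 //; apply: leq_ltn_trans Hj'.
have Acut b x z (r : rel 'I_n) : b < 2 -> (forall k, k < n -> Sb b k = connect r x (o k)) ->
    r = delete_edge e x z -> e x z -> ~~ connect r x z -> cut_ok (encode e) (cert_word n C Sb P) n b x z.
  move=> Hb HS Er Hxz Nxz; rewrite /cut_ok Ae // !oK Hxz !cutb_cert // !HS // !oK connect0 Nxz /=.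
  apply/allP => s0; rewrite mem_iota add0n /= => Hs0; apply/allP => s1.
  rewrite mem_iota add0n /= => Hs1; rewrite !cutb_cert // !HS // Ae //.
  apply/implyP => /andP[/andP[C1 C2] He].
  have [E|Nset] := eqVneq [set o s0; o s1]%SET [set x; z]%SET; last first.
    case/negP: C2; apply: connect_trans C1 (connect1 _); by rewrite Er /delete_edge He.
  case: (set2_eq E) => [[E0 E1]|[[E0 E1]|[E0 _]]].
  - by rewrite -E0 -E1 !oE // !eqxx.
  - by rewrite E0 in C1; rewrite C1 in Nxz.
  - by rewrite E0 Hi in He.
rewrite /verify; apply/and5P; split.
- by rewrite Ew (encode_mkseq n (fun i j => e (o i) (o j))) size_mkseq.
- apply/allP => k; rewrite mem_iota add0n /= => Hk.
  rewrite Ew (encode_mkseq n (fun i j => e (o i) (o j))) nth_mkseq ?Hk //.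
  by apply: leq_trans Hk _; rewrite addSn leqW // leq_addr.
- by rewrite Ew (encode_mkseq n (fun i j => e (o i) (o j))) nth_mkseq ?ltnn ?eqxx // addSn ltnS leq_addr.
- apply/allP => i'; rewrite mem_iota add0n /= => Hi'; apply/allP => j'.
  rewrite mem_iota add0n /= => Hj'; have [[i Ei] [j Ej]] : (exists i : 'I_n, i = i' :> nat) /\ (exists j : 'I_n, j = j' :> nat).
    by split; [exists (Ordinal Hi') | exists (Ordinal Hj')].
  rewrite -{}Ei -{}Ej {i' j' Hi' Hj'}; rewrite !Ae // !oK Hs eqxx Hi /= !colb_cert // /C finset.setUC eqxx /=.
  apply/implyP => Nij; have [F0 Fn Fl Flt [Finj Fe [a Fa]]] := HF (i, j) Nij; rewrite /= in F0 Fn Fl Flt Finj Fe Fa.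
  have Pn : pathv (cert_word n C Sb P) n i j n = F (i, j) n by rewrite Pv // (minn_idPr (ltnW Fn)).
  have Ps s : s <= F (i, j) n -> pathv (cert_word n C Sb P) n i j s = F (i, j) s.
    move=> H; rewrite Pv; first by rewrite (minn_idPr (ltnW (Flt _ H))).
    by rewrite ltnS; apply: leq_trans H (ltnW Fn).
  rewrite /path_ok Pn Ps // F0 eqxx Ps // Fl eqxx !andTb; apply/and3P; split.
  + apply/allP => s; rewrite mem_iota => /andP[_ H]; rewrite Ps // Flt // andTb.
    apply/allP => s'; rewrite mem_iota => /andP[_ H']; rewrite Ps //.
    by apply/implyP => /eqP/Finj-> //.
  + apply/allP => s; rewrite mem_iota add0n /= => H.
    by rewrite !Ps ?(ltnW H) // Ae ?Flt ?(ltnW H) //; apply: Fe.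
  + have Hlt s : s < F (i, j) n -> c [set o (F (i, j) s); o (F (i, j) s.+1)]%SET < 2.
      by move=> H; apply: Hc2; apply: Fe.
    have a2 : a < 2.
      rewrite ltnNge; apply/negP => Ha; move: Fa; rewrite big_mkord big1 // => s _.
      by apply/eqP; rewrite eqb0; apply: contraL Ha => /eqP <-; rewrite -ltnNge Hlt.
    apply/hasP; exists a; first by rewrite mem_iota.
    apply/eqP; rewrite -[RHS]Fa !big_mkord; apply: eq_bigr => s _.
    rewrite !Ps ?(ltnW (ltn_ord s)) // colb_cert ?Flt ?(ltnW (ltn_ord s)) //.
    by rewrite /C; have := Hlt s (ltn_ord s); case: (c _) => [|[|]] //= _; case: (a) a2 => [|[|]].
- have /andP[euv Nuv] : e u v && ~~ connect (delete_edge e u v) u v by rewrite -(cut_edgeE Hs Hi Hconn).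
  have /andP[evt Nvt] : e v t && ~~ connect (delete_edge e v t) v t by rewrite -(cut_edgeE Hs Hi Hconn).
  apply/hasP; exists (u : nat); first by rewrite mem_iota /=.
  apply/hasP; exists (v : nat); first by rewrite mem_iota /=.
  apply/hasP; exists (t : nat); first by rewrite mem_iota /=.
  apply/and3P; split=> //.
  + exact: (Acut 0 u v (delete_edge e u v)).
  + exact: (Acut 1 v t (delete_edge e v t)).
Qed.

Lemma NP_h2_cfc2 : NP (h2_cfc 2).
Proof.
(* [cert_size] has degree 4 in the order, which is below the length of the code; the fifth power
   leaves room. *)
exists verifier, (('X + 2%:P) ^+ 5)%R; split; first exact: polytime_rel_dfn dfn_verifier.
move=> w; split=> [[n [e [-> He Hconn Hh Hc]]]|[y [_ /hasP[n _]]]]; last exact: verify_sound.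
have [y [Sy Hy]] := verify_complete He Hconn Hh Hc.
have Sn : n < size (encode e) by rewrite size_cat size_nseq /= addnS ltnS leq_addr.
exists y; split; last by apply/hasP; exists n; rewrite // mem_iota.
rewrite Sy horner_exp hornerD hornerX hornerC natrE.
apply: (@leq_trans ((n + 2) ^ 5)); last by rewrite leq_exp2r // leq_add2r ltnW.
by rewrite /cert_size !expnS expn0; nia.
Qed.

(** * Deciding with one query to an oracle *)

Section Decide.
Variable K : nat.
Notation tapes := {ffun 'I_K.+1 -> tape unit}.

Definition Write (b : bool) : comp K :=
  Act (fun y k => (if k == 0 :> nat then bit b else y k, Stay)).

(** The input still stands on tape 0. The bit is written on the first cell behind it and the head
    stays there, so that only blanks follow. *)
Definition Answer (b : bool) : comp K := Seq (to_end K 0) (Write b).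

(* Tape [K] holds the answer of the oracle in unary: 2 or 3. *)
Definition Decide : comp K :=
  Seq (Move K K Right) (Seq (Move K K Right) (Ite (at_ K isbit) (Answer false) (Answer true))).

Lemma exits_scan (ts : tapes) w p : 0 < p -> view (ts ord0) p w -> p <= (size w).+1 ->
  exists2 ts', exits (While (at_ 0 isbit) (Move K 0 Right)) ts ts' (((size w).+1 - p) * 2).+1
    & view (ts' ord0) (size w).+1 w.
Proof.
move=> p0 Hv Hp; have [d Ed] : exists d, (size w).+1 - p = d by eexists.
elim: d ts p p0 Hv Hp Ed => [|d IH] ts p p0 Hv Hp Ed.
  have Ep : p = (size w).+1 by lia.
  exists ts; last by rewrite -{1}Ep.
  apply: exits_weaken (exits_While0 _ _) => //.
  rewrite /at_ ffunE (_ : inord 0 = ord0); last by apply: val_inj; rewrite /= inordK.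
  by case: Hv => _ + _; rewrite /scanned Ep => ->; rewrite isbit_cont ltnn andbF.
have [||||ts' He Hv'] := IH (perform ts (fun k => (scan ts k, if k == 0 :> nat then Right else Stay))) p.+1.
- by [].
- by rewrite !ffunE /=; apply: view_right.
- lia.
- lia.
have Ed' : (size w).+1 - p.+1 = d by lia.
rewrite Ed' in He; exists ts' => //; rewrite Ed; have -> : (d.+1 * 2).+1 = (1 + (d * 2).+1).+1 by lia.
apply: exits_WhileS; [|exact: exits_Act|exact: He].
rewrite /at_ ffunE (_ : inord 0 = ord0); last by apply: val_inj; rewrite /= inordK.
by case: Hv => _ + _; rewrite /scanned => ->; rewrite isbit_cont p0 /=; lia.
Qed.

Lemma exits_Answer (ts : tapes) w b : view (ts ord0) 0 w ->
  exists2 ts', exits (Answer b) ts ts' (size w * 2 + 3) & read (ts' ord0) = [:: b].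
Proof.
move=> Hv; pose ts1 := perform ts (fun k => (scan ts k, if k == 0 :> nat then Right else Stay)).
have [|ts2 He Hv2] := @exits_scan ts1 w 1 isT _ isT.
  by rewrite !ffunE /=; apply: view_right.
exists (perform ts2 (fun k => (if k == 0 :> nat then bit b else scan ts2 k, Stay))).
  apply: exits_weaken (exits_Seq (exits_Seq (exits_Act _ _) He) (exits_Act _ _)); lia.
rewrite !ffunE /=; case: Hv2; case: (ts2 ord0) => -[l a] r /= _ _ Hr.
rewrite /read /= (nth_None_leading_bits (s := r)) // => i.
by rewrite Hr /cont nth_default //= size_map; lia.
Qed.

(** The answer of the oracle is loaded without a marker, its first bit under the head; after two
    moves the third cell is scanned, a bit for 3 and a blank for 2. *)
Lemma exits_Decide (ts : tapes) w (m : bool) : K != 0 -> view (ts ord0) 0 w ->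
  ts ord_max = load (nseq (2 + m) true) ->
  exists2 ts', exits Decide ts ts' (size w * 2 + 6) & read (ts' ord0) = [:: ~~ m].
Proof.
move=> K0 Hv Hm.
pose right (t : tapes) := perform t (fun k => (scan t k, if k == K :> nat then Right else Stay)).
have Hr (t : tapes) : view (t ord0) 0 w -> view (right t ord0) 0 w.
  by move=> H; rewrite !ffunE /= eq_sym (negbTE K0); apply: view_stay.
have [ts' He Hr'] := exits_Answer (~~ m) (Hr _ (Hr _ Hv)).
exists ts' => //; apply: (exits_weaken (n := 1 + (1 + (size w * 2 + 3).+1))); first lia.
apply: exits_Seq (exits_Act _ _) (exits_Seq (exits_Act _ _) (exits_Ite _)).
rewrite /at_ ffunE (_ : inord K = ord_max); last by apply: val_inj; rewrite /= inordK.
by rewrite !ffunE /= eqxx Hm; move: He; case: (m).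
Qed.

End Decide.

Section Oracle.
Variables (K : nat) (P D : comp K).
Notation tapes := {ffun 'I_K.+1 -> tape unit}.

(** The idle step between [P] and [D] is the place of the query: its only state is the asking
    one. *)
Definition oracle_base : TM := tm_of (Seq P (Seq (Act (@noop K)) D)).

Definition asking (s : state oracle_base) : bool :=
  if s is Some (inr (inl _)) then true else false.
Definition resuming (s : state oracle_base) : state oracle_base :=
  Some (inr (inr (cstart D))).

Definition oracle_machine : oracle_TM := @MkOracleTM oracle_base asking resuming.

Variable O : word -> word.

Lemma oracle_run ins n (ts : tapes) n' ts' :
  exits P (load_all K ins) ts n ->
  exits D [ffun i => if i == ord_max then load (O (read (ts i))) else ts i] ts' n' ->
  oracle_computes_in O oracle_machine ins (read (ts' ord0)) (n + 1 + n').
Proof.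
move=> He HD.
pose emb1 (s : option (cst P)) (t : tapes) : config oracle_machine :=
  (Some (if s is Some s then inl s else inr (inl tt)), t).
pose emb2 (s : option (cst D)) (t : tapes) : config oracle_machine :=
  (omap (fun s => inr (inr s)) s, t).
have [|m1 l1 E1] := @exits_embed _ P _ (@oracle_step O oracle_machine) emb1 _ _ _ _ He.
  move=> s t; rewrite /oracle_step /emb1 /= /step /= /scan; case: (ctrans s _) => [[s'|] a]; reflexivity.
have [|m2 l2 E2] := @exits_embed _ D _ (@oracle_step O oracle_machine) emb2 _ _ _ _ HD.
  move=> s t; rewrite /oracle_step /emb2 /= /step /= /scan; case: (ctrans s _) => [[s'|] a]; reflexivity.
have Efix k : iter k (@oracle_step O oracle_machine) (emb2 None ts') = emb2 None ts'.
  by elim: k => //= k ->.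
have Hle : m2 + (1 + m1) <= n + 1 + n' by lia.
rewrite /oracle_computes_in -(subnK Hle) !iterD -[init _ _]/(emb1 (Some (cstart P)) (load_all K ins)).
by rewrite E1 [iter 1 _ _]/(emb2 (Some (cstart D)) _) E2 Efix.
Qed.

End Oracle.

Lemma oracle_decide K (P : comp K) O ins w (m : bool) n ts : K != 0 ->
  exits P (load_all K ins) ts n -> view (ts ord0) 0 w ->
  O (read (ts ord_max)) = nseq (2 + m) true ->
  oracle_computes_in O (oracle_machine P (Decide K)) ins [:: ~~ m] (n + 1 + (size w * 2 + 6)).
Proof.
move=> K0 He Hv HO.
have [||ts2 He2 <-] := @exits_Decide K
  [ffun i => if i == ord_max then load (O (read (ts i))) else ts i] w m K0.
- by rewrite ffunE -val_eqE /= eq_sym (negbTE K0).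
- by rewrite ffunE eqxx HO.
exact: oracle_run He He2.
Qed.

Lemma oracle_computes_in_leq O (M : oracle_TM) ins w n n' :
  oracle_computes_in O M ins w n -> n <= n' -> oracle_computes_in O M ins w n'.
Proof.
rewrite /oracle_computes_in => H /subnK <-; rewrite iterD.
elim: (n' - n) => //= k; case: (iter k _ _) => s t [Hfin Hread].
by rewrite /oracle_step /step Hfin.
Qed.

(** A single query, on the graph of the reduction, whose number is 2 or 3 for every input. *)
Lemma NP_hard_cfc : NP_hard solves_cfc.
Proof.
move=> L /NP_reduction [M [q [r Hred]]].
have [eL HL] := dfn_red_size M q r; have [eB HB] := dfn_red_bit M q r.
pose K := 8 + need eL + need eB.
have [|f pf Hf] := @prog_correct K eL eB K (leqnn _) (leqnn _); first by right.
have [p Hp] := pbound_poly (pbound_add (pbound_add pf (pbound_const 1))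
  (pbound_add (pbound_mul pbound_id (pbound_const 2)) (pbound_const 6))).
exists (oracle_machine (prog K eL eB K) (Decide _)), p => O HO x.
have [ts [He Hr Hv]] := Hf [:: x] isT; rewrite /= addn0 in He.
have [Gs Gc _ G2 G3] := Hred x.
have Eout : output eL eB (nth [::] [:: x]) = encode (red_graph M q r x).
  rewrite (@output_mkseq eL eB (fun g => red_size M q r (g.1 false))
    (fun g => red_bit M q r (g.1 false) (g.2 0)) _ HL HB) /=.
  exact: reduction_encode.
have EK : inord K = ord_max :> 'I_K.+1 by apply: val_inj; rewrite /= inordK.
have HOx : O (read (ts ord_max)) = nseq (2 + (~~ `[< L x >])) true.
  rewrite -EK Hr Eout HO //; congr nseq; case: asboolP => [HLx|NL].
    by rewrite G2.
  by rewrite G3.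
have K0 : K != 0 by rewrite /K; lia.
have := oracle_decide K0 He (Hv (elimN eqP K0)) HOx; rewrite negbK /=.
set n := (f _ + 1 + _) => H.
have Hn : n <= (p.[size x])%R by apply: Hp.
exact: oracle_computes_in_leq H Hn.
Qed.

Theorem theorem3p4 :
  NP_complete (h2_cfc 2) (h2_cfc 3) /\ NP_hard solves_cfc.
Proof.
split; last exact: NP_hard_cfc.
split=> [|L HL]; first exact: NP_h2_cfc2.
have [M [q [r Hred]]] := NP_reduction HL.
exists (reduction M q r); split=> [|x]; first exact: polytime_reduction.
have [Gs Gc Gh G2 G3] := Hred x; rewrite reduction_encode.
split=> Hx; exists (red_order M q r (size x)), (red_graph M q r x); split=> //; [exact: G2 | exact: G3].
Qed.
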